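(* For all real $x\ge 3$, $2\le Q \le x$, $\theta\ge 0$ and all integers $0\le k \le \log x$, we have $$\Xi(f_k, x, Q,\theta) \ll \left(x^{1/2}Q^2 + x^{5/6}Q + x + xQ^2\theta^{1/2}\right)(\log x)^{O(1)},$$ where the implicit constants (both in $\ll$ and in the exponent $O(1)$) are absolute.
   Context: $\Omega(n)$ is the number of prime factors of $n$ counted with multiplicity; $f_k(n) := 1$ if $\Omega(n)=k$ and $0$ otherwise; $\mathrm{e}(\beta) := e^{2i\pi\beta}$; $\phi$ is Euler's totient function. For an arithmetic function $f$, $$\Xi(f, x, Q, \theta) := \sum_{q\le Q} \frac{q}{\phi(q)} \ \sum^*_{\chi \bmod q}\ \max_{|\lambda|\le\theta} \left|\sum_{n\le x} f(n)\chi(n)\, \mathrm{e}(\lambda n)\right|,$$ where $q$ and $n$ run over positive integers, $\lambda$ over real numbers, and $\sum^*_{\chi \bmod q}$ denotes a sum over primitive Dirichlet characters modulo $q$ (for $q=1$ this is the constant character $1$). *)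

(* Defs.v *)
From mathcomp Require Export all_boot all_order all_algebra.
From mathcomp Require Import cyclic.
From mathcomp Require Export all_classical all_reals all_analysis.
From mathcomp Require Export complex.

Set Implicit Arguments.
Unset Strict Implicit.
Unset Printing Implicit Defensive.

Import Order.TTheory GRing.Theory Num.Theory numFieldNormedType.Exports.

Local Open Scope classical_set_scope.
Local Open Scope ring_scope.

Definition bigomega (n : nat) : nat := (\sum_(p <- primes n) logn p n)%N.

Definition omega_ind (R : realType) (k n : nat) : R[i] :=
  (bigomega n == k)%:R.

Definition expi2pi (R : realType) (b : R) : R[i] :=
  Complex (cos (2 * pi * b)) (sin (2 * pi * b)).

(* A Dirichlet character is determined by its values on the natural numbers,
   so it is a function on [nat] rather than on the integers. *)
Record dirichlet_char (R : realType) (q : nat) (chi : nat -> R[i]) : Prop := {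
  dchar_periodic : forall m n, (m = n %[mod q])%N -> chi m = chi n;
  dchar1 : chi 1%N = 1;
  dcharM : forall m n, chi (m * n)%N = chi m * chi n;
  dchar_eq0 : forall n, (chi n == 0) = ~~ coprime n q }.

Definition induced_from (R : realType) (q d : nat) (chi : nat -> R[i]) : Prop :=
  exists2 psi, dirichlet_char d psi & forall n, coprime n q -> chi n = psi n.

Definition primitive_char (R : realType) (q : nat) (chi : nat -> R[i]) : Prop :=
  dirichlet_char q chi /\
  forall d, (d %| q)%N -> (d < q)%N -> ~ induced_from q d chi.

(* [Num.truncn x] is the floor of [x] when [x >= 0], and 0 otherwise. *)
Definition twisted_sum (R : realType) (f chi : nat -> R[i]) (x lambda : R) :
    R[i] :=
  \sum_(1 <= n < (Num.truncn x).+1) f n * chi n * expi2pi (lambda * n%:R).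

(* The maximum over |lambda| <= theta; [max_twisted_sum_attained] below shows
   that this supremum is a maximum. *)
Definition max_twisted_sum (R : realType) (f chi : nat -> R[i]) (x theta : R) :
    R :=
  sup [set ComplexField.Normc.normc (twisted_sum f chi x lambda)
      | lambda in [set lambda : R | `|lambda| <= theta]].

(* [\sum_(chi \in _)] is a sum over a classical set, with the convention that
   it vanishes when infinitely many terms are nonzero; this does not happen for
   q > 0 by [finite_primitive_char]. *)
Definition Xi (R : realType) (f : nat -> R[i]) (x Q theta : R) : R :=
  \sum_(1 <= q < (Num.truncn Q).+1)
     q%:R / (totient q)%:R *
     \sum_(chi \in [set chi : nat -> R[i] | primitive_char q chi])
        max_twisted_sum f chi x theta.

Lemma dirichlet_char_value (R : realType) (q : nat) (chi : nat -> R[i]) n :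
  dirichlet_char q chi -> chi n ^+ (totient q).+1 = chi n.
Proof.
move=> [chiP chi1 chiM chi0].
have [nq|nq] := boolP (coprime n q); last first.
  by move: (chi0 n); rewrite nq => /eqP ->; rewrite exprS mul0r.
have chiX k : chi (n ^ k)%N = chi n ^+ k.
  by elim: k => [|k IH]; rewrite ?expn0 ?expr0// expnS chiM IH exprS.
by rewrite exprS -chiX (chiP _ _ (Euler_exp_totient nq)) chi1 mulr1.
Qed.

Lemma finite_dirichlet_char (R : realType) (q : nat) : (0 < q)%N ->
  finite_set [set chi : nat -> R[i] | dirichlet_char q chi].
Proof.
case: q => // q _.
pose p : {poly R[i]} := 'X^((totient q.+1).+1) - 'X.
have [rs prs] := closed_field_poly_normal p.
have p0 : p != 0.
  apply/eqP => /(congr1 (fun p : {poly R[i]} => p`_(totient q.+1).+1)).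
  rewrite coefB coefXn coefX eqxx coef0 eqSS.
  by rewrite gtn_eqF ?totient_gt0// subr0 => /eqP; rewrite oner_eq0.
have chi_rs chi n : dirichlet_char q.+1 chi -> chi n \in rs.
  move=> /dirichlet_char_value chin; have : root p (chi n).
    by rewrite /root !hornerE chin subrr.
  by rewrite prs rootZ ?lead_coef_eq0// root_prod_XsubC.
pose g (u : {ffun 'I_q.+1 -> 'I_(size rs).+1}) (n : nat) : R[i] :=
  nth 0 rs (u (inord (n %% q.+1))).
apply: (@sub_finite_set _ _ (g @` setT)); last exact/finite_image/finite_finset.
move=> chi /= dchi.
exists [ffun i : 'I_q.+1 => inord (index (chi i) rs)] => //.
apply/funext => n; rewrite /g ffunE inordK ?ltn_pmod// inordK; last first.
  by rewrite ltnS index_size.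
rewrite nth_index ?chi_rs//.
by apply: (dchar_periodic dchi); rewrite modn_mod.
Qed.

Lemma finite_primitive_char (R : realType) (q : nat) : (0 < q)%N ->
  finite_set [set chi : nat -> R[i] | primitive_char q chi].
Proof.
by move=> q0; apply: sub_finite_set (finite_dirichlet_char R q0) => chi [].
Qed.

Lemma max_twisted_sum_attained (R : realType) (f chi : nat -> R[i])
    (x theta : R) : 0 <= theta ->
  exists lambda, [/\ `|lambda| <= theta,
    max_twisted_sum f chi x theta =
      ComplexField.Normc.normc (twisted_sum f chi x lambda) &
    forall mu, `|mu| <= theta ->
      ComplexField.Normc.normc (twisted_sum f chi x mu) <=
      max_twisted_sum f chi x theta].
Proof.
move=> theta0.
pose h l := ComplexField.Normc.normc (twisted_sum f chi x l).
have hE l : h l = Num.sqrt (complex.Re (twisted_sum f chi x l) ^+ 2 +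
                            complex.Im (twisted_sum f chi x l) ^+ 2).
  by rewrite /h; case: twisted_sum.
have ce n : continuous (fun l : R => cos (2 * pi * (l * n%:R))) /\
            continuous (fun l : R => sin (2 * pi * (l * n%:R))).
  have lin : continuous (fun l : R => 2 * pi * (l * n%:R)).
    by move=> l; apply: cvgM; [exact: cvg_cst|apply: cvgM; [|exact: cvg_cst]].
  split=> l; apply: (@continuous_comp _ _ _ (fun l : R => 2 * pi * (l * n%:R))).
  - exact: lin.
  - exact: continuous_cos.
  - exact: lin.
  - exact: continuous_sin.
have cS : continuous (fun l => complex.Re (twisted_sum f chi x l)) /\
          continuous (fun l => complex.Im (twisted_sum f chi x l)).
  rewrite /twisted_sum.
  elim: (index_iota _ _) => [|n s [IHr IHi]].
    have e0 (p : R[i] -> R) : (fun l => p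
        (\sum_(n <- [::]) f n * chi n * expi2pi (l * n%:R))) = fun=> p 0.
      by apply/funext => l; rewrite big_nil.
    by rewrite !e0; split; exact: cst_continuous.
  case: (ce n) => cc cs.
  split.
    have -> : (fun l => complex.Re
        (\sum_(n <- n :: s) f n * chi n * expi2pi (l * n%:R))) =
      (fun l => (complex.Re (f n * chi n) * cos (2 * pi * (l * n%:R)) -
        complex.Im (f n * chi n) * sin (2 * pi * (l * n%:R))) +
        complex.Re (\sum_(n <- s) f n * chi n * expi2pi (l * n%:R))).
      apply/funext => l; rewrite big_cons raddfD /=; congr (_ + _).
      by case: (f n * chi n).
    move=> l; apply: cvgD; last exact: IHr.
    by apply: cvgB; (apply: cvgM; [exact: cvg_cst|]); [exact: cc|exact: cs].
  have -> : (fun l => complex.Im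
        (\sum_(n <- n :: s) f n * chi n * expi2pi (l * n%:R))) =
      (fun l => (complex.Re (f n * chi n) * sin (2 * pi * (l * n%:R)) +
        complex.Im (f n * chi n) * cos (2 * pi * (l * n%:R))) +
        complex.Im (\sum_(n <- s) f n * chi n * expi2pi (l * n%:R))).
    apply/funext => l; rewrite big_cons raddfD /=; congr (_ + _).
    by case: (f n * chi n).
  move=> l; apply: cvgD; last exact: IHi.
  by apply: cvgD; (apply: cvgM; [exact: cvg_cst|]); [exact: cs|exact: cc].
have ch : continuous h.
  pose g l := complex.Re (twisted_sum f chi x l) *
                complex.Re (twisted_sum f chi x l) +
              complex.Im (twisted_sum f chi x l) *
                complex.Im (twisted_sum f chi x l).
  have -> : h = Num.sqrt \o g by apply/funext => l; rewrite hE !expr2.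
  case: cS => cr ci l; apply: continuous_comp; last exact: sqrt_continuous.
  by apply: cvgD; apply: cvgM; [exact: cr|exact: cr|exact: ci|exact: ci].
have le0 : - theta <= theta by rewrite (le_trans _ theta0)// oppr_le0.
have [c cin cmax] := EVT_max le0 (continuous_subspaceT ch).
have ub : ubound [set h l | l in [set l : R | `|l| <= theta]] (h c).
  by move=> _ [l /= lt <-]; apply: cmax; rewrite in_itv /= -ler_norml.
have ct : `|c| <= theta by move: cin; rewrite in_itv /= -ler_norml.
have sE : max_twisted_sum f chi x theta = h c.
  apply/eqP; rewrite eq_le; apply/andP; split.
    by apply: ge_sup => //; exists (h c); exists c.
  by apply: ub_le_sup; [exists (h c)|exists c].
by exists c; split=> // mu mut; rewrite sE; apply: ub; exists mu.
Qed.

(* Main.v *)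
Require Import Defs.
From mathcomp Require Import all_boot all_order all_algebra cyclic.
From mathcomp Require Import all_classical all_reals all_analysis.
From mathcomp Require Import complex.
From mathcomp Require Import ring lra zify.
Set Implicit Arguments.
Unset Strict Implicit.
Unset Printing Implicit Defensive.

Import Order.TTheory GRing.Theory Num.Theory numFieldNormedType.Exports.

Local Open Scope ring_scope.


(** For each primitive character fix a frequency at which its twisted sum is
    largest.  What has to be bounded is then a weighted sum over characters of
    absolute values of finite sums ([prim_sum]).  If theta > 1/2, or if k = 0,
    counting terms is enough, so let theta <= 1/2 and k >= 1.  Put
    X = floor x and Z = floor (X^(1/3)).

    Arithmetic ([omega_decomposition]).  Multiply the prime factors of n > Z in
    increasing order and stop at the first product m that exceeds Z.  If the
    last prime used is at most Z, then Z < m <= Z^2 and n = m l, where l has no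
    prime factor below the largest one of m.  If it exceeds Z, then, as
    n < (Z+1)^3, the cofactor l is 1 or a prime.  The case l = 1 concerns the
    products of some d <= Z with a prime above Z; they appear in the sum over
    d <= Z, d | n, Omega(d) = k - 1, of the indicator that n/d has no prime
    factor <= Z.  There the levels Z, Z - 1, ... are removed one at a time by
    the Buchstab identity ([sieve_identity]): coefficients on integers d <= Z
    are kept, and those that leave this range have just been multiplied by a
    prime <= Z, hence live in (Z, Z^2].  Altogether the indicator of
    Omega(n) = k becomes a sum of O(k) bilinear sums (type II) with a variable
    between Z and (Z+1)^2, whose two variables are otherwise coupled only by a
    comparison of prime factors, plus one sum over divisors m <= Z of n
    (type I).  Coefficients are bounded by the divisor function, up to a
    logarithm, and its mean square is logarithmic ([sum_tau_sqr]).  The n <= Z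
    are too few to matter.

    Type II ([type2_rect], [type2_dyadic]).  Take m < M, l < N and
    |lambda| of size T/(MN).  Cut the two ranges into about T blocks, of
    lengths M/T and N/T.  With m = Ki + r and l = Hj + s, the phase
    lambda m l is lambda K H i j plus two phases of bounded size, and the
    exponentials of the latter separate into products by a binomial expansion
    ([bilinear_core]).  The matrix of the e(lambda K H i j) has squared operator
    norm O(T log) ([matrix_bound]), and on blocks of length K the multiplicative
    large sieve ([large_sieve]) costs K + Q^2.  Up to logarithms this gives the
    square root of MN + Q^2 (M + N) + Q^4 (1 + theta MN), times the norms of the
    coefficients.  The conditions m l <= X and u <= v(l) are separated by binary
    digits ([prim_sum_sep]), at the price of one logarithm each.  For MN of size
    X and M, N at most of size X^(2/3) the result is
    X + Q X^(5/6) + Q^2 X^(1/2) + Q^2 X theta^(1/2).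

    Type I ([type1_conv]).  For m of size D = 2^s, the Polya-Vinogradov bound,
    still valid with a twist of frequency at most 1/(2q), gives
    X + D Q^(5/2), which is acceptable if D <= X/Q^2, because D <= X^(1/3);
    otherwise, or if theta D Q is large, the type II bound already suffices. *)

(** * Complex modulus, Cauchy-Schwarz and elementary trigonometric bounds *)

Notation nrm := (@ComplexField.Normc.normc _).

Section Basics.
Context {R : realType}.
Implicit Types (z w : R[i]) (x y b : R).

Lemma ler_of_eq x y : x = y -> x <= y.
Proof. by move=> ->. Qed.

Lemma nrmE z : (nrm z)%:C%C = `|z|.
Proof. by []. Qed.

Lemma nrm_ge0 z : 0 <= nrm z.
Proof. by case: z => a b; rewrite /= sqrtr_ge0. Qed.

Lemma nrmM z w : nrm (z * w) = nrm z * nrm w.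
Proof. exact: ComplexField.Normc.normcM. Qed.

Lemma nrm0 : nrm (0 : R[i]) = 0.
Proof. exact: ComplexField.Normc.normc0. Qed.

Lemma nrm1 : nrm (1 : R[i]) = 1.
Proof. exact: ComplexField.Normc.normc1. Qed.

Lemma nrmX z n : nrm (z ^+ n) = nrm z ^+ n.
Proof. by elim: n => [|n IH]; rewrite ?expr0 ?nrm1// !exprS nrmM IH. Qed.

Lemma nrm_real x : nrm (x%:C)%C = `|x|.
Proof. by rewrite /= expr0n addr0 sqrtr_sqr. Qed.

Lemma nrm_nat n : nrm (n%:R : R[i]) = n%:R.
Proof. by rewrite -(rmorph_nat (real_complex R)) nrm_real ger0_norm. Qed.

Lemma nrmN z : nrm (- z) = nrm z.
Proof. by rewrite -mulN1r nrmM -(rmorphN1 (real_complex R)) nrm_real normrN1 mul1r. Qed.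

Lemma nrmD z w : nrm (z + w) <= nrm z + nrm w.
Proof. by have := ler_normD z w; rewrite -!nrmE -rmorphD lecR. Qed.

Lemma nrmB z w : nrm (z - w) <= nrm z + nrm w.
Proof. by rewrite -(nrmN w); exact: nrmD. Qed.

Lemma nrm_conj z : nrm (conjc z) = nrm z.
Proof. by case: z => a b /=; rewrite sqrrN. Qed.

Lemma nrm_sum I (r : seq I) (P : pred I) (F : I -> R[i]) :
  nrm (\sum_(i <- r | P i) F i) <= \sum_(i <- r | P i) nrm (F i).
Proof.
elim/big_ind2: _ => [|a x b y ax cy|i _]; rewrite ?nrm0//.
by apply: (le_trans (nrmD _ _)); rewrite lerD.
Qed.

Lemma sqr_nrm z : ((nrm z) ^+ 2)%:C%C = z * conjc z.
Proof.
case: z => a b; rewrite /= sqr_sqrtr ?addr_ge0 ?sqr_ge0//.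
by apply/eqP; rewrite eq_complex /=; apply/andP; split; apply/eqP; ring.
Qed.

Lemma Re_le_nrm z : complex.Re z <= nrm z.
Proof.
case: z => a b /=; apply: (le_trans (ler_norm a)).
by rewrite -sqrtr_sqr ler_wsqrtr// lerDl sqr_ge0.
Qed.

Lemma nrm_le_ReIm z : nrm z <= `|complex.Re z| + `|complex.Im z|.
Proof.
case: z => a b /=; rewrite -[leRHS]ger0_norm ?addr_ge0// -[leRHS]sqrtr_sqr.
rewrite ler_wsqrtr// sqrrD !real_normK ?num_real// lerD2r lerDl.
by rewrite mulrn_wge0// mulr_ge0.
Qed.

(** Lagrange identity: twice the defect is a sum of squares. *)
Lemma cauchy_schwarz I (r : seq I) (f g : I -> R) :
  (\sum_(i <- r) f i * g i) ^+ 2 <=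
  (\sum_(i <- r) f i ^+ 2) * (\sum_(i <- r) g i ^+ 2).
Proof.
rewrite -subr_ge0 -(pmulr_rge0 _ (ltr0n R 2)).
suff -> : 2 * ((\sum_(i <- r) f i ^+ 2) * (\sum_(i <- r) g i ^+ 2) -
    (\sum_(i <- r) f i * g i) ^+ 2) =
  \sum_(i <- r) \sum_(j <- r) (f i * g j - f j * g i) ^+ 2.
  by apply: sumr_ge0 => i _; apply: sumr_ge0 => j _; exact: sqr_ge0.
have E1 : (\sum_(i <- r) f i ^+ 2) * (\sum_(i <- r) g i ^+ 2) =
    \sum_(i <- r) \sum_(j <- r) f i ^+ 2 * g j ^+ 2 by rewrite big_distrlr.
have E2 : (\sum_(i <- r) f i ^+ 2) * (\sum_(i <- r) g i ^+ 2) =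
    \sum_(i <- r) \sum_(j <- r) g i ^+ 2 * f j ^+ 2.
  by rewrite mulrC big_distrlr.
rewrite mulrBr mulr_natl mulr2n {1}E1 E2 expr2 big_distrlr /= mulr_sumr.
rewrite -big_split/= -sumrB; apply: eq_bigr => i _.
rewrite -big_split/= mulr_sumr -sumrB; apply: eq_bigr => j _; ring.
Qed.

Lemma cauchy_schwarz_sqrt I (r : seq I) (f g : I -> R) :
  \sum_(i <- r) f i * g i <=
  Num.sqrt (\sum_(i <- r) f i ^+ 2) * Num.sqrt (\sum_(i <- r) g i ^+ 2).
Proof.
rewrite -sqrtrM; last by apply: sumr_ge0 => i _; exact: sqr_ge0.
apply: (le_trans (ler_norm _)).
by rewrite -sqrtr_sqr ler_wsqrtr// cauchy_schwarz.
Qed.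

Lemma sqr_sum_le I (r : seq I) (f : I -> R) :
  (\sum_(i <- r) f i) ^+ 2 <= (size r)%:R * \sum_(i <- r) f i ^+ 2.
Proof.
have := cauchy_schwarz r (fun=> 1) f.
under eq_bigr do rewrite mul1r.
suff -> : \sum_(i <- r) 1 ^+ 2 = (size r)%:R :> R by [].
by rewrite -sum1_size natr_sum; apply: eq_bigr => *; rewrite expr1n.
Qed.

Lemma ge0_of_derive (f df : R -> R) :
  (forall x, is_derive x 1 f (df x)) -> f 0 = 0 ->
  (forall x, 0 <= x -> 0 <= df x) -> forall x, 0 <= x -> 0 <= f x.
Proof.
move=> fd f0 df0 x x0.
have cf : {within `[0, x], continuous f}%classic.
  apply: continuous_subspaceT => y; apply: differentiable_continuous.
  by apply/derivable1_diffP; case: (fd y).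
have [c cx] := @MVT_segment R f df 0 x x0 (fun y _ => fd y) cf.
rewrite f0 !subr0 => ->; apply: mulr_ge0 => //; apply: df0.
by move: cx; rewrite in_itv/= => /andP[].
Qed.

Lemma sin_le_id x : 0 <= x -> sin x <= x.
Proof.
move=> x0; rewrite -subr_ge0.
apply: (@ge0_of_derive (fun x => x - sin x) (fun x => 1 - cos x)) => //.
- by rewrite sin0 subr0.
Qed.

Lemma cos_ge_quad x : 0 <= x -> 1 - x ^+ 2 / 2 <= cos x.
Proof.
move=> x0; rewrite -subr_ge0.
apply: (@ge0_of_derive (fun x => cos x - (1 - x ^+ 2 / 2)) (fun x => x - sin x)) => //.
- move=> y; apply: is_derive_eq.
  rewrite /GRing.scale/= ?exprS ?expr0 ?mulr1 ?expr1n. lra.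
- by rewrite cos0 expr0n/= mul0r subr0 subrr.
- by move=> y y0; rewrite subr_ge0 sin_le_id.
Qed.

Lemma sin_ge_cub x : 0 <= x -> x - x ^+ 3 / 6 <= sin x.
Proof.
move=> x0; rewrite -subr_ge0.
apply: (@ge0_of_derive (fun x => sin x - (x - x ^+ 3 / 6))
   (fun x => cos x - (1 - x ^+ 2 / 2))) => //.
- move=> y; apply: is_derive_eq.
  rewrite /GRing.scale/=; lra.
- by rewrite sin0 expr0n/= mul0r subr0 subrr.
- by move=> y y0; rewrite subr_ge0 cos_ge_quad.
Qed.

End Basics.

(** * The additive character *)

Section Expi.
Context {R : realType}.
Implicit Types (z w : R[i]) (x y b : R).
Local Notation e := (@expi2pi R).

Lemma conjcM z w : conjc (z * w) = conjc z * conjc w.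
Proof. by rewrite rmorphM. Qed.

Lemma conjc_sum I (r : seq I) (P : pred I) (F : I -> R[i]) :
  conjc (\sum_(i <- r | P i) F i) = \sum_(i <- r | P i) conjc (F i).
Proof. by rewrite rmorph_sum. Qed.

Lemma expiD x y : e (x + y) = e x * e y.
Proof.
rewrite /expi2pi mulrDr cosD sinD; apply/eqP.
by rewrite eq_complex /=; apply/andP; split; apply/eqP; ring.
Qed.

Lemma expi0 : e 0 = 1.
Proof. by rewrite /expi2pi mulr0 cos0 sin0. Qed.

Lemma expiN x : e (- x) = conjc (e x).
Proof. by rewrite /expi2pi mulrN cosN sinN. Qed.

Lemma nrm_expi x : nrm (e x) = 1.
Proof. by rewrite /= cos2Dsin2 sqrtr1. Qed.

Lemma expiMn x n : e (x * n%:R) = e x ^+ n.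
Proof.
elim: n => [|n IH]; first by rewrite mulr0 expi0.
by rewrite exprS -IH -expiD mulrS mulrDr mulr1.
Qed.

Lemma expi1 : e 1 = 1.
Proof. by rewrite /expi2pi mulr1 mulr_natl cos2pi sin2pi. Qed.

Lemma expi_nat n : e n%:R = 1.
Proof. by rewrite -[n%:R]mul1r expiMn expi1 expr1n. Qed.

Lemma expi_periodic x n : e (x + n%:R) = e x.
Proof. by rewrite expiD expi_nat mulr1. Qed.

Lemma nrm_1Bexpi x : nrm (1 - e x) = 2 * `|sin (pi * x)|.
Proof.
rewrite /= add0r sqrrN.
have -> : (1 - cos (2 * pi * x)) ^+ 2 + sin (2 * pi * x) ^+ 2 =
   (2 * `|sin (pi * x)|) ^+ 2.
  rewrite exprMn real_normK ?num_real//.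
  have -> : 2 * pi * x = (pi * x) *+ 2 by rewrite mulr2n; ring.
  rewrite cos_mulr2n sin_mulr2n cos2sin2 !mulr2n.
  have := cos2Dsin2 (pi * x); set c := cos _; set s := sin _ => cs.
  have c2 : c ^+ 2 = 1 - s ^+ 2 by rewrite -cs addrK.
  have -> : (c * s + c * s) ^+ 2 = 4 * c ^+ 2 * s ^+ 2 by ring.
  by rewrite c2; ring.
by rewrite sqrtr_sqr ger0_norm// mulr_ge0.
Qed.

Lemma sin_ge_third x : 0 <= x <= 2 -> x / 3 <= sin x.
Proof.
move=> /andP[x0 x2]; apply: le_trans (sin_ge_cub x0).
have : x ^+ 2 <= 4 by rewrite expr2; nra.
move=> x4; have -> : x - x ^+ 3 / 6 = x * (1 - x ^+ 2 / 6) by rewrite !exprS; lra.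
by apply: ler_wpM2l => //; lra.
Qed.

(** The denominator of geometric sums of [expi2pi]: the chord is at least the
    distance to the nearest integer. *)
Lemma nrm_1Bexpi_ge x : `|x| <= 2^-1 -> `|x| <= nrm (1 - e x).
Proof.
move=> xh; rewrite nrm_1Bexpi.
wlog x0 : x xh / 0 <= x.
  move=> W; have [x0|x0] := leP 0 x; first exact: W.
  have := W (- x); rewrite normrN mulrN sinN normrN; apply => //.
  by rewrite oppr_ge0 ltW.
move: xh; rewrite (ger0_norm x0) => xh.
have := @pi_ge2 R; have := @pihalf_lt2 R; set p := pi => p4 p2.
have px0 : 0 <= p * x by apply: mulr_ge0 => //; lra.
have px2 : p * x <= 2 by nra.
have := @sin_ge_third (p * x); rewrite px0 px2 => /(_ isT) H.
have := ler_norm (sin (p * x)); nra.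
Qed.

(** An average of points of the circle with angles at most 1/8 of a turn
    cannot be small; this keeps the weights of the large sieve away from 0. *)
Lemma Re_expi_ge_half x : 0 <= x -> x <= 8^-1 -> 2^-1 <= complex.Re (e x).
Proof.
move=> x0 x8 /=.
have := @pi_ge2 R; have := @pihalf_lt2 R; set p := pi => p4 p2.
have px0 : 0 <= 2 * p * x by apply: mulr_ge0 => //; lra.
have px1 : 2 * p * x <= 1 by nra.
have := cos_ge_quad px0.
have : (2 * p * x) ^+ 2 <= 1 by rewrite expr_le1.
lra.
Qed.

Local Notation ii := (0 +i* 1)%C.

Lemma expi_taylor1 x : `|2 * pi * x| <= 1 ->
  nrm (e x - (1 + (2 * pi * x)%:C%C * ii)) <= (2 * pi * x) ^+ 2.
Proof.
set y := 2 * pi * x => y1.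
apply: (le_trans (nrm_le_ReIm _)).
rewrite /expi2pi -/y /= !(mulr0,mul0r,mulr1,addr0,subr0,add0r,oppr0).
wlog y0 : y y1 / 0 <= y.
  move=> W; have [y0|y0] := leP 0 y; first exact: W.
  have := W (- y); rewrite cosN sinN normrN -opprD normrN sqrrN; apply => //.
  by rewrite oppr_ge0 ltW.
move: y1; rewrite ger0_norm// => y1.
have c1 := cos_le1 y; have c2 := cos_ge_quad y0.
have s1 := sin_le_id y0; have s2 := sin_ge_cub y0.
rewrite distrC (distrC _ y) !ger0_norm ?subr_ge0//.
have : y ^+ 3 <= y ^+ 2 by rewrite (exprS _ 2) ler_piMl ?sqr_ge0.
have := sqr_ge0 y.
lra.
Qed.

End Expi.

Arguments expi2pi : simpl never.
Arguments conjc : simpl never.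
Arguments ComplexField.Normc.normc : simpl never.

(** * Parseval on Z/L *)

Section Parseval.
Context {R : realType}.
Local Notation e := (@expi2pi R).

Lemma expi_neq1 (x : R) : 0 < x < 1 -> e x != 1.
Proof.
move=> /andP[x0 x1]; apply/eqP => ex1.
have [xh|xh] := leP x 2^-1.
  have := @nrm_1Bexpi_ge R x; rewrite ex1 subrr nrm0 (ger0_norm (ltW x0)).
  by move=> /(_ xh); rewrite leNgt x0.
have := @nrm_1Bexpi_ge R (x - 1).
have -> : e (x - 1) = 1 by rewrite expiD expiN expi1 ex1 conjc1 mulr1.
rewrite subrr nrm0 distrC ger0_norm; last by rewrite subr_ge0 ltW.
move=> H.
have : 1 - x <= 2^-1 by lra.
by move=> /H; rewrite leNgt subr_gt0 x1.
Qed.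

Lemma expi_modn q m n : (0 < q)%N -> (m = n %[mod q])%N ->
  e (m%:R / q%:R) = e (n%:R / q%:R).
Proof.
move=> q0; suff H k : e (k%:R / q%:R) = e ((k %% q)%N%:R / q%:R).
  by move=> mn; rewrite H mn -H.
rewrite {1}(divn_eq k q) natrD mulrDl natrM mulfK ?pnatr_eq0 -?lt0n//.
by rewrite addrC expi_periodic.
Qed.

Lemma sum_expi_grid (L r s : nat) : (r < L)%N -> (s < L)%N ->
  \sum_(g < L) e ((g * r)%:R / L%:R) * conjc (e ((g * s)%:R / L%:R)) =
  (r == s)%:R * L%:R.
Proof.
move=> rL sL; have L0 : (0 < L)%N by apply: leq_ltn_trans rL.
have Ln0 : (L%:R : R) != 0 by rewrite pnatr_eq0 -lt0n.
pose w := e ((r%:R - s%:R) / L%:R).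
transitivity (\sum_(g < L) w ^+ g).
  apply: eq_bigr => g _; rewrite -expiN -expiD -expiMn; congr (e _).
  by rewrite !natrM; field.
have [rs|rs] := eqVneq r s.
  rewrite /w rs subrr mul0r expi0 mul1r.
  under eq_bigr do rewrite expr1n.
  by rewrite sumr_const card_ord.
have w1 : w != 1.
  wlog lt_rs : r s rL sL rs @w / (s < r)%N.
    move=> W; case: (ltngtP r s) rs => [lt _|lt _|//].
      have := W s r sL rL; rewrite neq_ltn lt orbT => /(_ isT isT).
      rewrite /w -[in X in _ -> X]opprB mulNr expiN; apply: contraNN => /eqP H.
      by rewrite -[e _]conjcK H conjc1.
    by apply: W => //; rewrite neq_ltn lt orbT.
  apply: expi_neq1; rewrite /w -natrB; last exact: ltnW.
  apply/andP; split; first by rewrite divr_gt0 ?ltr0n ?subn_gt0.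
  by rewrite ltr_pdivrMr ?ltr0n// mul1r ltr_nat (leq_ltn_trans _ rL)// leq_subr.
have wL : w ^+ L = 1.
  rewrite -expiMn mulfVK// expiD expiN !expi_nat conjc1 mulr1//.
rewrite mul0r; have := subrX1 w L; rewrite wL subrr => /esym/eqP.
by rewrite mulf_eq0 subr_eq0 (negbTE w1) => /eqP.
Qed.

(** The functions g -> e(g r / L), r < L, are orthogonal on Z/L; sums with
    fewer than L terms are handled without periodic extension. *)
Lemma parseval (L K : nat) (c : nat -> R[i]) : (0 < L)%N -> (K <= L)%N ->
  \sum_(g < L) nrm (\sum_(r < K) c r * e ((g * r)%:R / L%:R)) ^+ 2 =
  L%:R * \sum_(r < K) nrm (c r) ^+ 2.
Proof.
move=> L0 KL; apply: (@complexI R); rewrite rmorph_sum rmorphM rmorph_sum/=.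
under eq_bigr => g _.
  rewrite sqr_nrm conjc_sum big_distrlr/=.
  under eq_bigr => r _ do under eq_bigr => s _ do rewrite conjcM mulrACA.
  over.
rewrite exchange_big/= rmorph_nat mulr_sumr; apply: eq_bigr => r _.
rewrite exchange_big/= (bigD1 r)//= -mulr_sumr sum_expi_grid ?(leq_trans _ KL)//.
rewrite eqxx mul1r big1 ?addr0; first by rewrite sqr_nrm mulrC.
move=> s sr; rewrite -mulr_sumr sum_expi_grid ?(leq_trans _ KL)//.
by rewrite eq_sym (_ : (_ == _) = false) ?mul0r ?mulr0//; exact/negbTE.
Qed.

End Parseval.

(** * Dirichlet characters *)

Section Characters.
Context {R : realType}.
Local Notation e := (@expi2pi R).
Implicit Types (chi psi : nat -> R[i]).

Lemma sum_mul_residue (V : nmodType) (q c : nat) (F : nat -> V) :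
  (0 < q)%N -> coprime c q -> (forall m n, (m = n %[mod q])%N -> F m = F n) ->
  \sum_(a < q) F (c * a)%N = \sum_(a < q) F a.
Proof.
move=> q0 cq per; pose h (a : 'I_q) := Ordinal (ltn_pmod (c * a) q0).
have hinj : injective h.
  move=> a b /(congr1 val) /= /eqP.
  wlog ab : a b / (a <= b)%N.
    move=> W; have [/W//|/ltnW/W H] := leqP a b.
    by rewrite eq_sym => /H ->.
  rewrite eq_sym eqn_mod_dvd ?leq_mul// -mulnBr Gauss_dvdr 1?coprime_sym// => d.
  apply/val_inj/eqP; rewrite eqn_leq ab -subn_eq0 /=.
  by have := gtnNdvd _ (leq_ltn_trans (leq_subr a b) (ltn_ord b)); case: (b - a)%N d => // k dk /(_ isT); rewrite dk.
rewrite [RHS](reindex_inj hinj)/=; apply: eq_bigr => a _.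
by apply: per; rewrite modn_mod.
Qed.

Lemma dchar_eq0P q chi n : dirichlet_char q chi -> ~~ coprime n q -> chi n = 0.
Proof. by move=> dchi nq; apply/eqP; rewrite (dchar_eq0 dchi). Qed.

Lemma nrm_dchar q chi n : dirichlet_char q chi -> coprime n q -> (0 < q)%N ->
  nrm (chi n) = 1.
Proof.
move=> dchi nq q0; have := dirichlet_char_value n dchi; rewrite exprS => H.
have chin0 : chi n != 0 by rewrite (dchar_eq0 dchi) nq.
have : chi n ^+ totient q = 1.
  by apply: (mulfI chin0); rewrite H mulr1.
move=> /(congr1 nrm); rewrite nrmX nrm1 => /eqP.
by rewrite pexprn_eq1 ?nrm_ge0 ?totient_gt0// gtn_eqF ?totient_gt0//= => /eqP.
Qed.

Lemma nrm_dchar_le1 q chi n : dirichlet_char q chi -> (0 < q)%N ->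
  nrm (chi n) <= 1.
Proof.
move=> dchi q0; have [nq|nq] := boolP (coprime n q).
  by rewrite (nrm_dchar dchi).
by rewrite (dchar_eq0P dchi nq) nrm0.
Qed.

Lemma totientE (q : nat) : (totient q)%:R = \sum_(a < q) (coprime a q)%:R :> R.
Proof.
rewrite totient_count_coprime big_mkord natr_sum.
by apply: eq_bigr => a _; rewrite coprime_sym.
Qed.

Lemma dchar_norm2 q chi : dirichlet_char q chi -> (0 < q)%N ->
  \sum_(a < q) chi a * conjc (chi a) = (totient q)%:R.
Proof.
move=> dchi q0; rewrite -(rmorph_nat (real_complex R)) totientE rmorph_sum/=.
apply: eq_bigr => a _; rewrite -sqr_nrm rmorph_nat.
have [aq|aq] := boolP (coprime a q); first by rewrite (nrm_dchar dchi)// expr1n.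
by rewrite (dchar_eq0P dchi aq) nrm0 expr0n.
Qed.

(** Translating the summation variable by an n with chi(n) <> psi(n)
    multiplies the sum by a factor other than 1. *)
Lemma dchar_orth q chi psi : dirichlet_char q chi -> dirichlet_char q psi ->
  (0 < q)%N -> chi <> psi -> \sum_(a < q) chi a * conjc (psi a) = 0.
Proof.
move=> dchi dpsi q0 cp.
have [n neq] : exists n, chi n != psi n.
  apply: contrapT => H; apply: cp; apply/funext => n; apply/eqP/negPn/negP => ne.
  by apply: H; exists n.
have nq : coprime n q.
  apply: contraNT neq => nq.
  by rewrite (dchar_eq0P dchi nq) (dchar_eq0P dpsi nq).
set S := \sum_(_ < _) _.
have : chi n * conjc (psi n) * S = S.
  transitivity (\sum_(a < q) chi (n * a)%N * conjc (psi (n * a)%N)).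
    rewrite mulr_sumr; apply: eq_bigr => a _.
    by rewrite (dcharM dchi) (dcharM dpsi) rmorphM /=; ring.
  apply: (@sum_mul_residue _ q n (fun a => chi a * conjc (psi a))) => //.
  by move=> a b ab; rewrite (dchar_periodic dchi ab) (dchar_periodic dpsi ab).
move=> /eqP; rewrite -subr_eq0 -[X in _ - X]mul1r -mulrBl mulf_eq0 => /orP[|/eqP//].
rewrite subr_eq0 => /eqP H; case/negP: neq; apply/eqP.
have := sqr_nrm (psi n); rewrite (nrm_dchar dpsi)// expr1n rmorph1 => H2.
by rewrite -[LHS]mulr1 H2 mulrCA H mulr1.
Qed.

(** Bessel inequality for the orthogonal characters mod q. It is derived by
    duality: S = sum_a T(a) c(a), while orthogonality computes the square mean
    of T as phi(q) S. *)
Lemma dchar_bessel q (s : seq (nat -> R[i])) (c : nat -> R[i]) : (0 < q)%N ->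
  uniq s -> (forall chi, chi \in s -> dirichlet_char q chi) ->
  \sum_(chi <- s) nrm (\sum_(a < q) chi a * c a) ^+ 2 <=
  (totient q)%:R * \sum_(a < q | coprime a q) nrm (c a) ^+ 2.
Proof.
move=> q0 us sP; pose b chi := \sum_(a < q) chi a * c a.
pose S := \sum_(chi <- s) nrm (b chi) ^+ 2; rewrite -/S.
have S0 : 0 <= S by apply: sumr_ge0 => *; exact: sqr_ge0.
pose T a := \sum_(chi <- s) conjc (b chi) * chi a.
have E1 : S%:C%C = \sum_(a < q) T a * c a.
  rewrite rmorph_sum/=; under eq_bigr do rewrite sqr_nrm mulrC {2}/b mulr_sumr.
  rewrite exchange_big/=; apply: eq_bigr => a _; rewrite mulr_suml.
  by apply: eq_bigr => chi _; rewrite mulrA.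
(* Only the diagonal survives, by orthogonality. *)
have E2 : \sum_(a < q) nrm (T a) ^+ 2 = (totient q)%:R * S.
  apply: (@complexI R); rewrite rmorph_sum rmorphM/= rmorph_nat rmorph_sum/=.
  under eq_bigr => a _.
    rewrite sqr_nrm conjc_sum big_distrlr/=.
    under eq_bigr => i _ do under eq_bigr => j _ do
      rewrite conjcM conjcK mulrACA.
    over.
  rewrite exchange_big/= mulr_sumr; rewrite big_seq [RHS]big_seq.
  apply: eq_bigr => i si; rewrite exchange_big/= (bigD1_seq i)//=.
  rewrite -mulr_sumr dchar_norm2//; last exact: sP.
  rewrite big_seq_cond big1 ?addr0 => [|j /andP[sj ji]].
    by rewrite mulrC sqr_nrm; congr (_ * _); rewrite mulrC.
  rewrite -mulr_sumr dchar_orth ?mulr0//; [exact: sP|exact: sP|].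
  by move=> ij; rewrite ij eqxx in ji.
(* T vanishes off the units mod q, so only coprime residues matter. *)
have E3 : S ^+ 2 <= (\sum_(a < q) nrm (T a) ^+ 2) *
                    (\sum_(a < q | coprime a q) nrm (c a) ^+ 2).
  pose d (a : 'I_q) := if coprime a q then nrm (c a) else 0.
  have -> : \sum_(a < q | coprime a q) nrm (c a) ^+ 2 = \sum_(a < q) d a ^+ 2.
    rewrite big_mkcond; apply: eq_bigr => a _; rewrite /d.
    by case: ifP => // _; rewrite expr0n.
  apply: le_trans (cauchy_schwarz _ _ _).
  rewrite lerXn2r ?nnegrE//.
    by apply: sumr_ge0 => a _; rewrite mulr_ge0 ?nrm_ge0// /d; case: ifP; rewrite ?nrm_ge0.
  have -> : S = nrm (S%:C)%C by rewrite nrm_real ger0_norm.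
  rewrite E1; apply: (le_trans (nrm_sum _ _ _)); apply: ler_sum => a _.
  rewrite nrmM /d; case: ifPn => // aq.
  suff -> : T a = 0 by rewrite nrm0 mul0r mulr0.
  rewrite /T big_seq big1// => chi /sP dchi.
  by rewrite (dchar_eq0P dchi aq) mulr0.
move: E3; rewrite E2 mulrAC expr2.
by have [->|Sp] := eqVneq S 0; [rewrite !mulr_ge0//; apply: sumr_ge0 => *; exact: sqr_ge0|rewrite ler_pM2r// lt_def Sp].
Qed.

End Characters.

(** * Gauss sums of primitive characters *)

Section GaussSums.
Context {R : realType}.
Local Notation e := (@expi2pi R).
Implicit Types (chi psi : nat -> R[i]).

(** Surjectivity of the units mod q onto the units mod d: add to n the
    multiple of d whose prime factors are the primes of q not dividing n. *)
Lemma coprime_lift n d q : (0 < q)%N -> (d %| q)%N -> coprime n d ->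
  exists m, (m = n %[mod d])%N /\ coprime m q.
Proof.
move=> q0 dq nd; pose t := (\prod_(p <- primes q | ~~ (p %| n)%N) p)%N.
exists (n + d * t)%N; split; first by rewrite addnC mulnC modnMDl.
rewrite coprime_sym coprime_has_primes//; last first.
  have [->|n0] := posnP n; last by rewrite addn_gt0 n0.
  have d0 : (0 < d)%N by apply: dvdn_gt0 dq.
  rewrite muln_gt0 d0/= /t big_seq_cond prodn_cond_gt0// => p /andP[].
  by rewrite mem_primes => /andP[/prime_gt0].
apply/hasPn => p; rewrite !mem_primes => /and3P[pp _ pnt].
rewrite pp q0/=; apply/negP => pq.
have [pn|pn] := boolP (p %| n)%N.
  move: pnt; rewrite dvdn_addr// Euclid_dvdM// => /orP[pd|].
    have : (p %| gcdn n d)%N by rewrite dvdn_gcd pn.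
    by move: nd; rewrite /coprime => /eqP ->; rewrite Euclid_dvd1.
  rewrite /t big_seq_cond; elim/big_ind: _ => [|a b IHa IHb|r /andP[]].
  - by rewrite Euclid_dvd1.
  - by rewrite Euclid_dvdM// => /orP[].
  - rewrite mem_primes => /and3P[rp _ _] rn.
    by rewrite dvdn_prime2// => /eqP pr; rewrite -pr pn in rn.
have : (p %| t)%N.
  rewrite /t -big_filter (bigD1_seq p)/= ?filter_uniq ?primes_uniq//; last first.
    by rewrite mem_filter pn mem_primes pp q0.
  by rewrite dvdn_mulr.
by move=> pt; move: pnt; rewrite dvdn_addl ?(negbTE pn)// dvdn_mull.
Qed.

(** A character mod q that is 1 on the kernel of reduction mod d factors
    through the units mod d. This turns primitivity into the existence of a c
    = 1 mod d, coprime to q, with chi(c) <> 1. *)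
Lemma induced_of_trivial q d chi : (0 < q)%N -> (d %| q)%N ->
  dirichlet_char q chi ->
  (forall c, coprime c q -> (c = 1 %[mod d])%N -> chi c = 1) ->
  induced_from q d chi.
Proof.
move=> q0 dq dchi triv.
have key m n : coprime m q -> coprime n q -> (m = n %[mod d])%N -> chi m = chi n.
  move=> mq nq mn; pose u := (n ^ (totient q).-1)%N.
  have nu : (n * u = 1 %[mod q])%N.
    by rewrite -expnS prednK ?totient_gt0// Euler_exp_totient.
  have nud : (n * u = 1 %[mod d])%N.
    by rewrite -(modn_dvdm _ dq) nu modn_dvdm.
  have uq : coprime u q by rewrite coprimeXl.
  have mu1 : chi (m * u)%N = 1.
    apply: triv; first by rewrite coprimeMl mq.
    by rewrite -modnMml mn modnMml.
  rewrite -[RHS]mul1r -mu1 -(dcharM dchi); apply: (dchar_periodic dchi).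
  by rewrite -mulnA [(u * n)%N]mulnC -modnMmr nu modnMmr muln1.
pose lft n := if pselect (coprime n d) is left nd
  then sval (cid (coprime_lift q0 dq nd)) else 0%N.
have lftP n : coprime n d -> (lft n = n %[mod d])%N /\ coprime (lft n) q.
  by move=> nd; rewrite /lft; case: pselect => // nd'; case: cid.
pose psi n := if coprime n d then chi (lft n) else 0.
have cong_cop m n : (m = n %[mod d])%N -> coprime m d = coprime n d.
  by move=> mn; rewrite -coprime_modl mn coprime_modl.
exists psi; first split.
- move=> m n mn; rewrite /psi (cong_cop _ _ mn); case: ifPn => // nd.
  have [n1 n2] := lftP _ nd.
  rewrite -(cong_cop _ _ mn) in nd; have [m1 m2] := lftP _ nd.
  by apply: key => //; rewrite m1 mn.
- rewrite /psi coprime1n; have [m1 m2] := lftP _ (coprime1n d).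
  by rewrite -(dchar1 dchi); apply: key => //; rewrite coprime1n.
- move=> m n; rewrite /psi coprimeMl; case: (boolP (coprime m d)) => md/=; last by rewrite mul0r.
  case: (boolP (coprime n d)) => nd; last by rewrite mulr0.
  have [m1 m2] := lftP _ md; have [n1 n2] := lftP _ nd.
  have [|p1 p2] := lftP (m * n)%N; first by rewrite coprimeMl md.
  rewrite -(dcharM dchi); apply: key => //; first by rewrite coprimeMl m2.
  by rewrite p1 -modnMm -m1 -n1 modnMm.
- move=> n; rewrite /psi; case: ifPn => nd; rewrite ?eqxx//.
  by rewrite (dchar_eq0 dchi) (lftP _ nd).2.
- move=> n nq; have nd : coprime n d by apply: coprime_dvdr nq.
  rewrite /psi nd; have [n1 n2] := lftP _ nd.
  by apply: key.
Qed.

Definition gauss_sum q chi (n : nat) : R[i] :=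
  \sum_(a < q) chi a * e ((a * n)%:R / q%:R).

Lemma gauss_sumM q chi n : (0 < q)%N -> dirichlet_char q chi -> coprime n q ->
  chi n * gauss_sum q chi n = gauss_sum q chi 1.
Proof.
move=> q0 dchi nq; rewrite /gauss_sum mulr_sumr.
transitivity (\sum_(a < q) chi (n * a)%N * e ((n * a)%:R / q%:R)).
  by apply: eq_bigr => a _; rewrite (dcharM dchi) mulrA [(a * n)%N]mulnC.
rewrite (@sum_mul_residue _ q n (fun a => chi a * e (a%:R / q%:R)))//.
  by apply: eq_bigr => a _; rewrite muln1.
by move=> a b ab; rewrite (dchar_periodic dchi ab) (expi_modn q0 ab).
Qed.

(** With g = gcd(n, q) > 1, the phase a n / q depends on a mod q/g only;
    primitivity provides a c = 1 mod q/g with chi(c) <> 1, and a -> c a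
    multiplies the sum by chi(c). *)
Lemma gauss_sum_primitive0 q chi n : (0 < q)%N -> primitive_char q chi ->
  ~~ coprime n q -> gauss_sum q chi n = 0.
Proof.
move=> q0 [dchi prim] nq; pose g := gcdn n q; pose d := (q %/ g)%N.
have gq : (g %| q)%N by rewrite dvdn_gcdr.
have g0 : (0 < g)%N by rewrite gcdn_gt0 q0 orbT.
have g1 : (1 < g)%N.
  by rewrite ltn_neqAle g0 andbT eq_sym; move: nq; rewrite /coprime.
have dg : (d * g = q)%N by rewrite divnK.
have dq : (d %| q)%N by rewrite -dg dvdn_mulr.
have dltq : (d < q)%N by rewrite ltn_Pdiv.
have [c [cq cd chic]] : exists c, [/\ coprime c q, (c = 1 %[mod d])%N & chi c != 1].
  apply: contrapT => H; apply: (prim d dq dltq).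
  apply: induced_of_trivial => // c cq cd; apply/eqP/negPn/negP => cc.
  by apply: H; exists c.
have : chi c * gauss_sum q chi n = gauss_sum q chi n.
  rewrite /gauss_sum mulr_sumr.
  transitivity (\sum_(a < q) chi (c * a)%N * e (((c * a) * n)%:R / q%:R)).
    apply: eq_bigr => a _; rewrite (dcharM dchi) mulrA; congr (_ * _).
    apply: expi_modn => //.
    have [k nk] : exists k, n = (k * g)%N by exists (n %/ g)%N; rewrite divnK ?dvdn_gcdl.
    move: (nat_of_ord a) => {}a; rewrite nk -dg !mulnA -!muln_modl; congr (_ * _)%N.
    by rewrite -[in RHS]mulnA -[RHS]modnMml cd modnMml mul1n.
  rewrite (@sum_mul_residue _ q c (fun a => chi a * e ((a * n)%:R / q%:R)))//.
  move=> a b ab; rewrite (dchar_periodic dchi ab); congr (_ * _).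
  by apply: expi_modn => //; rewrite -modnMml ab modnMml.
move=> /eqP; rewrite -subr_eq0 -[X in _ - X]mul1r -mulrBl mulf_eq0 subr_eq0.
by rewrite (negbTE chic) => /eqP.
Qed.

Lemma gauss_sum_primitive q chi n : (0 < q)%N -> primitive_char q chi ->
  gauss_sum q chi n = conjc (chi n) * gauss_sum q chi 1.
Proof.
move=> q0 pchi; have dchi := pchi.1.
have [nq|nq] := boolP (coprime n q); last first.
  by rewrite gauss_sum_primitive0// (dchar_eq0P dchi nq) conjc0 mul0r.
rewrite -(gauss_sumM q0 dchi nq) mulrA [conjc _ * _]mulrC -sqr_nrm.
by rewrite (nrm_dchar dchi)// expr1n rmorph1 mul1r.
Qed.

(** Parseval on Z/q applied to chi, whose Fourier transform is conj(chi) times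
    the Gauss sum. *)
Lemma nrm_gauss_sum q chi : (0 < q)%N -> primitive_char q chi ->
  nrm (gauss_sum q chi 1) ^+ 2 = q%:R.
Proof.
move=> q0 pchi; have dchi := pchi.1.
have t0 : ((totient q)%:R : R) != 0 by rewrite pnatr_eq0 -lt0n totient_gt0.
have E : \sum_(a < q) nrm (chi a) ^+ 2 = (totient q)%:R.
  apply: (@complexI R); rewrite rmorph_sum/= rmorph_nat -(dchar_norm2 dchi q0).
  by apply: eq_bigr => a _; rewrite sqr_nrm.
have := @parseval R q q chi q0 (leqnn q).
under eq_bigr => n _.
  rewrite (_ : \sum_(_ < _) _ = gauss_sum q chi n); last first.
    by apply: eq_bigr => a _; rewrite [(n * a)%N]mulnC.
  rewrite gauss_sum_primitive// nrmM nrm_conj exprMn.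
  over.
rewrite -mulr_suml E mulrC => H.
by apply: (mulIf t0).
Qed.

Definition prim_chars q : seq (nat -> R[i]) :=
  finmap.enum_fset (fset_set [set chi : nat -> R[i] | primitive_char q chi]%classic).

Lemma prim_charsP q chi : (0 < q)%N ->
  chi \in prim_chars q -> primitive_char q chi.
Proof.
move=> q0; rewrite in_fset_set; last exact: finite_primitive_char.
by rewrite inE.
Qed.

Lemma uniq_prim_chars q : uniq (prim_chars q).
Proof. exact: finmap.fset_uniq. Qed.

(** Bessel for the indicator of the residue 1. *)
Lemma size_prim_chars q : (0 < q)%N -> (size (prim_chars q) <= totient q)%N.
Proof.
move=> q0; rewrite -(ler_nat R).
pose c (a : nat) : R[i] := (a == 1 %% q)%N%:R.
have q1 : (1 %% q < q)%N by rewrite ltn_mod.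
have := @dchar_bessel R q (prim_chars q) c q0 (uniq_prim_chars q)
  (fun chi H => (prim_charsP q0 H).1).
rewrite [X in X <= _](_ : _ = (size (prim_chars q))%:R); last first.
  rewrite -sum1_size natr_sum big_seq [RHS]big_seq.
  apply: eq_bigr => chi /(prim_charsP q0) [dchi _].
  rewrite (bigD1 (Ordinal q1))//= /c eqxx mulr1 big1 ?addr0; last first.
    by move=> a; rewrite -val_eqE/= => /negbTE ->; rewrite mulr0.
  by rewrite (dchar_periodic dchi (modn_mod 1 q)) (dchar1 dchi) nrm1 expr1n.
move=> /le_trans; apply.
rewrite ler_piMr// (bigD1 (Ordinal q1))/= ?coprime_modl ?coprime1n//.
rewrite /c eqxx nrm1 expr1n big1 ?addr0// => a /andP[_].
by rewrite -val_eqE/= => /negbTE ->; rewrite nrm0 expr0n.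
Qed.

(** Gauss sums write chi as a combination of additive characters mod q; Bessel
    then passes from characters to reduced fractions b/q. *)
Lemma prim_chars_additive q (m0 K : nat) (a : nat -> R[i]) : (0 < q)%N ->
  q%:R / (totient q)%:R * \sum_(chi <- prim_chars q)
     nrm (\sum_(r < K) a r * chi (m0 + r)%N) ^+ 2 <=
  \sum_(b < q | coprime b q)
     nrm (\sum_(r < K) conjc (a r) * e ((b * (m0 + r))%:R / q%:R)) ^+ 2.
Proof.
move=> q0; have t0 : (0 : R) < (totient q)%:R by rewrite ltr0n totient_gt0.
rewrite mulrAC ler_pdivrMr// mulrC [leRHS]mulrC.
pose c (b : nat) := \sum_(r < K) conjc (a r) * e ((b * (m0 + r))%:R / q%:R).
have := @dchar_bessel R q (prim_chars q) c q0 (uniq_prim_chars q)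
  (fun chi H => (prim_charsP q0 H).1).
apply: le_trans; rewrite mulr_suml big_seq [leRHS]big_seq.
apply: ler_sum => chi /(prim_charsP q0) pchi.
set S := \sum_(r < K) _.
have -> : \sum_(b < q) chi b * c b = conjc S * gauss_sum q chi 1.
  rewrite conjc_sum mulr_suml /c.
  under eq_bigr do rewrite mulr_sumr.
  rewrite exchange_big/=; apply: eq_bigr => r _.
  rewrite conjcM -mulrA -gauss_sum_primitive// mulr_sumr.
  by apply: eq_bigr => b _; ring.
by rewrite nrmM nrm_conj exprMn nrm_gauss_sum.
Qed.

End GaussSums.

(** * The large sieve *)

Section LargeSieve.
Context {R : realType}.
Local Notation e := (@expi2pi R).

Lemma ler_sum_inj (T U : finType) (P : pred T) (h : T -> U) (F : U -> R) :
  {in P &, injective h} -> (forall u, 0 <= F u) ->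
  \sum_(t | P t) F (h t) <= \sum_u F u.
Proof.
move=> hinj F0; pose A := [set t | P t]%SET.
have Ainj : {in A &, injective h} by move=> t u; rewrite !inE; exact: hinj.
rewrite (eq_bigl (fun t => t \in A)) => [|t]; last by rewrite inE.
rewrite -(big_imset F Ainj)/=.
by rewrite [leRHS](bigID (fun u => u \in h @: A)%SET)/= lerDl sumr_ge0.
Qed.

(** Distinct fractions b/q, b'/q' with denominators at most Q are at distance
    at least 1/Q^2. On the grid Z/L the windows of length H after the points b
    L / q are therefore disjoint when H Q^2 <= L. *)
Lemma farey_window_inj (Q L H : nat) (q q' b b' h h' : nat) :
  (0 < q <= Q)%N -> (0 < q' <= Q)%N -> (q %| L)%N -> (q' %| L)%N ->
  coprime b q -> coprime b' q' -> (h < H)%N -> (h' < H)%N -> (H * Q ^ 2 <= L)%N ->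
  (b * (L %/ q) + h = b' * (L %/ q') + h')%N ->
  [/\ q = q', b = b' & h = h'].
Proof.
wlog le : q q' b b' h h' / (b' * q <= b * q')%N.
  move=> W qQ qQ' qL qL' bq bq' hH hH' HL E.
  have [le|/ltnW le] := leqP (b' * q) (b * q'); first exact: W.
  by have [] := W q' q b' b h' h le qQ' qQ qL' qL bq' bq hH' hH HL (esym E).
move=> /andP[q0 qQ] /andP[q0' qQ'] qL qL' bq bq' hH hH' HL E.
have E2 : (b * q' * L + h * (q * q') = b' * q * L + h' * (q * q'))%N.
  have := congr1 (fun n => n * (q * q'))%N E; rewrite !mulnDl.
  have -> : (b * (L %/ q) * (q * q') = b * q' * L)%N.
    by rewrite -{2}(divnK qL); ring.
  by have -> : (b' * (L %/ q') * (q * q') = b' * q * L)%N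
    by rewrite -{2}(divnK qL'); ring.
have qq' : (q * q' <= Q ^ 2)%N by rewrite expnS expn1 leq_mul.
have eqb : (b' * q = b * q')%N.
  apply/eqP; rewrite eqn_leq le/= leqNgt; apply/negP => lt.
  have l1 : (h' * (q * q') < L)%N.
    apply: leq_trans HL; apply: (@leq_trans (h' * (q * q')).+1) => //.
    apply: (@leq_ltn_trans (h' * Q ^ 2)); first by rewrite leq_mul.
    by rewrite ltn_pmul2r// (leq_trans _ qq')// muln_gt0 q0.
  have : ((b' * q).+1 * L <= b * q' * L)%N by rewrite leq_mul.
  rewrite mulSn => l2; move: E2; lia.
have eqh : h = h'.
  move: E2; rewrite eqb => /addnI/eqP; rewrite eqn_pmul2r ?muln_gt0 ?q0//.
  by move/eqP.
have qq : q = q'.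
  apply/eqP; rewrite eqn_dvd.
  have -> : (q %| q')%N by rewrite -(@Gauss_dvdr _ b) 1?coprime_sym// -eqb dvdn_mull.
  by rewrite -(@Gauss_dvdr _ b') 1?coprime_sym// eqb dvdn_mull.
split => //; move/eqP: eqb; rewrite qq eqn_pmul2r// => /eqP.
by move=> ->.
Qed.

(** All fractions b/q lie on a common grid Z/L. The coefficients are divided
    by W(r), the mean of e(h r / L) over a window 0 <= h < H, which is bounded
    below since H K / L is small; then the sum at b/q becomes a mean over the
    window after b/q. The windows are disjoint, so Parseval on Z/L finishes. *)
Lemma additive_large_sieve (Q K : nat) (c : nat -> R[i]) :
  \sum_(1 <= q < Q.+1) \sum_(b < q | coprime b q)
    nrm (\sum_(r < K) c r * e ((b * r)%:R / q%:R)) ^+ 2 <=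
  32 * (K + Q ^ 2)%:R * \sum_(r < K) nrm (c r) ^+ 2.
Proof.
have [->|Q0] := posnP Q.
  rewrite big_geq//; apply: mulr_ge0; first exact: mulr_ge0.
  by apply: sumr_ge0 => *; exact: sqr_ge0.
(* H plays two roles: window length, and common multiple making q | L for all
   q <= Q. *)
have [H H0 Hdvd] : exists2 H, (0 < H)%N & forall q, (0 < q <= Q)%N -> (q %| H)%N.
  by exists Q`!; [exact: fact_gt0|move=> q qQ; exact: dvdn_fact].
pose D := (8 * (K + Q ^ 2))%N.
have [L LD] : exists L, L = (H * D)%N by exists (H * D)%N.
have D0 : (0 < D)%N by rewrite muln_gt0 addn_gt0 expn_gt0 Q0 orbT.
have L0 : (0 < L)%N by rewrite LD muln_gt0 H0.
have KL : (K <= L)%N.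
  rewrite LD -[K]mul1n leq_mul// /D; lia.
have HR : (H%:R : R) != 0 by rewrite pnatr_eq0 -lt0n.
have LR : (L%:R : R) != 0 by rewrite pnatr_eq0 -lt0n.
have HC : (H%:R : R[i]) != 0 by rewrite pnatr_eq0 -lt0n.
have Qdvd q : (0 < q <= Q)%N -> (q %| L)%N.
  by move=> qQ; rewrite LD dvdn_mulr// Hdvd.
pose W (r : nat) : R[i] := \sum_(h < H) e ((h * r)%:R / L%:R).
have WH r : (r < K)%N -> H%:R / 2 <= nrm (W r).
  move=> rK; apply: le_trans (Re_le_nrm _).
  rewrite /W raddf_sum/= mulrC mulr_natr -[X in _ *+ X]card_ord -sumr_const.
  apply: ler_sum => h _; apply: Re_expi_ge_half; first exact: divr_ge0.
  rewrite ler_pdivrMr ?ltr0n// -(@ler_pM2l _ 8)// mulrA divff// mul1r.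
  have hr : (h * r <= H * (K + Q ^ 2))%N.
    by rewrite leq_mul ?(ltnW (ltn_ord h))// (leq_trans (ltnW rK)) ?leq_addr.
  by rewrite -natrM ler_nat LD /D [(H * _)%N]mulnCA leq_mul2l hr orbT.
have W0 r : (r < K)%N -> W r != 0.
  move=> /WH; apply: contraTneq => ->; rewrite nrm0 -ltNge divr_gt0 ?ltr0n//.
pose c' r := c r * H%:R / W r.
have c'2 r : (r < K)%N -> nrm (c' r) ^+ 2 <= 4 * nrm (c r) ^+ 2.
  move=> rK; have -> : 4 = (2 : R) ^+ 2 by rewrite expr2; lra.
  rewrite -exprMn lerXn2r ?nnegrE ?nrm_ge0 ?mulr_ge0 ?nrm_ge0//.
  rewrite /c' !nrmM ComplexField.Normc.normcV ler_pdivrMr; last first.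
    by rewrite (lt_le_trans _ (WH _ rK))// divr_gt0 ?ltr0n.
  rewrite nrm_nat [2 * _]mulrC -mulrA ler_wpM2l ?nrm_ge0//.
  by have := WH _ rK; rewrite ler_pdivrMr// mulrC.
pose S' (g : nat) := \sum_(r < K) c' r * e ((g * r)%:R / L%:R).
(* The value at b/q is the mean of the values over its window. *)
have step q (b : 'I_q) : (0 < q <= Q)%N ->
   nrm (\sum_(r < K) c r * e ((b * r)%:R / q%:R)) ^+ 2 <=
   H%:R^-1 * \sum_(h < H) nrm (S' (b * (L %/ q) + h)%N) ^+ 2.
  move=> qQ; have qR : (q%:R : R) != 0.
    by rewrite pnatr_eq0 -lt0n; case/andP: qQ.
  have -> : \sum_(r < K) c r * e ((b * r)%:R / q%:R) =
      H%:R^-1 * \sum_(h < H) S' (b * (L %/ q) + h)%N.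
    rewrite mulr_sumr; under [RHS]eq_bigr do rewrite mulr_sumr.
    rewrite exchange_big/=; apply: eq_bigr => r _.
    rewrite -mulr_sumr.
    transitivity (H%:R^-1 * (c' r * (e ((b * r)%:R / q%:R) * W r))).
      by rewrite /c'; field; rewrite HC W0.
    congr (_ * _); rewrite -mulr_sumr; congr (_ * _); rewrite /W mulr_sumr.
    apply: eq_bigr => h _; rewrite -expiD; congr (e _).
    have Lq : ((L %/ q)%:R : R) != 0.
      have /andP[qp _] := qQ.
      by rewrite pnatr_eq0 -lt0n divn_gt0 // dvdn_leq // Qdvd.
    have LE : L%:R = (L %/ q)%:R * q%:R :> R by rewrite -natrM divnK// Qdvd.
    rewrite !natrM natrD !natrM LE; move: ((L %/ q)%:R : R) Lq => l Lq.
    by field; rewrite qR.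
  rewrite nrmM ComplexField.Normc.normcV nrm_nat exprMn.
  rewrite [H%:R^-1 ^+ 2]expr2 -mulrA ler_wpM2l ?invr_ge0//.
  rewrite mulrC ler_pdivrMr ?ltr0n// mulrC.
  apply: (@le_trans _ _ ((\sum_(h < H) nrm (S' (b * (L %/ q) + h)%N)) ^+ 2)).
    rewrite lerXn2r ?nnegrE ?nrm_ge0 ?nrm_sum//.
    by apply: sumr_ge0 => *; exact: nrm_ge0.
  have := sqr_sum_le (index_enum 'I_H) (fun h : 'I_H => nrm (S' (b * (L %/ q) + h)%N)).
  by rewrite /index_enum -enumT size_enum_ord.
apply: (@le_trans _ _ (\sum_(1 <= q < Q.+1) \sum_(b < q | coprime b q)
   (H%:R^-1 * \sum_(h < H) nrm (S' (b * (L %/ q) + h)%N) ^+ 2))).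
  rewrite !big_nat; apply: ler_sum => q qQ; apply: ler_sum => b _.
  by apply: step; rewrite -ltnS.
under eq_bigr do rewrite -mulr_sumr.
rewrite -mulr_sumr mulrC ler_pdivrMr ?ltr0n//.
have parS : \sum_(g < L) nrm (S' g) ^+ 2 <= L%:R * (4 * \sum_(r < K) nrm (c r) ^+ 2).
  rewrite parseval// ler_wpM2l// mulr_sumr; apply: ler_sum => r _.
  exact: c'2.
apply: le_trans (le_trans parS _); last first.
  by rewrite LD /D !natrM; apply: ler_of_eq; ring.
pose P (t : 'I_Q.+1 * ('I_Q.+1 * 'I_H)) :=
  [&& (0 < t.1)%N, (t.2.1 < t.1)%N & coprime t.2.1 t.1].
have gL (t : 'I_Q.+1 * ('I_Q.+1 * 'I_H)) : P t ->
   (t.2.1 * (L %/ t.1) + t.2.2 < L)%N.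
  case: t => q [b h] /= /and3P[/= q0 bq _].
  have qQ : (0 < q <= Q)%N by apply/andP; split; [exact: q0|exact: ltn_ord q].
  have HLq : (H <= L %/ q)%N.
    rewrite leq_divRL// LD leq_mul2l; apply/orP; right; rewrite /D.
    have : (q <= Q ^ 2)%N.
      by have /andP[_ qQ2] := qQ; apply: (leq_trans qQ2); rewrite expnS expn1 leq_pmulr.
    lia.
  apply: (@leq_trans (b.+1 * (L %/ q))).
    by rewrite mulSn addnC ltn_add2r (leq_trans (ltn_ord h)).
  by rewrite -{2}(divnK (Qdvd q qQ)) mulnC leq_mul.
(* The disjoint windows, as one injection into Z/L. *)
pose g (t : 'I_Q.+1 * ('I_Q.+1 * 'I_H)) := inord (t.2.1 * (L %/ t.1) + t.2.2) : 'I_L.-1.+1.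
have LE : L.-1.+1 = L by rewrite prednK.
have ginj : {in P &, injective g}.
  move=> t u Pt Pu /(congr1 val); rewrite /g /= !inordK ?LE ?gL//.
  move: t u Pt Pu => [q [b h]] [q' [b' h']] /= /and3P[/= q0 bq cbq] /and3P[/= q0' bq' cbq'].
  have qQ : (0 < q <= Q)%N by apply/andP; split; [exact: q0|exact: ltn_ord q].
  have qQ' : (0 < q' <= Q)%N by apply/andP; split; [exact: q0'|exact: ltn_ord q'].
  move=> /(farey_window_inj qQ qQ' (Qdvd _ qQ) (Qdvd _ qQ') cbq cbq' (ltn_ord h) (ltn_ord h')).
  have HL : (H * Q ^ 2 <= L)%N by rewrite LD leq_mul2l; apply/orP; right; rewrite /D; lia.
  by move=> /(_ HL) [/val_inj -> /val_inj -> /val_inj ->].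
have := ler_sum_inj ginj (fun u => sqr_ge0 (nrm (S' u))).
rewrite (_ : \sum_u _ = \sum_(u < L) nrm (S' u) ^+ 2); last by rewrite LE.
apply: le_trans; apply: ler_of_eq.
rewrite big_geq_mkord/=.
transitivity (\sum_(q < Q.+1 | (0 < q)%N) \sum_(bh : 'I_Q.+1 * 'I_H | (bh.1 < q)%N && coprime bh.1 q)
   nrm (S' (bh.1 * (L %/ q) + bh.2)%N) ^+ 2).
  apply: eq_bigr => q q0.
  rewrite (big_ord_widen_cond Q.+1 (fun b => coprime b q)
    (fun b => \sum_(h < H) nrm (S' (b * (L %/ q) + h)%N) ^+ 2)); last by rewrite ltnW.
  rewrite pair_big_dep/=; apply: eq_bigl => bh; by rewrite andbT andbC.
rewrite pair_big_dep/=; apply: eq_big => [//|t Pt].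
by rewrite /g inordK// LE gL.
Qed.

(** The constant 32 is 4 (from the weights W) times 8 = L / (H (K + Q^2)). *)
Lemma large_sieve (Q K m0 : nat) (a : nat -> R[i]) :
  \sum_(1 <= q < Q.+1) q%:R / (totient q)%:R *
    \sum_(chi <- prim_chars q) nrm (\sum_(r < K) a r * chi (m0 + r)%N) ^+ 2 <=
  32 * (K + Q ^ 2)%:R * \sum_(r < K) nrm (a r) ^+ 2.
Proof.
have := additive_large_sieve Q K (fun r => conjc (a r)).
under [X in _ <= _ * X -> _]eq_bigr do rewrite nrm_conj.
apply: le_trans; rewrite !big_nat; apply: ler_sum => q /andP[q0 _].
apply: (le_trans (prim_chars_additive _ _ _ q0)); apply: ler_sum => b _.
apply: ler_of_eq; congr (_ ^+ 2).
(* The shift by m0 is a phase independent of r. *)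
transitivity (nrm (e ((b * m0)%:R / q%:R) *
    \sum_(r < K) conjc (a r) * e ((b * r)%:R / q%:R))); last first.
  by rewrite nrmM nrm_expi mul1r.
congr nrm; rewrite mulr_sumr; apply: eq_bigr => r _.
by rewrite mulrCA -expiD mulnDr natrD mulrDl.
Qed.

End LargeSieve.

(** * Matrices with exponential entries *)

Section BilinearMatrix.
Context {R : realType}.
Local Notation e := (@expi2pi R).
Implicit Types (A a b : nat -> R[i]).

Lemma nrm_geom_expi (beta : R) J : 0 < `|beta| -> `|beta| <= 2^-1 ->
  nrm (\sum_(j < J) e (beta * j%:R)) <= 2 / `|beta|.
Proof.
move=> b0 b2; rewrite ler_pdivlMr//.
apply: (@le_trans _ _ (nrm (\sum_(j < J) e (beta * j%:R)) * nrm (1 - e beta))).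
  by rewrite ler_wpM2l ?nrm_ge0// nrm_1Bexpi_ge.
rewrite -nrmM mulrC; under eq_bigr do rewrite expiMn.
have -> : (1 - e beta) * \sum_(i < J) e beta ^+ i = 1 - e beta ^+ J.
  by rewrite -[1 - e beta]opprB mulNr -subrX1 opprB.
by apply: (le_trans (nrmB _ _)); rewrite nrm1 nrmX nrm_expi expr1n.
Qed.

Definition harm (n : nat) : R := \sum_(d < n) (d%:R)^-1.

Lemma harm_ge0 n : 0 <= harm n.
Proof. by apply: sumr_ge0 => d _; rewrite invr_ge0. Qed.

Lemma harm_le m n : (m <= n)%N -> harm m <= harm n.
Proof.
move=> mn; rewrite /harm (big_ord_widen n (fun d => (d%:R)^-1 : R) mn).
by rewrite [leRHS](bigID (fun d : 'I_n => (d < m)%N))/= lerDl sumr_ge0// => d _; rewrite invr_ge0.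
Qed.

Lemma sum_inv_subl I (i : 'I_I) : \sum_(k < I) ((i - k)%N%:R)^-1 <= harm I.
Proof.
case: I i => [[]//|I] i; pose h (k : 'I_I.+1) : 'I_I.+1 := inord (i - k).
have hE k : val (h k) = (i - k)%N.
  by rewrite /h /= inordK// (leq_ltn_trans (leq_subr _ _)).
rewrite (bigID (fun k : 'I_I.+1 => (k < i)%N))/= [X in _ + X]big1 ?addr0; last first.
  by move=> k; rewrite -leqNgt -subn_eq0 => /eqP ->; rewrite invr0.
under eq_bigr do rewrite -hE.
apply: (@ler_sum_inj _ _ _ _ h (fun d : 'I_I.+1 => (d%:R)^-1)) => [k l|u]; last by rewrite invr_ge0.
rewrite !unfold_in => ki li /(congr1 val); rewrite !hE => kl.
by apply: val_inj => /=; lia.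
Qed.

Lemma sum_inv_subr I (i : 'I_I) : \sum_(k < I) ((k - i)%N%:R)^-1 <= harm I.
Proof.
case: I i => [[]//|I] i; pose h (k : 'I_I.+1) : 'I_I.+1 := inord (k - i).
have hE k : val (h k) = (k - i)%N.
  by rewrite /h /= inordK// (leq_ltn_trans (leq_subr _ _)).
rewrite (bigID (fun k : 'I_I.+1 => (i < k)%N))/= [X in _ + X]big1 ?addr0; last first.
  by move=> k; rewrite -leqNgt -subn_eq0 => /eqP ->; rewrite invr0.
under eq_bigr do rewrite -hE.
apply: (@ler_sum_inj _ _ _ _ h (fun d : 'I_I.+1 => (d%:R)^-1)) => [k l|u]; last by rewrite invr_ge0.
rewrite !unfold_in => ki li /(congr1 val); rewrite !hE => kl.
by apply: val_inj => /=; lia.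
Qed.

(** Expanding the square gives a Hermitian form with entries bounded by
    geometric sums 2 / |g (i - k)|. Its norm is at most the largest row sum
    (Schur), where the harmonic sum appears. The condition on g I keeps g (i -
    k) away from nonzero integers. *)
Lemma exp_matrix_short (g : R) I J A : g != 0 -> `|g| * I%:R <= 2^-1 ->
  \sum_(j < J) nrm (\sum_(i < I) A i * e (g * i%:R * j%:R)) ^+ 2 <=
  (J%:R + 4 / `|g| * harm I) * \sum_(i < I) nrm (A i) ^+ 2.
Proof.
move=> g0 gI; have gp : 0 < `|g| by rewrite normr_gt0.
pose G (i k : 'I_I) := \sum_(j < J) e ((i%:R - k%:R) * g * j%:R).
(* Truncated subtraction and 1/0 = 0 make exactly one of the two inverses
   nonzero off the diagonal. *)
pose kk (i k : 'I_I) : R := (i == k)%:R * J%:R +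
  2 / `|g| * (((i - k)%N%:R)^-1 + ((k - i)%N%:R)^-1).
have kk_ge0 i k : 0 <= kk i k.
  by rewrite addr_ge0 ?mulr_ge0 ?addr_ge0 ?invr_ge0.
have Gk i k : nrm (G i k) <= kk i k.
  rewrite /G /kk; have [<-|ik] := eqVneq i k.
    rewrite mul1r subnn invr0 addr0 mulr0 addr0 subrr mul0r.
    under eq_bigr do rewrite mul0r expi0.
    by rewrite sumr_const card_ord nrm_nat.
  rewrite mul0r add0r.
  have E : ((i - k)%N%:R)^-1 + ((k - i)%N%:R)^-1 = `|i%:R - k%:R|^-1 :> R.
    case: (ltngtP i k) => [lt|lt|/val_inj eq]; last by rewrite eq eqxx in ik.
      have -> : (i - k)%N = 0%N by apply/eqP; rewrite subn_eq0 ltnW.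
      by rewrite invr0 add0r distrC -natrB ?(ltnW lt)// ger0_norm.
    have -> : (k - i)%N = 0%N by apply/eqP; rewrite subn_eq0 ltnW.
    by rewrite invr0 addr0 -natrB ?(ltnW lt)// ger0_norm.
  rewrite E; have n0 : i%:R - k%:R != 0 :> R by rewrite subr_eq0 eqr_nat.
  apply: le_trans (nrm_geom_expi _ _ _) _.
  - by rewrite normr_gt0 mulf_neq0.
  - rewrite normrM mulrC; apply: le_trans gI; rewrite ler_wpM2l//.
    rewrite ler_norml; have := ltn_ord i; have := ltn_ord k.
    rewrite -!(ltr_nat R) => /ltW kI /ltW iI.
    have : (0 : R) <= i%:R by []. have : (0 : R) <= k%:R by [].
    by move=> *; apply/andP; split; lra.
  - rewrite normrM invfM; apply: ler_of_eq; ring.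
set S := \sum_(j < J) _; set N2 := \sum_(i < I) nrm (A i) ^+ 2.
have S0 : 0 <= S by apply: sumr_ge0 => *; exact: sqr_ge0.
have E : S%:C%C = \sum_(i < I) \sum_(k < I) A i * conjc (A k) * G i k.
  rewrite rmorph_sum/=; under eq_bigr => j _.
    rewrite sqr_nrm conjc_sum big_distrlr/=.
    under eq_bigr => i _ do under eq_bigr => k _ do
      rewrite conjcM mulrACA -expiN -expiD.
    over.
  rewrite exchange_big/=; apply: eq_bigr => i _.
  rewrite exchange_big/=; apply: eq_bigr => k _.
  rewrite -mulr_sumr; congr (_ * _); apply: eq_bigr => j _; congr (e _); ring.
have -> : S = nrm S%:C%C by rewrite nrm_real ger0_norm.
rewrite E; apply: (le_trans (nrm_sum _ _ _)).
apply: (@le_trans _ _ (\sum_(i < I) \sum_(k < I)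
   (nrm (A i) ^+ 2 * (kk i k / 2) + nrm (A k) ^+ 2 * (kk i k / 2)))).
  apply: ler_sum => i _; apply: (le_trans (nrm_sum _ _ _)).
  apply: ler_sum => k _; rewrite !nrmM nrm_conj.
  apply: (@le_trans _ _ (nrm (A i) * nrm (A k) * kk i k)).
    by rewrite ler_wpM2l// mulr_ge0 ?nrm_ge0.
  have := sqr_ge0 (nrm (A i) - nrm (A k)); have := kk_ge0 i k; nra.
have kksym i k : kk i k = kk k i by rewrite /kk eq_sym [(_)^-1 + _]addrC.
have row i : \sum_(k < I) kk i k <= J%:R + 4 / `|g| * harm I.
  rewrite /kk big_split/= lerD//.
    rewrite (bigD1 i)//= eqxx mul1r big1 ?addr0// => k; rewrite eq_sym => /negbTE ->.
    by rewrite mul0r.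
  rewrite -mulr_sumr big_split/=.
  have := sum_inv_subl i; have := sum_inv_subr i.
  have -> : 4 / `|g| * harm I = 2 / `|g| * (harm I + harm I) by ring.
  by move=> h1 h2; rewrite ler_wpM2l// lerD.
under eq_bigr do rewrite big_split/=.
rewrite big_split/= [X in _ + X]exchange_big/=.
have half : \sum_(i < I) \sum_(k < I) nrm (A i) ^+ 2 * (kk i k / 2) <=
   (J%:R + 4 / `|g| * harm I) / 2 * N2.
  rewrite mulr_sumr; apply: ler_sum => i _; rewrite -mulr_sumr -mulr_suml mulrC.
  by rewrite ler_wpM2r ?sqr_ge0// ler_wpM2r// invr_ge0.
rewrite [X in _ <= X](_ : _ = (J%:R + 4 / `|g| * harm I) / 2 * N2 + (J%:R + 4 / `|g| * harm I) / 2 * N2); last by field; rewrite gt_eqF.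
rewrite lerD//; apply: le_trans half.
by apply: ler_of_eq; apply: eq_bigr => i _; apply: eq_bigr => k _; rewrite kksym.
Qed.

Lemma sum_mul_blocks (V : nmodType) (F : nat -> V) B K :
  \sum_(m < B * K) F m = \sum_(b < B) \sum_(r < K) F (b * K + r)%N.
Proof.
elim: B => [|B IH]; first by rewrite !big_ord0.
rewrite big_ord_recr/= -IH -(big_mkord xpredT) (big_cat_nat (n := B * K))//=; last first.
  by rewrite leq_mul2r leqnSn orbT.
rewrite big_mkord; congr (_ + _).
rewrite -[X in \sum_(X <= _ < _) _]addn0 addnC mulSn.
by rewrite big_addn addnK big_mkord; apply: eq_bigr => r _; rewrite addnC.
Qed.

(** Extension by zero lets a range be cut into blocks of equal length even
    when the length does not divide it. *)
Definition extend0 (V : nmodType) (M : nat) (F : nat -> V) m : V := if (m < M)%N then F m else 0.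

Lemma sum_blocks (V : nmodType) (F : nat -> V) M K B : (M <= B * K)%N ->
  \sum_(m < M) F m = \sum_(b < B) \sum_(r < K) extend0 M F (b * K + r)%N.
Proof.
move=> MB; rewrite -sum_mul_blocks (big_ord_widen _ F MB) big_mkcond/=.
by apply: eq_bigr.
Qed.

(** The range of i is cut into pieces of length about 1/(2|g|), to which the
    short case applies, and the pieces are recombined by Cauchy-Schwarz. *)
Lemma exp_matrix (g : R) I J A : g != 0 -> `|g| <= 2^-1 ->
  \sum_(j < J) nrm (\sum_(i < I) A i * e (g * i%:R * j%:R)) ^+ 2 <=
  (4 * `|g| * I%:R + 1) * (J%:R + 4 / `|g| * harm I) * \sum_(i < I) nrm (A i) ^+ 2.
Proof.
move=> g0 g2; have gp : 0 < `|g| by rewrite normr_gt0.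
have N0 : 0 <= \sum_(i < I) nrm (A i) ^+ 2 by apply: sumr_ge0 => *; exact: sqr_ge0.
have X0 : 0 <= J%:R + 4 / `|g| * harm I by rewrite addr_ge0// mulr_ge0 ?harm_ge0.
have [gI|gI] := leP (`|g| * I%:R) 2^-1.
  apply: (le_trans (exp_matrix_short _ _ g0 gI)).
  by rewrite ler_wpM2r// ler_peMl// lerDr mulr_ge0.
pose y := (2 * `|g|)^-1; pose I0 := Num.truncn y.
have y1 : 1 <= y by rewrite /y invf_ge1 ?mulr_gt0//; lra.
have y0 : 0 <= y by apply: le_trans y1.
have gy : `|g| * y = 2^-1 by rewrite /y invfM mulrCA divff ?mulr1// gt_eqF.
have [I0y yI0] : I0%:R <= y /\ y < I0.+1%:R by apply/andP; exact: truncn_itv.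
have I01 : 1 <= I0%:R :> R.
  by rewrite ler1n lt0n; apply: contraTneq yI0 => ->; rewrite -leNgt.
have I0p : (0 < I0)%N by rewrite -(ltr0n R) (lt_le_trans _ I01).
have gI0 : `|g| * I0%:R <= 2^-1 by rewrite -gy ler_wpM2l.
have I0I : (I0 <= I)%N.
  rewrite -(ler_nat R) (le_trans I0y)// ltW// -(ltr_pM2l gp) gy//.
pose B := (I %/ I0).+1.
have IB : (I <= B * I0)%N by rewrite ltnW// ltn_ceil.
have BR : B%:R <= 4 * `|g| * I%:R + 1.
  rewrite (_ : B%:R = (I %/ I0)%:R + 1); last by rewrite /B natr1.
  rewrite lerD2r; have : (I %/ I0 * I0 <= I)%N by exact: leq_divM.
  rewrite -(ler_nat R) natrM => H.
  have : 1 <= 4 * `|g| * I0%:R.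
    have : y <= 2 * I0%:R by rewrite -natr1 in yI0; lra.
    by move=> h; have := ler_wpM2l (normr_ge0 g) h; rewrite gy; lra.
  have : (0 : R) <= (I %/ I0)%:R by [].
  have : (0 : R) <= I0%:R by [].
  nra.
have S0 (c : nat) : 0 <= \sum_(r < I0) nrm (extend0 I A (c * I0 + r)%N) ^+ 2.
  by apply: sumr_ge0 => *; exact: sqr_ge0.
have NE : \sum_(i < I) nrm (A i) ^+ 2 =
   \sum_(b < B) \sum_(r < I0) nrm (extend0 I A (b * I0 + r)%N) ^+ 2.
  rewrite (sum_blocks (fun i => nrm (A i) ^+ 2) IB); apply: eq_bigr => b _.
  by apply: eq_bigr => r _; rewrite /extend0; case: ifP => //; rewrite nrm0 expr0n.
apply: (@le_trans _ _ (\sum_(j < J) (B%:R * \sum_(b < B)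
   nrm (\sum_(r < I0) extend0 I A (b * I0 + r)%N * e (g * r%:R * j%:R)) ^+ 2))).
  apply: ler_sum => j _.
  rewrite (sum_blocks (fun i => A i * e (g * i%:R * j%:R)) IB).
  apply: (@le_trans _ _ ((\sum_(b < B) nrm (\sum_(r < I0) extend0 I A (b * I0 + r)%N * e (g * r%:R * j%:R))) ^+ 2)).
    rewrite lerXn2r ?nnegrE ?nrm_ge0//; first by apply: sumr_ge0 => *; exact: nrm_ge0.
    apply: (le_trans (nrm_sum _ _ _)); apply: ler_sum => b _.
    apply: (@le_trans _ _ (nrm (e (g * (b * I0)%:R * j%:R)) *
      nrm (\sum_(r < I0) extend0 I A (b * I0 + r)%N * e (g * r%:R * j%:R)))); last first.
      by rewrite nrm_expi mul1r.
    rewrite -nrmM mulr_sumr.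
    apply: ler_of_eq; congr nrm.
    apply: eq_bigr => r _; rewrite /extend0; case: ifP => _; last by rewrite mul0r mulr0.
    rewrite mulrCA -expiD natrD; congr (_ * _); congr (e _); ring.
  have := sqr_sum_le (index_enum 'I_B) (fun b : 'I_B =>
    nrm (\sum_(r < I0) extend0 I A (b * I0 + r)%N * e (g * r%:R * j%:R))).
  by rewrite /index_enum -enumT size_enum_ord.
rewrite -mulr_sumr exchange_big/= -mulrA.
apply: ler_pM => //.
  by apply: sumr_ge0 => b _; apply: sumr_ge0 => *; exact: sqr_ge0.
rewrite NE mulr_sumr; apply: ler_sum => b _.
apply: (le_trans (exp_matrix_short _ (fun r => extend0 I A (b * I0 + r)%N) g0 gI0)).
rewrite ler_wpM2r// lerD2l ler_wpM2l//.
exact: harm_le.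
Qed.

End BilinearMatrix.

(** * Separation of variables in the exponential *)

Section Separation.
Context {R : realType}.
Local Notation e := (@expi2pi R).
Local Notation ii := (0 +i* 1 : R[i])%C.
Implicit Types (a b : nat -> R[i]).

Lemma bin_le_exp n p : ('C(n, p) <= n ^ p)%N.
Proof.
elim: p n => [|p IH] n; first by rewrite bin0.
case: n => [|n]; first by rewrite bin0n.
have : (p.+1 * 'C(n.+1, p.+1) <= n.+1 ^ p.+1)%N.
  rewrite -mul_bin_diag expnS leq_mul2l (leq_trans (IH n))//.
  by case: p {IH} => // p; rewrite leq_exp2r.
by move=> h; apply: leq_trans h; rewrite leq_pmull.
Qed.

(** The compound-interest approximation (1 + 2 pi i x / n)^n of e(x): being a
    polynomial in x, it separates a product of variables after finitely many
    terms. *)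
Definition expi_approx n x : R[i] := (1 + (2 * pi * x / n%:R)%:C%C * ii) ^+ n.
Definition expi_coef n (k : R) p : R[i] :=
  ((2 * pi * k / n%:R)%:C%C * ii) ^+ p *+ 'C(n, p).

Lemma expi_approxE n k u : expi_approx n (k * u) =
  \sum_(p < n.+1) expi_coef n k p * (u ^+ p)%:C%C.
Proof.
rewrite /expi_approx exprDn; apply: eq_bigr => p _; rewrite expr1n mul1r /expi_coef.
rewrite -[in LHS]mulr_natr -[in RHS]mulr_natr [RHS]mulrAC; congr (_ * _).
rewrite rmorphXn -exprMn; congr (_ ^+ _).
rewrite [RHS]mulrAC -rmorphM/=; congr (_ * _); congr (_ %:C%C); ring.
Qed.

Lemma nrm_ii : nrm ii = 1.
Proof. by rewrite /ComplexField.Normc.normc expr0n/= add0r expr1n sqrtr1. Qed.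

(** The geometric decay makes the sum over the terms of the expansion converge
    uniformly in n. *)
Lemma nrm_expi_coef n k p : (0 < n)%N -> `|2 * pi * k| <= 2^-1 ->
  nrm (expi_coef n k p) <= 2^-1 ^+ p.
Proof.
move=> n0 k2; rewrite /expi_coef -mulr_natr nrmM nrm_nat nrmX nrmM nrm_ii mulr1 nrm_real.
rewrite normrM exprMn -[X in X <= _]mulrA.
have h1 : `|2 * pi * k| ^+ p <= 2^-1 ^+ p by rewrite lerXn2r ?nnegrE.
have h2 : `|n%:R^-1| ^+ p * 'C(n, p)%:R <= (1 : R).
  rewrite ger0_norm ?invr_ge0// exprVn mulrC ler_pdivrMr ?exprn_gt0 ?ltr0n//.
  by rewrite mul1r -natrX ler_nat bin_le_exp.
have h0 : 0 <= `|n%:R^-1 : R| ^+ p * 'C(n, p)%:R by rewrite mulr_ge0// exprn_ge0.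
apply: (le_trans (ler_wpM2r h0 h1)).
by rewrite ler_piMr// exprn_ge0.
Qed.

Lemma geo_half n : \sum_(p < n) (2^-1 : R) ^+ p <= 2.
Proof.
have H : \sum_(p < n) (2^-1 : R) ^+ p = 2 - 2 * 2^-1 ^+ n.
  elim: n => [|n IH]; first by rewrite big_ord0 expr0 mulr1 subrr.
  by rewrite big_ord_recr/= IH exprS; lra.
by rewrite H gerBl mulr_ge0.
Qed.

Lemma nrm_expi_approx n x : (0 < n)%N -> `|2 * pi * x| <= 2^-1 ->
  nrm (expi_approx n x) <= 2.
Proof.
move=> n0 x2; rewrite -[x]mulr1 expi_approxE; apply: (le_trans (nrm_sum _ _ _)).
apply: le_trans (geo_half n.+1); apply: ler_sum => p _.
by rewrite expr1n rmorph1 mulr1 nrm_expi_coef.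
Qed.

(** Factor u^n - v^n with u = e(x/n); the difference u - v is O(1/n^2). *)
Lemma expi_approx_close n x : (0 < n)%N -> `|2 * pi * x| <= 2^-1 ->
  nrm (e x - expi_approx n x) <= n%:R^-1.
Proof.
move=> n0 x2; have nR : (n%:R : R) != 0 by rewrite pnatr_eq0 -lt0n.
have n1 : 1 <= (n%:R : R) by rewrite ler1n.
pose u := e (x / n%:R); pose v : R[i] := 1 + (2 * pi * x / n%:R)%:C%C * ii.
have -> : e x = u ^+ n by rewrite -expiMn mulfVK.
have v1 : 1 <= nrm v.
  apply: le_trans (Re_le_nrm _); rewrite /v raddfD/=.
  by rewrite !(mul0r,mulr1,mulr0,oppr0,subr0,addr0).
rewrite /expi_approx -/v subrXX nrmM.
have duv : nrm (u - v) <= (2 * n%:R)^-1 ^+ 2.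
  have E : 2 * pi * x / n%:R = 2 * pi * (x / n%:R) by rewrite mulrA.
  have xn : `|2 * pi * (x / n%:R)| <= (2 * n%:R)^-1.
    rewrite mulrA normrM invfM [X in _ * X <= _]ger0_norm ?invr_ge0//.
    by rewrite ler_wpM2r ?invr_ge0.
  rewrite /v E; apply: (le_trans (expi_taylor1 _)).
    apply: (le_trans xn); rewrite invf_le1//; first lra.
    by rewrite mulr_gt0// (lt_le_trans ltr01).
  by rewrite -real_normK ?num_real// lerXn2r ?nnegrE// invr_ge0.
have sv : nrm (\sum_(i < n) u ^+ (n.-1 - i) * v ^+ i) <= 2 * n%:R.
  apply: (le_trans (nrm_sum _ _ _)).
  rewrite mulr_natr -[X in _ *+ X]card_ord -sumr_const; apply: ler_sum => i _.
  rewrite nrmM !nrmX nrm_expi expr1n mul1r.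
  apply: le_trans (nrm_expi_approx n0 x2).
  by rewrite /expi_approx -/v nrmX ler_weXn2l// ltnW.
apply: le_trans (ler_pM _ _ duv sv) _; rewrite ?nrm_ge0//.
rewrite (_ : (2 * n%:R)^-1 ^+ 2 * (2 * n%:R) = (n%:R)^-1 / 2); last by field; rewrite nR.
by rewrite ler_pdivrMr// ler_peMr ?invr_ge0//; lra.
Qed.

Lemma expi_approx_mul n x y : (0 < n)%N -> `|2 * pi * x| <= 2^-1 ->
  `|2 * pi * y| <= 2^-1 ->
  nrm (e x * e y - expi_approx n x * expi_approx n y) <= 3 / n%:R.
Proof.
move=> n0 x2 y2.
have -> : e x * e y - expi_approx n x * expi_approx n y =
  e x * (e y - expi_approx n y) + (e x - expi_approx n x) * expi_approx n y by ring.
apply: (le_trans (nrmD _ _)); rewrite !nrmM nrm_expi mul1r.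
have := expi_approx_close n0 x2; have := expi_approx_close n0 y2.
have := nrm_expi_approx n0 y2; have := nrm_ge0 (expi_approx n y).
have := nrm_ge0 (e x - expi_approx n x).
have : 0 <= (n%:R : R)^-1 by rewrite invr_ge0.
nra.
Qed.

Definition block_sum M K (f : nat -> nat -> R) a i : R[i] :=
  \sum_(r < K) extend0 M a (i * K + r)%N * (f i r)%:C%C.

Lemma bilinear_form_le I J (g : nat -> nat -> R[i]) (rho : R) (A B : nat -> R[i]) :
  0 <= rho ->
  \sum_(j < J) nrm (\sum_(i < I) A i * g i j) ^+ 2 <= rho * \sum_(i < I) nrm (A i) ^+ 2 ->
  nrm (\sum_(i < I) \sum_(j < J) A i * B j * g i j) <=
  Num.sqrt rho * (Num.sqrt (\sum_(i < I) nrm (A i) ^+ 2) *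
     Num.sqrt (\sum_(j < J) nrm (B j) ^+ 2)).
Proof.
move=> r0 H; rewrite exchange_big/=; apply: (le_trans (nrm_sum _ _ _)).
apply: (@le_trans _ _ (\sum_(j < J) nrm (\sum_(i < I) A i * g i j) * nrm (B j))).
  apply: ler_sum => j _; rewrite -nrmM mulr_suml le_eqVlt; apply/orP; left.
  by apply/eqP; congr nrm; apply: eq_bigr => i _; rewrite mulrAC.
apply: (le_trans (cauchy_schwarz_sqrt _ _ _)).
rewrite mulrA ler_wpM2r ?sqrtr_ge0// -sqrtrM// ler_wsqrtr//.
Qed.

Lemma sum_blocks2 M N K H I J a b (k : nat -> nat -> R[i]) :
  (M <= I * K)%N -> (N <= J * H)%N ->
  \sum_(m < M) \sum_(l < N) a m * b l * k m l =
  \sum_(i < I) \sum_(j < J) \sum_(r < K) \sum_(s < H)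
    extend0 M a (i * K + r)%N * extend0 N b (j * H + s)%N * k (i * K + r)%N (j * H + s)%N.
Proof.
move=> MI NJ.
rewrite (sum_blocks (fun m => \sum_(l < N) a m * b l * k m l) MI).
apply: eq_bigr => i _; rewrite exchange_big/=.
apply: eq_bigr => r _; rewrite {1}/extend0; case: ifP => mM; last first.
  by rewrite big1// => j _; rewrite big1// => s _; rewrite /extend0 mM !mul0r.
rewrite (sum_blocks (fun l => a (i * K + r)%N * b l * k (i * K + r)%N l) NJ).
apply: eq_bigr => j _; apply: eq_bigr => s _.
by rewrite /extend0 mM; case: ifP => // _; rewrite mulr0 mul0r.
Qed.

End Separation.

(** * Bilinear sums: one pair of sequences *)

Section Core.
Context {R : realType}.
Local Notation e := (@expi2pi R).
Implicit Types (a b : nat -> R[i]).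

(** The length 1 is forced when T > M, where each m is its own block. *)
Definition block_len (M T : nat) := maxn 1 (M %/ T).
Definition block_num (M T : nat) := (M %/ block_len M T).+1.

Lemma block_len_gt0 M T : (0 < block_len M T)%N.
Proof. by rewrite /block_len leq_max. Qed.

Lemma block_numP M T : (M <= block_num M T * block_len M T)%N.
Proof. by rewrite ltnW// ltn_ceil// block_len_gt0. Qed.

Lemma block_len_ltP M T r : (0 < T)%N -> (r < block_len M T)%N -> (r * T <= M)%N.
Proof.
rewrite /block_len => T0; rewrite leq_max => /orP[|]; first by rewrite ltnS leqn0 => /eqP ->.
by move=> /ltnW; rewrite leq_divRL.
Qed.

(** The factors in the variable m = Ki + r of the (p, q) term of the
    expansion, normalised to lie in [0, 1]: (m / M)^p comes from the phase
    lambda m s, (r T / M)^q from lambda r H j. [weightB] holds the matching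
    factors in l = Hj + s. *)
Definition weightA M T p q (i r : nat) : R :=
  ((i * block_len M T + r)%:R / M%:R) ^+ p * ((r * T)%:R / M%:R) ^+ q.
Definition weightB N T p q (j s : nat) : R :=
  ((s * T)%:R / N%:R) ^+ p * ((j * block_len N T)%:R / N%:R) ^+ q.

Lemma weightA_le1 M T p q i r : (0 < M)%N -> (0 < T)%N -> (i * block_len M T + r < M)%N ->
  (r < block_len M T)%N -> 0 <= weightA M T p q i r <= 1.
Proof.
move=> M0 T0 iM rK; rewrite /weightA; apply/andP; split.
  by apply: mulr_ge0; apply: exprn_ge0; rewrite divr_ge0.
rewrite mulr_ile1 ?exprn_ge0 ?divr_ge0// exprn_ile1 ?divr_ge0//.
- by rewrite ler_pdivrMr ?ltr0n// mul1r ler_nat ltnW.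
- by rewrite ler_pdivrMr ?ltr0n// mul1r ler_nat block_len_ltP.
Qed.

Lemma weightB_le1 N T p q j s : (0 < N)%N -> (0 < T)%N -> (j * block_len N T + s < N)%N ->
  (s < block_len N T)%N -> 0 <= weightB N T p q j s <= 1.
Proof.
move=> N0 T0 jN sH; rewrite /weightB; apply/andP; split.
  by apply: mulr_ge0; apply: exprn_ge0; rewrite divr_ge0.
rewrite mulr_ile1 ?exprn_ge0 ?divr_ge0// exprn_ile1 ?divr_ge0//.
- by rewrite ler_pdivrMr ?ltr0n// mul1r ler_nat block_len_ltP.
- by rewrite ler_pdivrMr ?ltr0n// mul1r ler_nat (leq_trans _ (ltnW jN))// leq_addr.
Qed.

(** Since |lambda| <= T/(16 M N), the two small phases are k x1 and k x2 with
    |2 pi k| <= 1/2 and x1, x2 in [0, 1], so that the expansions have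
    geometric coefficients; the remaining phase lambda K H i j depends on the
    blocks only. The error of replacing e by its approximation vanishes as n
    grows. *)
Lemma bilinear_core (M N T : nat) (lam rho : R) a b n :
  (0 < M)%N -> (0 < N)%N -> (0 < T)%N -> (0 < n)%N ->
  `|lam| * (16 * M * N)%:R <= T%:R -> 0 <= rho ->
  (forall A : nat -> R[i], \sum_(j < block_num N T) nrm (\sum_(i < block_num M T)
        A i * e (lam * (block_len M T * block_len N T)%:R * i%:R * j%:R)) ^+ 2 <=
     rho * \sum_(i < block_num M T) nrm (A i) ^+ 2) ->
  nrm (\sum_(m < M) \sum_(l < N) a m * b l * e (lam * (m * l)%:R)) <=
  Num.sqrt rho * \sum_(p < n.+1) \sum_(q < n.+1) 2^-1 ^+ p * 2^-1 ^+ q *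
    (Num.sqrt (\sum_(i < block_num M T) nrm (block_sum M (block_len M T) (weightA M T p q) a i) ^+ 2) *
     Num.sqrt (\sum_(j < block_num N T) nrm (block_sum N (block_len N T) (weightB N T p q) b j) ^+ 2))
  + 3 / n%:R * ((\sum_(m < M) nrm (a m)) * (\sum_(l < N) nrm (b l))).
Proof.
move=> M0 N0 T0 n0 lamT rho0 mat.
set I := block_num M T; set J := block_num N T; set K := block_len M T; set H := block_len N T.
have MR : (M%:R : R) != 0 by rewrite pnatr_eq0 -lt0n.
have NR : (N%:R : R) != 0 by rewrite pnatr_eq0 -lt0n.
have TR : (T%:R : R) != 0 by rewrite pnatr_eq0 -lt0n.
pose k : R := lam * M%:R * N%:R / T%:R.
have k2 : `|2 * pi * k| <= 2^-1.
  have k16 : `|k| <= 16^-1.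
    rewrite /k !normrM normfV !normr_nat ler_pdivrMr ?ltr0n//.
    rewrite -(ler_pM2l (ltr0n R 16)) [leRHS]mulrA divff ?mul1r ?pnatr_eq0//; apply: le_trans lamT.
    by rewrite !natrM; apply: ler_of_eq; ring.
  rewrite normrM ger0_norm ?mulr_ge0 ?pi_ge0//.
  by have := @pihalf_lt2 R; have := @pi_ge0 R; have := normr_ge0 k; nra.
have k2u u : 0 <= u <= 1 -> `|2 * pi * (k * u)| <= 2^-1.
  move=> /andP[u0 u1]; rewrite mulrA normrM (ger0_norm u0).
  by rewrite (le_trans _ k2)// ler_piMr.
pose x1 m l : R := (m%:R / M%:R) * ((l %% H * T)%:R / N%:R).
pose x2 m l : R := ((m %% K * T)%:R / M%:R) * ((l %/ H * H)%:R / N%:R).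
have x1P m l : (m < M)%N -> (l < N)%N -> 0 <= x1 m l <= 1.
  move=> mM lN; rewrite /x1; apply/andP; split; first by rewrite mulr_ge0 ?divr_ge0.
  rewrite mulr_ile1 ?divr_ge0// ler_pdivrMr ?ltr0n// mul1r ler_nat; first exact: ltnW.
  by rewrite block_len_ltP// ltn_mod block_len_gt0.
have x2P m l : (m < M)%N -> (l < N)%N -> 0 <= x2 m l <= 1.
  move=> mM lN; rewrite /x2; apply/andP; split; first by rewrite mulr_ge0 ?divr_ge0.
  rewrite mulr_ile1 ?divr_ge0// ler_pdivrMr ?ltr0n// mul1r ler_nat.
    by rewrite block_len_ltP// ltn_mod block_len_gt0.
  by rewrite (leq_trans (leq_divM _ _))// ltnW.
pose c m l := e (lam * (K * H)%:R * (m %/ K)%:R * (l %/ H)%:R).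
have split_e m l : e (lam * (m * l)%:R) = c m l * (e (k * x1 m l) * e (k * x2 m l)).
  rewrite /c -!expiD; congr (e _); rewrite /k /x1 /x2.
  have Em : m%:R = (m %/ K)%:R * K%:R + (m %% K)%:R :> R.
    by rewrite -natrM -natrD -divn_eq.
  have El : l%:R = (l %/ H)%:R * H%:R + (l %% H)%:R :> R.
    by rewrite -natrM -natrD -divn_eq.
  rewrite !natrM Em El.
  move: ((m %/ K)%:R : R) (K%:R : R) ((m %% K)%:R : R) => m1 m2 m3.
  move: ((l %/ H)%:R : R) (H%:R : R) ((l %% H)%:R : R) => l1 l2 l3.
  by field; rewrite MR NR TR.
pose k' m l := c m l * (expi_approx n (k * x1 m l) * expi_approx n (k * x2 m l)).
have -> : \sum_(m < M) \sum_(l < N) a m * b l * e (lam * (m * l)%:R) =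
   \sum_(m < M) \sum_(l < N) a m * b l * k' m l +
   \sum_(m < M) \sum_(l < N) a m * b l * (e (lam * (m * l)%:R) - k' m l).
  rewrite -big_split/=; apply: eq_bigr => m _; rewrite -big_split/=.
  by apply: eq_bigr => l _; ring.
apply: (le_trans (nrmD _ _)); apply: lerD; last first.
  rewrite big_distrlr/= mulr_sumr; apply: (le_trans (nrm_sum _ _ _)).
  apply: ler_sum => m _; rewrite mulr_sumr; apply: (le_trans (nrm_sum _ _ _)).
  apply: ler_sum => l _; rewrite !nrmM mulrC; apply: ler_wpM2r.
    by rewrite mulr_ge0 ?nrm_ge0.
  rewrite split_e /k' -mulrBr nrmM nrm_expi mul1r.
  by apply: expi_approx_mul => //; apply: k2u; [exact: x1P|exact: x2P].
rewrite (sum_blocks2 a b k' (block_numP M T) (block_numP N T)) -/I -/J -/K -/H.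
(* Exchanging the order of summation brings the expansions outside. *)
have main : \sum_(i < I) \sum_(j < J) \sum_(r < K) \sum_(s < H)
    extend0 M a (i * K + r)%N * extend0 N b (j * H + s)%N * k' (i * K + r)%N (j * H + s)%N =
  \sum_(p < n.+1) \sum_(q < n.+1) expi_coef n k p * expi_coef n k q *
    \sum_(i < I) \sum_(j < J) block_sum M K (weightA M T p q) a i * block_sum N H (weightB N T p q) b j *
       e (lam * (K * H)%:R * i%:R * j%:R).
  under [RHS]eq_bigr do under eq_bigr do rewrite mulr_sumr.
  under [RHS]eq_bigr do rewrite exchange_big/=.
  rewrite [RHS]exchange_big/=; apply: eq_bigr => i _.
  under [RHS]eq_bigr do under eq_bigr do rewrite mulr_sumr.
  under [RHS]eq_bigr do rewrite exchange_big/=.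
  rewrite [RHS]exchange_big/=; apply: eq_bigr => j _.
  under [RHS]eq_bigr do under eq_bigr do
    rewrite /block_sum big_distrlr/= mulr_suml mulr_sumr.
  under [RHS]eq_bigr do rewrite exchange_big/=.
  rewrite [RHS]exchange_big/=; apply: eq_bigr => r _.
  under [RHS]eq_bigr do under eq_bigr do rewrite mulr_suml mulr_sumr.
  under [RHS]eq_bigr do rewrite exchange_big/=.
  rewrite [RHS]exchange_big/=; apply: eq_bigr => s _.
  have K0 : (0 < K)%N by exact: block_len_gt0.
  have H0 : (0 < H)%N by exact: block_len_gt0.
  rewrite /k' /c /x1 /x2 !divnMDl// !modnMDl !modn_small// !divn_small// !addn0.
  rewrite !expi_approxE big_distrlr/= !mulr_sumr.
  apply: eq_bigr => p _; rewrite !mulr_sumr; apply: eq_bigr => q _.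
  rewrite /weightA /weightB -/K -/H !exprMn !rmorphM/=; ring.
rewrite main; apply: (le_trans (nrm_sum _ _ _)).
rewrite mulr_sumr; apply: ler_sum => p _; apply: (le_trans (nrm_sum _ _ _)).
rewrite mulr_sumr; apply: ler_sum => q _; rewrite nrmM mulrCA.
apply: ler_pM; rewrite ?nrm_ge0//.
  by rewrite nrmM; apply: ler_pM; rewrite ?nrm_ge0// nrm_expi_coef.
apply: (bilinear_form_le (g := fun i j => e (lam * (K * H)%:R * i%:R * j%:R))) => //.
Qed.

End Core.

(** * Sums over primitive characters *)

Section CharSum.
Context {R : realType}.
Local Notation e := (@expi2pi R).
Implicit Types (a b : nat -> R[i]) (chi : nat -> R[i]).

(** A single list of pairs (q, chi) turns the double sum into one sum, to
    which Cauchy-Schwarz applies directly. *)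
Definition prim_list Q : seq (nat * (nat -> R[i])) :=
  [seq (q, chi) | q <- index_iota 1 Q.+1, chi <- prim_chars (R := R) q].

Definition prim_weight (t : nat * (nat -> R[i])) : R := t.1%:R / (totient t.1)%:R.

Definition prim_sum Q (G : (nat -> R[i]) -> R) : R :=
  \sum_(t <- prim_list Q) prim_weight t * G t.2.

Lemma prim_sumE Q G : prim_sum Q G = \sum_(1 <= q < Q.+1) q%:R / (totient q)%:R *
  \sum_(chi <- prim_chars q) G chi.
Proof.
rewrite /prim_sum /prim_list big_allpairs_dep/=; apply: eq_bigr => q _.
by rewrite mulr_sumr.
Qed.

Lemma prim_listP Q t : t \in prim_list Q ->
  [/\ (0 < t.1)%N, (t.1 <= Q)%N & primitive_char t.1 t.2].
Proof.
move=> /allpairsPdep [q [chi [+ chiP ->]]]; rewrite mem_index_iota ltnS => /andP[q0 qQ].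
by split => //; exact: prim_charsP.
Qed.

Lemma prim_weight_ge0 t : 0 <= prim_weight t.
Proof. by rewrite divr_ge0. Qed.

Lemma prim_sum_le Q (F G : (nat -> R[i]) -> R) :
  (forall q chi, (0 < q <= Q)%N -> primitive_char q chi -> F chi <= G chi) ->
  prim_sum Q F <= prim_sum Q G.
Proof.
move=> FG; rewrite /prim_sum !big_seq; apply: ler_sum => t /prim_listP[q0 qQ p].
by apply: ler_wpM2l; [exact: prim_weight_ge0|apply: (FG t.1) => //; rewrite q0].
Qed.

Lemma eq_prim_sum Q (F G : (nat -> R[i]) -> R) : F =1 G -> prim_sum Q F = prim_sum Q G.
Proof. by move=> FG; apply: eq_bigr => t _; rewrite FG. Qed.

Lemma prim_sumD Q F G : prim_sum Q (fun chi => F chi + G chi) = prim_sum Q F + prim_sum Q G.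
Proof. by rewrite /prim_sum -big_split/=; apply: eq_bigr => t _; rewrite mulrDr. Qed.

Lemma prim_sumZ Q k F : prim_sum Q (fun chi => k * F chi) = k * prim_sum Q F.
Proof. by rewrite /prim_sum mulr_sumr; apply: eq_bigr => t _; rewrite mulrCA. Qed.

Lemma prim_sum_sum Q I (r : seq I) (P : pred I) (F : I -> (nat -> R[i]) -> R) :
  prim_sum Q (fun chi => \sum_(i <- r | P i) F i chi) = \sum_(i <- r | P i) prim_sum Q (F i).
Proof.
rewrite /prim_sum exchange_big/=; apply: eq_bigr => t _; by rewrite mulr_sumr.
Qed.

(** There are at most phi(q) primitive characters mod q. *)
Lemma prim_sum_const Q k : 0 <= k -> prim_sum Q (fun=> k) <= k * (Q ^ 2)%:R.
Proof.
move=> k0; rewrite prim_sumE.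
apply: (@le_trans _ _ (\sum_(1 <= q < Q.+1) k * Q%:R)).
  rewrite !big_nat; apply: ler_sum => q /andP[q0 qQ].
  have -> : \sum_(chi <- prim_chars (R := R) q) k = k * (size (prim_chars (R := R) q))%:R.
    by rewrite big_const_seq count_predT iter_addr_0 mulr_natr.
  rewrite mulrCA ler_wpM2l//.
  rewrite mulrAC ler_pdivrMr ?ltr0n ?totient_gt0//.
  by apply: ler_pM => //; rewrite ler_nat// size_prim_chars.
by rewrite sumr_const_nat subSS subn0 -[_ *+ Q]mulr_natr -mulrA -natrM expnS expn1.
Qed.

Lemma prim_sum_cauchy Q (F G : (nat -> R[i]) -> R) : (forall chi, 0 <= F chi) -> (forall chi, 0 <= G chi) ->
  prim_sum Q (fun chi => Num.sqrt (F chi) * Num.sqrt (G chi)) <=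
  Num.sqrt (prim_sum Q F) * Num.sqrt (prim_sum Q G).
Proof.
move=> F0 G0; rewrite /prim_sum.
have := cauchy_schwarz_sqrt (prim_list Q)
  (fun t => Num.sqrt (prim_weight t * F t.2)) (fun t => Num.sqrt (prim_weight t * G t.2)).
have E t : Num.sqrt (prim_weight t * F t.2) * Num.sqrt (prim_weight t * G t.2) =
    prim_weight t * (Num.sqrt (F t.2) * Num.sqrt (G t.2)).
  rewrite !(sqrtrM _ (prim_weight_ge0 t)); have := sqr_sqrtr (prim_weight_ge0 t).
  move: (Num.sqrt (prim_weight t)) => s ss; rewrite -[in RHS]ss; ring.
under eq_bigr do rewrite E.
move=> /le_trans; apply.
apply: ler_of_eq.
congr (Num.sqrt _ * Num.sqrt _); apply: eq_bigr => t _;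
  by rewrite sqr_sqrtr// mulr_ge0// prim_weight_ge0.
Qed.

Definition l2 M a : R := Num.sqrt (\sum_(m < M) nrm (a m) ^+ 2).

Lemma l2_ge0 M a : 0 <= l2 M a.
Proof. exact: sqrtr_ge0. Qed.

Lemma sqr_l2 M a : l2 M a ^+ 2 = \sum_(m < M) nrm (a m) ^+ 2.
Proof. by rewrite sqr_sqrtr// sumr_ge0// => *; exact: sqr_ge0. Qed.

(** The large sieve on each block; weights in [0, 1] do no harm. *)
Lemma large_sieve_block Q M K I (f : nat -> nat -> R) a : (M <= I * K)%N ->
  (forall i r, (i * K + r < M)%N -> (r < K)%N -> 0 <= f i r <= 1) ->
  prim_sum Q (fun chi => \sum_(i < I) nrm (block_sum M K f (fun m => a m * chi m) i) ^+ 2) <=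
  32 * (K + Q ^ 2)%:R * l2 M a ^+ 2.
Proof.
move=> MI f1; rewrite prim_sum_sum sqr_l2 (sum_blocks (fun m => nrm (a m) ^+ 2) MI).
rewrite mulr_sumr; apply: ler_sum => i _.
pose a' r := extend0 M a (i * K + r)%N * (f i r)%:C%C.
have := large_sieve Q K (i * K) a'; rewrite -prim_sumE => H.
apply: (@le_trans _ _ (32 * (K + Q ^ 2)%:R * \sum_(r < K) nrm (a' r) ^+ 2)).
  apply: le_trans H; apply: ler_of_eq.
  apply: eq_prim_sum => chi; congr (nrm _ ^+ 2); apply: eq_bigr => r _.
  by rewrite /a' /extend0; case: ifP => _; rewrite ?mul0r// mulrAC.
rewrite ler_wpM2l ?mulr_ge0//; apply: ler_sum => r _.
rewrite /a' /extend0; case: ifP => ir; last by rewrite mul0r nrm0 expr0n.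
have /andP[f0 fle] := f1 _ _ ir (ltn_ord r).
rewrite nrmM nrm_real ger0_norm// lerXn2r ?nnegrE ?nrm_ge0 ?mulr_ge0 ?nrm_ge0//.
by rewrite ler_piMr// nrm_ge0.
Qed.

(** Lets n tend to infinity in [bilinear_core]. *)
Lemma le_of_le_add_inv (X Y D : R) :
  (forall n, (0 < n)%N -> X <= Y + D / n%:R) -> X <= Y.
Proof.
move=> H; rewrite leNgt; apply/negP => YX.
pose d := X - Y; have d0 : 0 < d by rewrite subr_gt0.
pose n := (Num.truncn (`|D| / d)).+1.
have nD : `|D| / d < n%:R by have /andP[] := truncn_itv (divr_ge0 (normr_ge0 D) (ltW d0)).
have := H n isT; rewrite leNgt => /negP; apply.
rewrite -ltrBrDl -/d ltr_pdivrMr ?ltr0n//.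
by move: nD; rewrite ltr_pdivrMr// mulrC; apply: le_lt_trans; exact: ler_norm.
Qed.

Definition bilin M N a b chi (lam : R) : R[i] :=
  \sum_(m < M) \sum_(l < N) a m * b l * chi (m * l)%N * e (lam * (m * l)%:R).

(** Bilinear estimate for the characters selected by P, those with lambda_chi
    in a given range. For each term of the expansion, Cauchy-Schwarz over the
    characters and two large sieves on blocks give a bound X independent of p
    and q; the geometric weights then cost a factor 4. *)
Lemma bilinear_prim_sum Q M N T (rho : R) (lam : (nat -> R[i]) -> R)
    (P : pred (nat -> R[i])) a b :
  (0 < M)%N -> (0 < N)%N -> (0 < T)%N -> 0 <= rho ->
  (forall chi, P chi -> `|lam chi| * (16 * M * N)%:R <= T%:R) ->
  (forall chi (A : nat -> R[i]), P chi ->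
    \sum_(j < block_num N T) nrm (\sum_(i < block_num M T)
       A i * e (lam chi * (block_len M T * block_len N T)%:R * i%:R * j%:R)) ^+ 2 <=
     rho * \sum_(i < block_num M T) nrm (A i) ^+ 2) ->
  prim_sum Q (fun chi => if P chi then nrm (bilin M N a b chi (lam chi)) else 0) <=
  128 * Num.sqrt rho * Num.sqrt ((block_len M T + Q ^ 2) * (block_len N T + Q ^ 2))%:R *
    (l2 M a * l2 N b).
Proof.
move=> M0 N0 T0 rho0 lamP mat.
pose A p q chi := \sum_(i < block_num M T) nrm (block_sum M (block_len M T) (weightA M T p q) (fun m => a m * chi m) i) ^+ 2.
pose B p q chi := \sum_(i < block_num N T) nrm (block_sum N (block_len N T) (weightB N T p q) (fun m => b m * chi m) i) ^+ 2.
have A0 p q chi : 0 <= A p q chi by apply: sumr_ge0 => *; exact: sqr_ge0.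
have B0 p q chi : 0 <= B p q chi by apply: sumr_ge0 => *; exact: sqr_ge0.
pose D := prim_sum Q (fun chi => (\sum_(m < M) nrm (a m * chi m)) * (\sum_(l < N) nrm (b l * chi l))).
apply: (@le_of_le_add_inv _ _ (3 * D)) => n n0.
pose S p q := prim_sum Q (fun chi => Num.sqrt (A p q chi) * Num.sqrt (B p q chi)).
apply: (@le_trans _ _ (Num.sqrt rho *
  \sum_(p < n.+1) \sum_(q < n.+1) 2^-1 ^+ p * 2^-1 ^+ q * S p q + 3 * D / n%:R)).
  have -> : Num.sqrt rho * \sum_(p < n.+1) \sum_(q < n.+1) 2^-1 ^+ p * 2^-1 ^+ q * S p q =
    prim_sum Q (fun chi => Num.sqrt rho * \sum_(p < n.+1) \sum_(q < n.+1)
       2^-1 ^+ p * 2^-1 ^+ q * (Num.sqrt (A p q chi) * Num.sqrt (B p q chi))).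
    rewrite prim_sumZ prim_sum_sum; congr (_ * _); apply: eq_bigr => p _.
    by rewrite prim_sum_sum; apply: eq_bigr => q _; rewrite prim_sumZ.
  rewrite [3 * D / _]mulrAC -prim_sumZ -prim_sumD; apply: prim_sum_le => q chi /andP[q0 _] [dchi _].
  case: ifPn => Pchi; last first.
    apply: addr_ge0; rewrite !mulr_ge0 ?sqrtr_ge0//.
      by apply: sumr_ge0 => p _; apply: sumr_ge0 => r _; rewrite !mulr_ge0 ?exprn_ge0 ?sqrtr_ge0.
    by apply: sumr_ge0 => *; exact: nrm_ge0.
    by apply: sumr_ge0 => *; exact: nrm_ge0.
  have := bilinear_core (fun m => a m * chi m) (fun l => b l * chi l) M0 N0 T0 n0
    (lamP chi Pchi) rho0 (fun A => mat chi A Pchi).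
  apply: le_trans; apply: ler_of_eq.
  congr nrm; apply: eq_bigr => m _; apply: eq_bigr => l _.
  by rewrite (dcharM dchi); ring.
rewrite lerD2r.
pose X := 32 * Num.sqrt ((block_len M T + Q ^ 2) * (block_len N T + Q ^ 2))%:R * (l2 M a * l2 N b).
have X0 : 0 <= X by rewrite !mulr_ge0 ?sqrtr_ge0 ?l2_ge0.
have SX p q : S p q <= X.
  apply: (le_trans (prim_sum_cauchy _ _ _)) => //.
  have hA : prim_sum Q (A p q) <= 32 * (block_len M T + Q ^ 2)%:R * l2 M a ^+ 2.
    apply: large_sieve_block; first exact: block_numP.
    by move=> i r iM rK; exact: weightA_le1.
  have hB : prim_sum Q (B p q) <= 32 * (block_len N T + Q ^ 2)%:R * l2 N b ^+ 2.
    apply: large_sieve_block; first exact: block_numP.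
    by move=> i r iM rK; exact: weightB_le1.
  apply: (@le_trans _ _ (Num.sqrt (32 * (block_len M T + Q ^ 2)%:R * l2 M a ^+ 2) *
     Num.sqrt (32 * (block_len N T + Q ^ 2)%:R * l2 N b ^+ 2))).
    by apply: ler_pM; rewrite ?sqrtr_ge0// ler_wsqrtr.
  apply: ler_of_eq.
  set u := (block_len M T + Q ^ 2)%N; set v := (block_len N T + Q ^ 2)%N.
  have u0 : 0 <= 32 * u%:R :> R by rewrite mulr_ge0.
  have v0 : 0 <= 32 * v%:R :> R by rewrite mulr_ge0.
  rewrite (sqrtrM _ u0) (sqrtrM _ v0) !sqrtr_sqr (ger0_norm (l2_ge0 M a)) (ger0_norm (l2_ge0 N b)).
  rewrite mulrACA -(sqrtrM _ u0) /X -/u -/v; congr (_ * _).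
  have -> : 32 * u%:R * (32 * v%:R) = 32 ^+ 2 * (u * v)%:R :> R by rewrite natrM; ring.
  by rewrite sqrtrM ?sqr_ge0// sqrtr_sqr ger0_norm.
have -> : 128 * Num.sqrt rho * Num.sqrt ((block_len M T + Q ^ 2) * (block_len N T + Q ^ 2))%:R * (l2 M a * l2 N b)
   = Num.sqrt rho * (4 * X) by rewrite /X; ring.
rewrite ler_wpM2l ?sqrtr_ge0//.
apply: (@le_trans _ _ (\sum_(p < n.+1) \sum_(q < n.+1) 2^-1 ^+ p * 2^-1 ^+ q * X)).
  by apply: ler_sum => p _; apply: ler_sum => q _; rewrite ler_wpM2l// mulr_ge0 ?exprn_ge0.
under eq_bigr do rewrite -mulr_suml -mulr_sumr.
rewrite -mulr_suml -mulr_suml ler_wpM2r//.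
have := geo_half (R := R) n.+1.
have : 0 <= \sum_(p < n.+1) (2^-1 : R) ^+ p by apply: sumr_ge0 => *; rewrite exprn_ge0.
nra.
Qed.

End CharSum.

(** * Type II sums on a rectangle *)

Section TypeII.
Context {R : realType}.
Local Notation e := (@expi2pi R).
Implicit Types (a b : nat -> R[i]) (chi : nat -> R[i]).

Lemma harm_pow2 B : harm (2 ^ B) <= B%:R :> R.
Proof.
elim: B => [|B IH]; first by rewrite /harm expn0 big_ord1 invr0.
have E : harm (2 ^ B.+1) = harm (2 ^ B) + \sum_(2 ^ B <= d < 2 ^ B.+1) (d%:R)^-1 :> R.
  rewrite /harm -(big_mkord xpredT (fun d => (d%:R)^-1 : R)) (big_cat_nat (n := 2 ^ B)) ?leq_exp2l//=.
  by rewrite big_mkord.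
rewrite E -natr1 lerD//.
apply: (@le_trans _ _ (\sum_(2 ^ B <= d < 2 ^ B.+1) ((2 ^ B)%:R)^-1)).
  rewrite !big_nat; apply: ler_sum => d /andP[d1 _].
  have p0 : (0 < 2 ^ B)%N by rewrite expn_gt0.
  by rewrite lef_pV2 ?posrE ?ltr0n ?ler_nat// (leq_trans p0).
rewrite sumr_const_nat expnS mul2n -addnn addnK -[leLHS]mulr_natr mulVf//.
Qed.

Lemma harm_le_log B n : (n <= 2 ^ B)%N -> harm n <= B%:R :> R.
Proof. by move=> h; apply: le_trans (harm_pow2 B); exact: harm_le. Qed.

Lemma block_len_le M T : (0 < M)%N -> (block_len M T <= M)%N.
Proof. by move=> M0; rewrite /block_len geq_max M0 leq_div. Qed.

Lemma le_block_len M T : (0 < T)%N -> (M <= 2 * T * block_len M T)%N.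
Proof.
move=> T0; have h := ltn_ceil M T0.
have h2 : (M %/ T <= block_len M T)%N by rewrite /block_len leq_max leqnn orbT.
have h1 := block_len_gt0 M T; nia.
Qed.

Lemma block_len_mul_le M T : (T * block_len M T <= M + T)%N.
Proof.
rewrite /block_len; have h := leq_divM M T.
by case: (leqP 1 (M %/ T)) => H; nia.
Qed.

Lemma block_num_mul_le M T : (0 < M)%N -> (block_num M T * block_len M T <= 2 * M)%N.
Proof.
move=> M0; rewrite /block_num; have := leq_divM M (block_len M T).
have := block_len_le T M0; lia.
Qed.

Lemma block_num_le M T : (0 < M)%N -> (0 < T)%N -> (block_num M T <= 4 * T)%N.
Proof.
move=> M0 T0; have h1 := block_num_mul_le T M0; have h2 := le_block_len M T0.
have h3 := block_len_gt0 M T.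
by rewrite -(leq_pmul2r h3); nia.
Qed.

Lemma block_num_leS M T : (block_num M T <= M.+1)%N.
Proof. by rewrite ltnS leq_div. Qed.

(** With |lambda| of size T/(MN), the step g = lambda K H satisfies |g| I J <<
    T and 1/|g| << T, while I, J << T, so all terms of [exp_matrix] are O(T
    log). For T = 1 lambda may be arbitrarily small; the matrix has size 2 and
    is bounded trivially. *)
Lemma matrix_bound (M N T B : nat) (lam : R) (A : nat -> R[i]) :
  (0 < M < 2 ^ B)%N -> (0 < N)%N -> (0 < T)%N -> (0 < B)%N ->
  `|lam| <= 2^-1 -> `|lam| * (16 * M * N)%:R <= T%:R ->
  (T == 1)%N || (T%:R <= `|lam| * (32 * M * N)%:R) ->
  \sum_(j < block_num N T) nrm (\sum_(i < block_num M T)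
       A i * e (lam * (block_len M T * block_len N T)%:R * i%:R * j%:R)) ^+ 2 <=
  (600 * T * B)%:R * \sum_(i < block_num M T) nrm (A i) ^+ 2.
Proof.
move=> /andP[M0 MB] N0 T0 B0 lam2 lamT.
have A0 : 0 <= \sum_(i < block_num M T) nrm (A i) ^+ 2 by apply: sumr_ge0 => *; exact: sqr_ge0.
move=> /orP[/eqP T1|lamT2].
  subst T.
  have E k : (0 < k)%N -> block_num k 1 = 2%N.
    by move=> k0; rewrite /block_num /block_len divn1 (maxn_idPr k0) divnn k0.
  rewrite !E// in A0 *.
  have C j : nrm (\sum_(i < 2) A i * e (lam * (block_len M 1 * block_len N 1)%:R * i%:R * j%:R)) ^+ 2 <=
     2 * \sum_(i < 2) nrm (A i) ^+ 2.
    apply: (@le_trans _ _ ((\sum_(i < 2) nrm (A i)) ^+ 2)).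
      rewrite lerXn2r ?nnegrE ?nrm_ge0//; first by apply: sumr_ge0 => *; exact: nrm_ge0.
      apply: (le_trans (nrm_sum _ _ _)); apply: ler_sum => i _.
      by rewrite nrmM nrm_expi mulr1.
    have := sqr_sum_le (index_enum 'I_2) (fun i : 'I_2 => nrm (A i)).
    by rewrite {2}/index_enum -enumT size_enum_ord.
  apply: (@le_trans _ _ (\sum_(j < 2) 2 * \sum_(i < 2) nrm (A i) ^+ 2)).
    by apply: ler_sum.
  rewrite sumr_const card_ord -mulrnAl ler_wpM2r// -mulr_natr -natrM ler_nat; lia.
set K := block_len M T; set H := block_len N T; set I := block_num M T; set J := block_num N T.
have K0 : (0 < K)%N by exact: block_len_gt0.
have H0 : (0 < H)%N by exact: block_len_gt0.
pose l := `|lam|; have l0 : 0 < l.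
  have Tp : 0 < T%:R :> R by rewrite ltr0n.
  rewrite /l lt_def normr_ge0 andbT; apply/eqP => l0.
  by move: lamT2; rewrite l0 mul0r leNgt Tp.
pose g := lam * (K * H)%:R.
have gE : `|g| = l * (K%:R * H%:R) by rewrite /g normrM normr_nat natrM.
have mp : (1 : R) <= M%:R by rewrite ler1n.
have np : (1 : R) <= N%:R by rewrite ler1n.
have tp : (1 : R) <= T%:R by rewrite ler1n.
have kp : (1 : R) <= K%:R by rewrite ler1n.
have hp : (1 : R) <= H%:R by rewrite ler1n.
have lT : l * (16 * (M%:R * N%:R)) <= T%:R.
  by rewrite (_ : 16 * (M%:R * N%:R) = (16 * M * N)%:R) // !natrM mulrA.
have lT2 : T%:R <= l * (32 * (M%:R * N%:R)).
  by rewrite (_ : 32 * (M%:R * N%:R) = (32 * M * N)%:R) // !natrM mulrA.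
have g0 : g != 0 by rewrite -normr_gt0 gE !mulr_gt0 ?ltr0n.
(* Either K H = 1 and g = lambda, or T K H is at most 8 M N. *)
have g2 : `|g| <= 2^-1.
  have [kh|kh] := eqVneq (K * H)%N 1%N; first by rewrite /g kh mulr1.
  have : (T * (K * H) <= 8 * (M * N))%N.
    have [/ltnW d1|d1] := ltnP (M %/ T) 1; last first.
      have TK : (T * K <= M)%N.
        by rewrite /K /block_len (maxn_idPr d1) mulnC leq_divM.
      have HN : (H <= N)%N by exact: block_len_le.
      by rewrite mulnA; apply: (@leq_trans (M * N)); [exact: leq_mul|exact: leq_pmull].
    have K1 : K = 1%N by rewrite /K /block_len (maxn_idPl d1).
    have [/ltnW d2|d2] := ltnP (N %/ T) 1.
      by move: kh; rewrite K1 /H /block_len (maxn_idPl d2).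
    have TH : (T * H <= N)%N by rewrite /H /block_len (maxn_idPr d2) mulnC leq_divM.
    by rewrite K1 mul1n (leq_trans TH)// mulnA leq_pmull// muln_gt0 M0.
  rewrite -(ler_nat R) !natrM => TKH.
  rewrite gE -(ler_pM2l (lt_le_trans ltr01 tp)).
  have : l * (8 * (M%:R * N%:R)) <= T%:R / 2 by lra.
  by have := ler_wpM2l (ltW l0) TKH; rewrite mulrCA; lra.
have := exp_matrix I J A g0 g2.
move=> /le_trans; apply; rewrite ler_wpM2r//.
have IK : I%:R * K%:R <= 2 * M%:R :> R by rewrite -!natrM ler_nat block_num_mul_le.
have JH : J%:R * H%:R <= 2 * N%:R :> R by rewrite -!natrM ler_nat block_num_mul_le.
have I4 : I%:R <= 4 * T%:R :> R by rewrite -natrM ler_nat block_num_le.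
have J4 : J%:R <= 4 * T%:R :> R by rewrite -natrM ler_nat block_num_le.
have mK : M%:R <= 2 * T%:R * K%:R :> R by rewrite -!natrM ler_nat le_block_len.
have nH : N%:R <= 2 * T%:R * H%:R :> R by rewrite -!natrM ler_nat le_block_len.
have hI : harm I <= B%:R :> R.
  by apply: harm_le_log; rewrite (leq_trans (block_num_leS _ _)).
have gI : 4 * `|g| * I%:R * J%:R <= T%:R.
  have IKJH : (I%:R * K%:R) * (J%:R * H%:R) <= (2 * M%:R) * (2 * N%:R) :> R.
    by apply: ler_pM; rewrite ?mulr_ge0.
  have -> : 4 * `|g| * I%:R * J%:R = 4 * l * ((I%:R * K%:R) * (J%:R * H%:R)) by rewrite gE; ring.
  have := ler_wpM2l (ltW l0) IKJH; lra.
have ginv : `|g|^-1 <= 128 * T%:R.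
  rewrite -[_^-1]mul1r ler_pdivrMr ?normr_gt0// gE.
  have h : M%:R * N%:R <= (2 * T%:R * K%:R) * (2 * T%:R * H%:R) :> R by apply: ler_pM.
  have := ler_wpM2l (ltW l0) h => h2.
  have h3 : T%:R * 1 <= T%:R * (128 * T%:R * (l * (K%:R * H%:R))).
    rewrite mulr1; apply: (le_trans lT2).
    have -> : T%:R * (128 * T%:R * (l * (K%:R * H%:R))) = 32 * (l * ((2 * T%:R * K%:R) * (2 * T%:R * H%:R))) by ring.
    by rewrite mulrCA ler_wpM2l.
  by move: h3; rewrite ler_pM2l// ltr0n.
have -> : (4 * `|g| * I%:R + 1) * (J%:R + 4 / `|g| * harm I) =
  4 * `|g| * I%:R * J%:R + J%:R + 16 * I%:R * harm I + 4 * `|g|^-1 * harm I.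
  by field; rewrite normr_eq0.
have B1 : 1 <= B%:R :> R by rewrite ler1n.
have h0 : 0 <= harm I :> R by exact: harm_ge0.
have e1 : I%:R * harm I <= 4 * T%:R * B%:R :> R by apply: ler_pM.
have e2 : `|g|^-1 * harm I <= 128 * T%:R * B%:R :> R by apply: ler_pM; rewrite ?invr_ge0.
rewrite !natrM.
have : T%:R <= T%:R * B%:R :> R by rewrite ler_peMr.
lra.
Qed.

Lemma pow2_bound M N B : (M < 2 ^ B)%N -> (N < 2 ^ B)%N ->
  (16 * M * N <= 2 ^ (2 * B + 3).+1)%N.
Proof.
move=> MB NB; rewrite -addnS [(2 ^ _)%N]expnD mul2n -addnn expnD.
have := leq_mul (ltnW MB) (ltnW NB); move: (2 ^ B)%N => p; lia.
Qed.

(** At least 128 * 25 * 6: the constant of [bilinear_prim_sum], a bound for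
    the square root of the 600 in [matrix_bound], and the number 2 B + 4 of
    ranges for lambda, over B. *)
Definition type2_const : R := 200 * 100.

Lemma type2_const_ge0 : 0 <= type2_const.
Proof. by rewrite mulr_ge0. Qed.

Definition type2_factor (Q M N : nat) (theta : R) : R :=
  (M * N)%:R + 2 * (Q ^ 2)%:R * (M + N)%:R +
  4 * (Q ^ 4)%:R * (1 + 32 * theta * (M * N)%:R).

(** The characters are sorted by the size of lambda_chi: class t has 2^(t-1) <
    16 M N |lambda_chi| <= 2^t. Only O(log) classes are nonempty, and in each
    of them 2^t <= 1 + 32 theta M N. *)
Lemma type2_rect Q M N B (theta : R) (lam : (nat -> R[i]) -> R) a b :
  (0 < Q)%N -> (0 < M < 2 ^ B)%N -> (0 < N < 2 ^ B)%N -> theta <= 2^-1 ->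
  (forall chi, `|lam chi| <= theta) ->
  prim_sum Q (fun chi => nrm (bilin M N a b chi (lam chi))) <=
  type2_const * (B ^ 2)%:R * Num.sqrt (type2_factor Q M N theta) * (l2 M a * l2 N b).
Proof.
move=> Q0 MB NB th2 lamth; have /andP[M0 MB'] := MB; have /andP[N0 NB'] := NB.
have B0 : (0 < B)%N.
  by rewrite lt0n; apply: contraTneq MB' => ->; rewrite expn0 ltnS leqn0 -lt0n.
have B1 : 1 <= B%:R :> R by rewrite ler1n.
have th0 : 0 <= theta by apply: le_trans (lamth (fun=> 0)).
pose mn : R := (16 * M * N)%:R.
pose P t chi := if t is t'.+1 then ((2 ^ t')%:R < `|lam chi| * mn <= (2 ^ t)%:R)
  else `|lam chi| * mn <= 1.
pose G t chi := if P t chi then nrm (bilin M N a b chi (lam chi)) else 0.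
have cover chi : exists2 t, (t < 2 * B + 4)%N & P t chi.
  have [s1|s1] := leP (`|lam chi| * mn) 1; first by exists 0%N => //; lia.
  have tmax : `|lam chi| * mn <= (2 ^ (2 * B + 3))%:R.
    apply: (@le_trans _ _ (2^-1 * mn)).
      by rewrite ler_wpM2r// (le_trans (lamth _)).
    by rewrite mulrC ler_pdivrMr// -natrM ler_nat -expnSr pow2_bound.
  have ex : exists t, `|lam chi| * mn <= (2 ^ t)%:R by exists (2 * B + 3)%N.
  have := ex_minnP ex; case=> -[|t] Pt mint.
    by move: Pt; rewrite expn0 leNgt s1.
  exists t.+1.
    have h := mint _ tmax; clear -h; lia.
  rewrite /P Pt andbT ltNge; apply/negP => /mint; by rewrite ltnn.
apply: (@le_trans _ _ (\sum_(t < 2 * B + 4) prim_sum Q (G t))).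
  rewrite -prim_sum_sum; apply: prim_sum_le => q chi _ _.
  have [t tB Pt] := cover chi.
  rewrite (bigD1 (Ordinal tB))//= {1}/G Pt lerDl.
  by apply: sumr_ge0 => s _; rewrite /G; case: ifP => _; rewrite ?nrm_ge0.
pose Y := type2_factor Q M N theta.
have Y0 : 0 <= Y by rewrite /Y /type2_factor !addr_ge0 ?mulr_ge0 ?addr_ge0 ?mulr_ge0.
have LL0 : 0 <= l2 M a * l2 N b by rewrite mulr_ge0 ?l2_ge0.
have each t : prim_sum Q (G t) <= 128 * (25 * B%:R * Num.sqrt Y) * (l2 M a * l2 N b).
  (* Classes beyond the range allowed by theta are empty. *)
  have [Tle|Tgt] := leP (2 ^ t)%:R (1 + 32 * theta * (M * N)%:R); last first.
    rewrite (_ : prim_sum Q (G t) = prim_sum Q (fun=> 0)).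
      rewrite /prim_sum; under eq_bigr do rewrite mulr0.
      by rewrite big1_eq !mulr_ge0 ?l2_ge0 ?sqrtr_ge0.
    apply: eq_prim_sum => chi; rewrite /G; case: ifP => //.
    case: t Tgt => [|t]; rewrite ?expn0 => Tgt /=.
      by move: Tgt; rewrite ltNge lerDl !mulr_ge0.
    move=> /andP[h _]; move: Tgt; rewrite ltNge => /negP; case.
    rewrite expnS natrM; have := ler_wpM2r (ler0n R (16 * M * N)) (lamth chi).
    rewrite -/mn => h2; have := lt_le_trans h h2.
    rewrite /mn -mulnA natrM => h3; apply: (@le_trans _ _ (2 * (theta * (16 * (M * N)%:R)))).
      by rewrite ler_wpM2l// ltW.
    by rewrite (_ : 2 * _ = 32 * theta * (M * N)%:R) ?lerDr//; ring.
  pose T := (2 ^ t)%N; have T0 : (0 < T)%N by rewrite expn_gt0.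
  have lamP chi : P t chi -> `|lam chi| * (16 * M * N)%:R <= T%:R.
    by rewrite /P /T; case: t {Tle T T0} => [|t]; [rewrite expn0|case/andP].
  apply: (le_trans (@bilinear_prim_sum R Q M N T (600 * T * B)%:R lam (P t) a b M0 N0 T0 (ler0n _ _) lamP _)).
    move=> chi A Pt; apply: (@matrix_bound M N T B (lam chi) A) => //.
    - exact: le_trans (lamth _) th2.
    - exact: lamP.
    - rewrite /T; case: t Pt {Tle T T0 lamP} => [|t]; first by rewrite expn0.
      move=> /andP[h _]; apply/orP; right; rewrite expnS natrM.
      rewrite (_ : (32 * M * N)%:R = 2 * mn); last by rewrite /mn -natrM; congr (_%:R); ring.
      by rewrite mulrCA ler_wpM2l// ltW.
  rewrite -[leRHS]mulrA -[leLHS]mulrA -mulrA; rewrite ler_wpM2l// mulrA ler_wpM2r//.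
  have -> : 25 * B%:R * Num.sqrt Y = Num.sqrt ((25 * B%:R) ^+ 2 * Y).
    by rewrite sqrtrM ?sqr_ge0// sqrtr_sqr ger0_norm.
  rewrite -sqrtrM; last exact: ler0n.
  apply: ler_wsqrtr.
  set K := block_len M T; set H := block_len N T.
  have kT : T%:R * K%:R <= M%:R + T%:R :> R by rewrite -natrM -natrD ler_nat block_len_mul_le.
  have hT : T%:R * H%:R <= N%:R + T%:R :> R by rewrite -natrM -natrD ler_nat block_len_mul_le.
  have t1 : 1 <= T%:R :> R by rewrite ler1n.
  have q1 : 1 <= (Q ^ 2)%:R :> R by rewrite ler1n expn_gt0 Q0.
  (* The blocks have lengths K <= M/T + 1 and H <= N/T + 1, whence T (K +
     Q^2)(H + Q^2) <= MN + 2 Q^2 (M + N) + 4 Q^4 T. *)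
  have main : T%:R * ((K + Q ^ 2) * (H + Q ^ 2))%:R <= Y.
    have t0 : 0 < T%:R :> R by rewrite ltr0n.
    rewrite -(ler_pM2l t0).
    have -> : T%:R * (T%:R * ((K + Q ^ 2) * (H + Q ^ 2))%:R) =
      (T%:R * K%:R + T%:R * (Q ^ 2)%:R) * (T%:R * H%:R + T%:R * (Q ^ 2)%:R) :> R.
      by rewrite natrM !natrD; ring.
    apply: (@le_trans _ _ ((M%:R + 2 * (T%:R * (Q ^ 2)%:R)) * (N%:R + 2 * (T%:R * (Q ^ 2)%:R)))).
      have tq : T%:R <= T%:R * (Q ^ 2)%:R :> R by rewrite ler_peMr.
      by apply: ler_pM; rewrite ?addr_ge0 ?mulr_ge0//; lra.
    rewrite /Y /type2_factor.
    have -> : (Q ^ 4)%:R = (Q ^ 2)%:R * (Q ^ 2)%:R :> R by rewrite -natrM -expnD.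
    rewrite natrM natrD in Tle *.
    set q := (Q ^ 2)%:R in q1 *; set m := M%:R; set n := N%:R; set tt := T%:R in t1 t0 Tle *.
    have mn0 : 0 <= m * n by rewrite mulr_ge0.
    have h1 : m * n <= tt * (m * n) by rewrite ler_peMl.
    have h2 : 4 * (q * q) * tt * tt <= 4 * (q * q) * tt * (1 + 32 * theta * (m * n)).
      have q0 : 0 <= q by lra.
      apply: ler_wpM2l; last exact: Tle.
      by rewrite !mulr_ge0// ltW.
    have -> : tt * (m * n + 2 * q * (m + n) + 4 * (q * q) * (1 + 32 * theta * (m * n))) =
      tt * (m * n) + 2 * tt * q * (m + n) + 4 * (q * q) * tt * (1 + 32 * theta * (m * n)) by ring.
    have -> : (m + 2 * (tt * q)) * (n + 2 * (tt * q)) =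
      m * n + 2 * tt * q * (m + n) + 4 * (q * q) * tt * tt by ring.
    by rewrite lerD// lerD2r.
  have -> : (600 * T * B)%:R * ((K + Q ^ 2) * (H + Q ^ 2))%:R =
     600 * B%:R * (T%:R * ((K + Q ^ 2) * (H + Q ^ 2))%:R) :> R.
    by rewrite !natrM; ring.
  have c0 : 0 <= 600 * B%:R :> R by apply: mulr_ge0; exact: ler0n.
  apply: (le_trans (ler_wpM2l c0 main)); apply: ler_wpM2r; first exact: Y0.
  have bb : B%:R <= B%:R * B%:R :> R by rewrite ler_peMr.
  rewrite expr2; lra.
apply: (@le_trans _ _ (\sum_(t < 2 * B + 4) 128 * (25 * B%:R * Num.sqrt Y) * (l2 M a * l2 N b))).
  by apply: ler_sum => t _; exact: each.
rewrite sumr_const card_ord -[leLHS]mulr_natr.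
have -> : 128 * (25 * B%:R * Num.sqrt Y) * (l2 M a * l2 N b) * (2 * B + 4)%:R =
  (3200 * B%:R * (2 * B + 4)%:R) * (Num.sqrt Y * (l2 M a * l2 N b)) by ring.
rewrite -[leRHS]mulrA; apply: ler_wpM2r; first by rewrite mulr_ge0 ?sqrtr_ge0.
have bb : B%:R <= B%:R * B%:R :> R by rewrite ler_peMr.
rewrite natrD natrM expnS expn1 natrM /type2_const; lra.
Qed.

End TypeII.

(** * Separating order conditions *)

Section Cutoffs.
Context {R : realType}.
Local Notation e := (@expi2pi R).
Implicit Types (b : nat -> R[i]) (chi : nat -> R[i]) (a : nat -> nat -> R[i]).
Implicit Types (k : nat -> nat -> nat -> bool).

(** The extra variable u carries a label of m, such as its largest prime
    factor, that will be compared with a function of l. *)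
Definition kernel_sum M U N k a b chi (lam : R) : R[i] :=
  \sum_(m < M) \sum_(l < N) \sum_(u < U)
    (k m u l)%:R * (a m u * b l) * (chi (m * l)%N * e (lam * (m * l)%:R)).

(** Mixed norm, l^1 in the label u and l^2 in m. *)
Definition l12 M U a : R :=
  Num.sqrt (\sum_(m < M) (\sum_(u < U) nrm (a m u)) ^+ 2).

Lemma l12_ge0 M U a : 0 <= l12 M U a.
Proof. exact: sqrtr_ge0. Qed.

Lemma sqr_l12 M U a : l12 M U a ^+ 2 = \sum_(m < M) (\sum_(u < U) nrm (a m u)) ^+ 2.
Proof. by rewrite sqr_sqrtr// sumr_ge0// => *; exact: sqr_ge0. Qed.

Lemma sum_sqr_le I (r : seq I) (f : I -> R) : (forall i, 0 <= f i) ->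
  \sum_(i <- r) f i ^+ 2 <= (\sum_(i <- r) f i) ^+ 2.
Proof.
move=> f0; elim: r => [|i r IH]; first by rewrite !big_nil expr0n.
rewrite !big_cons sqrrD -addrA lerD2l (le_trans IH)// lerDr.
by rewrite mulrn_wge0// mulr_ge0// sumr_ge0.
Qed.

Lemma sum_indic_le1 (H w : nat) (g : nat -> nat) : injective g ->
  \sum_(h < H) (w == g h)%:R <= 1 :> R.
Proof.
move=> ginj; have [/existsP[h /eqP wh]|/existsPn nh] := boolP [exists h : 'I_H, w == g h].
  rewrite (bigD1 h)//= wh eqxx big1 ?addr0// => j jh.
  by rewrite (inj_eq ginj) eq_sym -val_eqE in jh *; rewrite (negbTE jh).
by rewrite big1// => h _; rewrite (negbTE (nh h)).
Qed.

(** x < y holds iff at the first binary place where x and y differ, x has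
    digit 0 and y has digit 1. Removing the last digits of both, either the
    truncations are still ordered (induction on the number of digits L), or
    they agree, equal to some h, and then the condition factors as [x = 2h] [y
    = 2h+1]. The pieces indexed by h have disjoint supports, so Cauchy-Schwarz
    over h loses nothing: each digit costs one application of the bound
    without the condition. *)
Lemma prim_sum_sep Q M U N k (lam : (nat -> R[i]) -> R) (kap : R) :
  0 <= kap ->
  (forall a b, prim_sum Q (fun chi => nrm (kernel_sum M U N k a b chi (lam chi))) <=
     kap * (l12 M U a * l2 N b)) ->
  forall L (F : nat -> nat -> nat) (V : nat -> nat),
  (forall m u, (m < M)%N -> (u < U)%N -> (F m u < 2 ^ L)%N) ->
  (forall l, (l < N)%N -> (V l < 2 ^ L)%N) ->
  forall a b,
  prim_sum Q (fun chi => nrm (kernel_sum M U N (fun m u l => k m u l && (F m u < V l)%N)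
     a b chi (lam chi))) <= L%:R * kap * (l12 M U a * l2 N b).
Proof.
move=> kap0 base; elim=> [|L IH] F V FL VL a b.
  rewrite mul0r mul0r; rewrite (_ : prim_sum _ _ = prim_sum Q (fun=> 0)).
    by rewrite /prim_sum; under eq_bigr do rewrite mulr0; rewrite big1_eq.
  apply: eq_prim_sum => chi; rewrite /kernel_sum big1 ?nrm0// => m _; rewrite big1// => l _.
  rewrite big1// => u _; have := FL _ _ (ltn_ord m) (ltn_ord u); have := VL _ (ltn_ord l).
  rewrite expn0 !ltnS !leqn0 => /eqP -> /eqP ->.
  by rewrite ltnn andbF !mul0r.
pose ah h m u := (F m u == h.*2)%:R * a m u.
pose bh h l := (V l == h.*2.+1)%:R * b l.
have dec x y : (x < y)%N = (x./2 < y./2)%N || [&& x./2 == y./2, ~~ odd x & odd y].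
  rewrite -{1}(odd_double_half x) -{1}(odd_double_half y).
  by case: (odd x); case: (odd y) => /=; lia.
have split_k (x y : nat) : (x < 2 ^ L.+1)%N -> (y < 2 ^ L.+1)%N ->
   (x < y)%N%:R = (x./2 < y./2)%N%:R + \sum_(h < 2 ^ L) (x == h.*2)%:R * (y == h.*2.+1)%:R :> R[i].
  move=> xL yL; have [lt|ge] := boolP (x./2 < y./2)%N.
    rewrite dec lt/= big1 ?addr0// => h _.
    case: eqP => [xh|_]; last by rewrite mul0r.
    case: eqP => [yh|_]; last by rewrite mulr0.
    by move: lt; rewrite xh yh /= uphalf_double doubleK ltnn.
  rewrite dec (negbTE ge)/= add0r.
  have xh : (x./2 < 2 ^ L)%N by rewrite -ltn_double -!muln2 -expnSr (leq_ltn_trans _ xL)// muln2 -{2}(odd_double_half x) leq_addl.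
  case: (boolP [&& _, _ & _]) => [/and3P[/eqP xy ox oy]|nxy].
    have ex : x = x./2.*2 by rewrite -{1}(odd_double_half x) (negbTE ox).
    have ey : y = x./2.*2.+1 by rewrite xy -{1}(odd_double_half y) oy.
    rewrite (bigD1 (Ordinal xh))//= -ey -ex !eqxx mulr1 big1 ?addr0// => h.
    rewrite -val_eqE/= => hx; case: eqP => [xh2|_]; last by rewrite mul0r.
    by move: hx; rewrite xh2 doubleK eqxx.
  rewrite big1// => h _; case: eqP => [xh2|_]; last by rewrite mul0r.
  case: eqP => [yh|_]; last by rewrite mulr0.
  by move: nxy; rewrite xh2 yh /= uphalf_double doubleK eqxx odd_double.
have E chi : kernel_sum M U N (fun m u l => k m u l && (F m u < V l)%N) a b chi (lam chi) =
   kernel_sum M U N (fun m u l => k m u l && ((F m u)./2 < (V l)./2)%N) a b chi (lam chi) +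
   \sum_(h < 2 ^ L) kernel_sum M U N k (ah h) (bh h) chi (lam chi).
  rewrite /kernel_sum [X in _ = _ + X]exchange_big/= -big_split/=; apply: eq_bigr => m _.
  rewrite [X in _ = _ + X]exchange_big/= -big_split/=; apply: eq_bigr => l _.
  rewrite [X in _ = _ + X]exchange_big/= -big_split/=; apply: eq_bigr => u _.
  rewrite -!mulnb !natrM split_k ?FL ?VL// mulrDr !mulrDl; congr (_ + _).
  rewrite mulr_sumr !mulr_suml; apply: eq_bigr => h _; rewrite /ah /bh; ring.
apply: (@le_trans _ _ (prim_sum Q (fun chi =>
   nrm (kernel_sum M U N (fun m u l => k m u l && ((F m u)./2 < (V l)./2)%N) a b chi (lam chi))
   + \sum_(h < 2 ^ L) nrm (kernel_sum M U N k (ah h) (bh h) chi (lam chi))))).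
  apply: prim_sum_le => q chi _ _; rewrite E; apply: (le_trans (nrmD _ _)).
  by rewrite lerD2l nrm_sum.
rewrite prim_sumD prim_sum_sum.
have half_lt x : (x < 2 ^ L.+1)%N -> (x./2 < 2 ^ L)%N.
  by move=> xL; rewrite -ltn_double -!muln2 -expnSr (leq_ltn_trans _ xL)// muln2 -{2}(odd_double_half x) leq_addl.
rewrite -natr1 mulrDl mul1r mulrDl; apply: lerD.
  by apply: IH => [m u mM uU|l lN]; apply: half_lt; [exact: FL|exact: VL].
apply: (@le_trans _ _ (\sum_(h < 2 ^ L) kap * (l12 M U (ah h) * l2 N (bh h)))).
  by apply: ler_sum => h _; exact: base.
rewrite -mulr_sumr ler_wpM2l//; apply: (le_trans (cauchy_schwarz_sqrt _ _ _)).
apply: ler_pM; rewrite ?sqrtr_ge0//; apply: ler_wsqrtr.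
  under eq_bigr do rewrite sqr_l12.
  rewrite exchange_big/=; apply: ler_sum => m _.
  apply: (@le_trans _ _ ((\sum_(h < 2 ^ L) \sum_(u < U) nrm (ah h m u)) ^+ 2)).
    by apply: sum_sqr_le => h; apply: sumr_ge0 => *; exact: nrm_ge0.
  rewrite lerXn2r ?nnegrE//; try by apply: sumr_ge0 => *; rewrite ?sumr_ge0// => *; exact: nrm_ge0.
  rewrite exchange_big/=; apply: ler_sum => u _.
  rewrite /ah; under eq_bigr do rewrite nrmM nrm_nat.
  rewrite -mulr_suml ler_piMl ?nrm_ge0//.
  by apply: (sum_indic_le1 _ _ (g := double)); exact: double_inj.
under eq_bigr do rewrite sqr_l2.
rewrite exchange_big/=; apply: ler_sum => l _.
rewrite /bh; under eq_bigr do rewrite nrmM nrm_nat exprMn -natrX.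
rewrite -mulr_suml ler_piMl ?sqr_ge0//.
apply: le_trans (sum_indic_le1 (2 ^ L) (V l) (g := fun h => h.*2.+1) _).
  by apply: ler_sum => h _; case: eqP.
by move=> x y [] /double_inj.
Qed.

Lemma kernel_sum_true Q M U N B (theta : R) (lam : (nat -> R[i]) -> R) a b :
  (0 < Q)%N -> (0 < M < 2 ^ B)%N -> (0 < N < 2 ^ B)%N -> theta <= 2^-1 ->
  (forall chi, `|lam chi| <= theta) ->
  prim_sum Q (fun chi => nrm (kernel_sum M U N (fun _ _ _ => true) a b chi (lam chi))) <=
  type2_const * (B ^ 2)%:R * Num.sqrt (type2_factor Q M N theta) * (l12 M U a * l2 N b).
Proof.
move=> Q0 MB NB th2 lamth.
have := type2_rect (fun m => \sum_(u < U) a m u) b Q0 MB NB th2 lamth.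
move=> H; apply: (@le_trans _ _ (prim_sum Q (fun chi =>
   nrm (bilin M N (fun m => \sum_(u < U) a m u) b chi (lam chi))))).
  apply: ler_of_eq; apply: eq_prim_sum => chi.
  congr nrm; apply: eq_bigr => m _; apply: eq_bigr => l _.
  by rewrite !mulr_suml; apply: eq_bigr => u _; rewrite mul1r mulrA.
apply: (le_trans H); rewrite ler_wpM2l ?mulr_ge0 ?sqrtr_ge0 ?type2_const_ge0// ler_wpM2r ?l2_ge0//.
rewrite ler_wsqrtr//; apply: ler_sum => m _.
by rewrite lerXn2r ?nnegrE ?nrm_ge0 ?nrm_sum// sumr_ge0// => *; exact: nrm_ge0.
Qed.

(** For l > 0 the condition m l <= X reads m < floor(X/l) + 1; this and u <
    v(l) + 1 are separated one after the other. *)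
Lemma type2_dyadic Q X B s U (theta : R) (lam : (nat -> R[i]) -> R) a b (v : nat -> nat) :
  (0 < Q)%N -> b 0%N = 0 -> (X < 2 ^ B)%N -> (2 ^ s <= X)%N -> (U <= 2 ^ B)%N ->
  (forall l, (v l < 2 ^ B)%N) -> theta <= 2^-1 -> (forall chi, `|lam chi| <= theta) ->
  prim_sum Q (fun chi => nrm (kernel_sum (2 ^ s.+1) U (X %/ 2 ^ s).+1
     (fun m u l => [&& (2 ^ s <= m)%N, (m * l <= X)%N & (u <= v l)%N]) a b chi (lam chi))) <=
  type2_const * (B.+1 ^ 4)%:R * Num.sqrt (type2_factor Q (2 ^ s.+1) (X %/ 2 ^ s).+1 theta) *
    (l12 (2 ^ s.+1) U a * l2 (X %/ 2 ^ s).+1 b).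
Proof.
move=> Q0 b0 XB sX UB vB th2 lamth.
have sB : (s < B)%N by rewrite -(ltn_exp2l _ _ (isT : 1 < 2)%N) (leq_ltn_trans sX).
have MB : (0 < 2 ^ s.+1 < 2 ^ B.+1)%N by rewrite expn_gt0/= ltn_exp2l// ltnS.
have Blt : (2 ^ B < 2 ^ B.+1)%N by rewrite ltn_exp2l.
have NB : (0 < (X %/ 2 ^ s).+1 < 2 ^ B.+1)%N.
  by rewrite /= (leq_ltn_trans _ Blt)// (leq_ltn_trans (leq_div _ _) XB).
set M := (2 ^ s.+1)%N in MB *; set N := (X %/ 2 ^ s).+1 in NB *.
pose kap := type2_const * (B.+1 ^ 2)%:R * Num.sqrt (type2_factor Q M N theta).
have kap0 : 0 <= kap by rewrite /kap !mulr_ge0 ?sqrtr_ge0 ?type2_const_ge0.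
have step0 a' b' := kernel_sum_true U a' b' Q0 MB NB th2 lamth.
have Bkap0 : 0 <= B.+1%:R * kap by rewrite mulr_ge0.
have FL1 m u : (m < M)%N -> (u < U)%N -> (m < 2 ^ B.+1)%N.
  by move=> mM _; rewrite (leq_trans mM)//; case/andP: MB => _ /ltnW.
have VL1 l : (l < N)%N -> ((X %/ l).+1 < 2 ^ B.+1)%N.
  by move=> _; rewrite (leq_ltn_trans _ Blt)// (leq_ltn_trans (leq_div _ _) XB).
have step1 := prim_sum_sep kap0 step0 FL1 VL1.
have FL2 m u : (m < M)%N -> (u < U)%N -> (u < 2 ^ B.+1)%N.
  by move=> _ uU; rewrite (leq_trans uU)// (leq_trans UB)// ltnW.
have VL2 l : (l < N)%N -> ((v l).+1 < 2 ^ B.+1)%N.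
  by move=> _; rewrite (leq_ltn_trans _ Blt).
pose a' m u := if (2 ^ s <= m)%N then a m u else 0.
have step2 := prim_sum_sep Bkap0 step1 FL2 VL2 a' b.
apply: (@le_trans _ _ (B.+1%:R * (B.+1%:R * kap) * (l12 M U a' * l2 N b))).
  apply: le_trans step2.
  apply: ler_of_eq; apply: eq_prim_sum => chi; congr nrm.
  apply: eq_bigr => m _; apply: eq_bigr => l _; apply: eq_bigr => u _.
  rewrite /a' !ltnS; case: (leqP (2 ^ s) m) => /= sm; last by rewrite !mul0r mulr0 mul0r.
  have [->|l0] := posnP l; first by rewrite b0 !mulr0 !mul0r.
  by rewrite leq_divRL.
have -> : B.+1%:R * (B.+1%:R * kap) = type2_const * (B.+1 ^ 4)%:R * Num.sqrt (type2_factor Q M N theta).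
  by rewrite /kap !expnS expn0 !natrM; ring.
rewrite ler_wpM2l ?mulr_ge0 ?sqrtr_ge0 ?type2_const_ge0// ler_wpM2r ?l2_ge0// ler_wsqrtr//.
apply: ler_sum => m _; rewrite lerXn2r ?nnegrE ?sumr_ge0// => [*|*|]; rewrite ?nrm_ge0//.
by apply: ler_sum => u _; rewrite /a'; case: ifP => _; rewrite ?nrm0 ?nrm_ge0.
Qed.

End Cutoffs.

(** * Type I sums *)

Section TypeI.
Context {R : realType}.
Local Notation e := (@expi2pi R).
Implicit Types (b : nat -> R[i]) (chi : nat -> R[i]) (a : nat -> nat -> R[i]).

Lemma nrm_geom_unit (beta : R) y : 0 < beta < 1 ->
  nrm (\sum_(l < y) e (beta * l%:R)) <= 2 / beta + 2 / (1 - beta).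
Proof.
move=> /andP[b0 b1]; have [b2|b2] := leP beta 2^-1.
  apply: (@le_trans _ _ (2 / beta)); last by rewrite lerDl divr_ge0// subr_ge0 ltW.
  by have := @nrm_geom_expi R beta y; rewrite (gtr0_norm b0); apply.
apply: (@le_trans _ _ (2 / (1 - beta))); last by rewrite lerDr divr_ge0// ltW.
have := @nrm_geom_expi R (beta - 1) y; rewrite distrC gtr0_norm ?subr_gt0//.
have -> : \sum_(l < y) e ((beta - 1) * l%:R) = \sum_(l < y) e (beta * l%:R).
  apply: eq_bigr => l _; rewrite -(expi_periodic _ l); congr (e _); ring.
by apply => //; rewrite ?subr_gt0//; lra.
Qed.

(** Gauss sums turn the twisted sum into geometric sums with ratios e(b/q -
    alpha). As b runs over 0 < b < q, the bound on alpha keeps b/q - alpha at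
    distance at least b/(2q) and (q - b)/(2q) from 0 and 1. *)
Lemma polya_vinogradov q chi B (alpha : R) y : (1 < q < 2 ^ B)%N ->
  primitive_char q chi -> `|alpha| * (2 * q)%:R <= 1 ->
  nrm (\sum_(l < y) chi l * e (alpha * l%:R)) <= 8 * Num.sqrt q%:R * B%:R.
Proof.
move=> /andP[q1 qB] pchi al; have q0 : (0 < q)%N by apply: ltnW.
have dchi := pchi.1.
have qR : (0 : R) < q%:R by rewrite ltr0n.
pose S := \sum_(l < y) chi l * e (alpha * l%:R); rewrite -/S.
have key : conjc S * gauss_sum q chi 1 =
   \sum_(b < q) chi b * \sum_(l < y) e ((b%:R / q%:R - alpha) * l%:R).
  rewrite conjc_sum mulr_suml; under [RHS]eq_bigr do rewrite mulr_sumr.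
  rewrite exchange_big/=; apply: eq_bigr => l _.
  rewrite conjcM mulrAC -gauss_sum_primitive// /gauss_sum mulr_suml.
  apply: eq_bigr => b _; rewrite -mulrA -expiN -expiD natrM; congr (_ * e _).
  by field; rewrite gt_eqF.
have tau : nrm (gauss_sum q chi 1) = Num.sqrt q%:R.
  by rewrite -(nrm_gauss_sum q0 pchi) sqrtr_sqr ger0_norm ?nrm_ge0.
have bnd : nrm S * Num.sqrt q%:R <= 8 * q%:R * B%:R.
  rewrite -tau -nrm_conj -nrmM key; apply: (le_trans (nrm_sum _ _ _)).
  apply: (@le_trans _ _ (\sum_(b < q) 4 * q%:R * ((b%:R)^-1 + ((q - b)%N%:R)^-1))).
    apply: ler_sum => b _; rewrite nrmM.
    have [b0|b0] := posnP b.
      rewrite b0 (dchar_eq0P dchi) ?nrm0 ?mul0r ?mulr_ge0 ?addr_ge0 ?invr_ge0//.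
      by rewrite /coprime gcd0n gtn_eqF.
    apply: (@le_trans _ _ (nrm (\sum_(l < y) e ((b%:R / q%:R - alpha) * l%:R)))).
      by rewrite ler_piMl ?nrm_ge0// (nrm_dchar_le1 _ dchi).
    have bq : (b < q)%N by [].
    have b1 : (1 : R) <= b%:R by rewrite ler1n.
    have qb : (1 : R) <= (q - b)%N%:R by rewrite ler1n subn_gt0.
    have qbE : (q - b)%N%:R = q%:R - b%:R :> R by rewrite natrB// ltnW.
    have al2 : - (b%:R / (2 * q%:R)) <= alpha <= b%:R / (2 * q%:R).
      rewrite -ler_norml ler_pdivlMr ?mulr_gt0//.
      by move: al; rewrite natrM => h; apply: (le_trans h).
    have al3 : - ((q - b)%N%:R / (2 * q%:R)) <= alpha <= (q - b)%N%:R / (2 * q%:R).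
      rewrite -ler_norml ler_pdivlMr ?mulr_gt0//.
      by move: al; rewrite natrM => h; apply: (le_trans h).
    pose beta : R := b%:R / q%:R - alpha.
    have h1 : b%:R / (2 * q%:R) <= beta.
      have -> : b%:R / (2 * q%:R) = b%:R / q%:R - b%:R / (2 * q%:R) :> R by field; rewrite gt_eqF.
      by rewrite /beta lerB//; case/andP: al2.
    have h2 : (q - b)%N%:R / (2 * q%:R) <= 1 - beta.
      have -> : (q - b)%N%:R / (2 * q%:R) = 1 - b%:R / q%:R - (q - b)%N%:R / (2 * q%:R) :> R.
        by rewrite qbE; field; rewrite gt_eqF.
      by rewrite /beta; case/andP: al3 => *; lra.
    have p1 : 0 < b%:R / (2 * q%:R) :> R.
      by apply: divr_gt0; [exact: lt_le_trans ltr01 b1|rewrite mulr_gt0].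
    have p2 : 0 < (q - b)%N%:R / (2 * q%:R) :> R.
      by apply: divr_gt0; [exact: lt_le_trans ltr01 qb|rewrite mulr_gt0].
    have be0 : 0 < beta by apply: lt_le_trans h1.
    have be1 : 0 < 1 - beta by apply: lt_le_trans h2.
    apply: (le_trans (nrm_geom_unit y _)); first by rewrite be0 -subr_gt0.
    rewrite mulrDr; apply: lerD.
      have -> : 4 * q%:R * (b%:R)^-1 = 2 / (b%:R / (2 * q%:R)) :> R.
        by field; rewrite (gt_eqF qR) (gt_eqF (lt_le_trans ltr01 b1)).
      by rewrite ler_wpM2l// lef_pV2 ?posrE.
    have -> : 4 * q%:R * ((q - b)%N%:R)^-1 = 2 / ((q - b)%N%:R / (2 * q%:R)) :> R.
      by field; rewrite (gt_eqF qR) (gt_eqF (lt_le_trans ltr01 qb)).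
    by rewrite ler_wpM2l// lef_pV2 ?posrE.
  rewrite -mulr_sumr big_split/=.
  have s1 : \sum_(b < q) (b%:R)^-1 <= B%:R :> R by apply: harm_le_log; exact: ltnW.
  (* The reflection b -> q - b. *)
  have s2 : \sum_(b < q) ((q - b)%N%:R)^-1 <= B%:R :> R.
    have := @sum_inv_subl R q.+1 ord_max; rewrite big_ord_recr/= subnn invr0 addr0.
    by move=> h; apply: (le_trans h); exact: harm_le_log.
  have -> : 8 * q%:R * B%:R = 4 * q%:R * (B%:R + B%:R) :> R by ring.
  by rewrite ler_wpM2l ?mulr_ge0// lerD.
have sq : 0 < Num.sqrt (q%:R : R) by rewrite sqrtr_gt0.
rewrite -(ler_pM2r sq); apply: (le_trans bnd).
rewrite -{1}(sqr_sqrtr (ltW qR)); apply: ler_of_eq; ring.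
Qed.

(** The trivial character mod 1 has no cancellation and is estimated apart. *)
Lemma prim_sum_split1 Q F (A A1 : R) : 0 <= A -> 0 <= A1 ->
  (forall chi, primitive_char 1 chi -> F chi <= A1) ->
  (forall q chi, (1 < q <= Q)%N -> primitive_char q chi -> F chi <= A) ->
  prim_sum Q F <= A1 + A * (Q ^ 2)%:R.
Proof.
move=> A0 A10 F1 FQ; case: Q FQ => [|Q] FQ.
  by rewrite /prim_sum /prim_list big_nil addr_ge0// mulr_ge0.
rewrite prim_sumE big_ltn//; apply: lerD.
  rewrite [(totient 1)](_ : _ = 1%N)// divr1 mul1r.
  apply: (@le_trans _ _ (\sum_(chi <- prim_chars (R := R) 1) A1)).
    by rewrite !big_seq; apply: ler_sum => chi /(prim_charsP (isT : 0 < 1)%N) /F1.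
  rewrite big_const_seq count_predT iter_addr_0 -[leLHS]mulr_natr ler_piMr//.
  by rewrite lern1 (leq_trans (size_prim_chars (R := R) (isT : 0 < 1)%N)).
apply: le_trans (prim_sum_const Q.+1 A0); rewrite prim_sumE [leRHS]big_ltn//.
apply: (@le_trans _ _ (\sum_(2 <= q < Q.+2) q%:R / (totient q)%:R *
   \sum_(chi <- prim_chars (R := R) q) A)); last first.
  by rewrite lerDr mulr_ge0// sumr_ge0.
rewrite !big_nat; apply: ler_sum => q /andP[q1 qQ].
rewrite ler_wpM2l ?divr_ge0// !big_seq; apply: ler_sum => chi.
by move=> /(prim_charsP (ltnW q1)) /(FQ q); apply; rewrite q1.
Qed.

Lemma type1_dyadic Q X B s (theta : R) (lam : (nat -> R[i]) -> R) (c : nat -> R[i]) :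
  (Q < 2 ^ B)%N -> (2 ^ s <= X)%N -> 0 <= theta ->
  theta * (2 ^ s.+1 * (2 * Q))%:R <= 1 -> (forall chi, `|lam chi| <= theta) ->
  prim_sum Q (fun chi => nrm (kernel_sum (2 ^ s.+1) 1 (X %/ 2 ^ s).+1
     (fun m u l => [&& (2 ^ s <= m)%N, (m * l <= X)%N & (u <= 0)%N])
     (fun m _ => c m) (fun l => (0 < l)%N%:R) chi (lam chi))) <=
  (\sum_(m < 2 ^ s.+1) nrm (c m)) *
    ((X %/ 2 ^ s).+1%:R + 8 * Num.sqrt Q%:R * B%:R * (Q ^ 2)%:R).
Proof.
move=> QB sX th0 thQ lamth.
set M := (2 ^ s.+1)%N; set N := (X %/ 2 ^ s).+1.
have s0 : (0 < 2 ^ s)%N by rewrite expn_gt0.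
pose kk m l : R[i] := [&& (2 ^ s <= m)%N, (m * l <= X)%N & (0 < l)%N]%:R.
have E chi (lm : R) : kernel_sum M 1 N (fun m u l => [&& (2 ^ s <= m)%N, (m * l <= X)%N & (u <= 0)%N])
     (fun m _ => c m) (fun l => (0 < l)%N%:R) chi lm =
   \sum_(m < M) c m * \sum_(l < N) kk m l * (chi (m * l)%N * e (lm * (m * l)%:R)).
  apply: eq_bigr => m _; rewrite mulr_sumr; apply: eq_bigr => l _.
  rewrite big_ord1 /kk leqnn andbT -!mulnb !natrM; ring.
have C0 : 0 <= \sum_(m < M) nrm (c m) by apply: sumr_ge0 => *; exact: nrm_ge0.
have S0 : 0 <= 8 * Num.sqrt Q%:R * B%:R :> R by rewrite !mulr_ge0 ?sqrtr_ge0.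
rewrite mulrDr mulrA; apply: prim_sum_split1; rewrite ?mulr_ge0//.
  move=> chi [dchi _]; rewrite E mulr_suml; apply: (le_trans (nrm_sum _ _ _)).
  apply: ler_sum => m _; rewrite nrmM ler_wpM2l ?nrm_ge0//.
  apply: (le_trans (nrm_sum _ _ _)).
  rewrite -[leRHS]mulr1 mulr_natl -[X in _ *+ X]card_ord -sumr_const.
  apply: ler_sum => l _; rewrite !nrmM nrm_expi mulr1 /kk nrm_nat.
  by rewrite mulr_ile1 ?nrm_ge0 ?(nrm_dchar_le1 _ dchi)// lern1 leq_b1.
move=> q chi /andP[q1 qQ] pchi; have dchi := pchi.1; have q0 := ltnW q1.
rewrite E mulr_suml; apply: (le_trans (nrm_sum _ _ _)).
apply: ler_sum => m _; rewrite nrmM ler_wpM2l ?nrm_ge0//.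
have [sm|sm] := leqP (2 ^ s) m; last first.
  by rewrite big1 ?nrm0// => l _; rewrite /kk leqNgt sm mul0r.
have m0 : (0 < m)%N by apply: leq_trans sm.
have chi0 : chi 0%N = 0 by apply: (dchar_eq0P dchi); rewrite /coprime gcd0n gtn_eqF.
have -> : \sum_(l < N) kk m l * (chi (m * l)%N * e (lam chi * (m * l)%:R)) =
   chi m * \sum_(l < (X %/ m).+1) chi l * e (lam chi * m%:R * l%:R).
  have le : ((X %/ m).+1 <= N)%N by rewrite ltnS leq_div2l.
  rewrite (big_ord_widen _ (fun l => chi l * e (lam chi * m%:R * l%:R)) le).
  rewrite mulr_sumr [RHS]big_mkcond/=; apply: eq_bigr => l _.
  rewrite /kk sm/= ltnS leq_divRL// [(l * m)%N]mulnC.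
  have [->|l0] := posnP l; first by rewrite andbF mul0r muln0 chi0 mul0r mulr0.
  rewrite andbT; case: ifP => _; rewrite ?mul0r// mul1r (dcharM dchi) mulrA.
  by rewrite natrM mulrA.
rewrite nrmM; apply: (@le_trans _ _ (1 * (8 * Num.sqrt q%:R * B%:R))); last first.
  by rewrite mul1r ler_wpM2r// ler_wpM2l// ler_wsqrtr// ler_nat.
apply: ler_pM; rewrite ?nrm_ge0 ?(nrm_dchar_le1 _ dchi)//.
apply: (polya_vinogradov _ _ pchi); first by rewrite q1 (leq_ltn_trans qQ).
apply: le_trans thQ; rewrite normrM normr_nat -mulrA -natrM.
apply: ler_pM => //; rewrite ler_nat leq_mul// ?leq_mul2l ?qQ ?orbT//.
exact: ltnW.
Qed.

End TypeI.

(** * Rough numbers and initial segments of the factorisation *)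

Section Rough.
Local Open Scope nat_scope.

Definition rough (w n : nat) : bool := all (leq w) (primes n).

Lemma roughP w n : 0 < n ->
  reflect (forall p, prime p -> p %| n -> w <= p) (rough w n).
Proof.
move=> n0; apply: (iffP allP) => H p.
  by move=> pp pn; apply: H; rewrite mem_primes pp n0.
by rewrite mem_primes => /and3P[pp _ pn]; exact: H.
Qed.

Lemma rough1 w : rough w 1.
Proof. by []. Qed.

Lemma rough_le1 n : rough 1 n.
Proof. by apply/allP => p; rewrite mem_primes => /andP[/prime_gt0]. Qed.

Lemma rough_pdiv w n : 1 < n -> rough w n = (w <= pdiv n).
Proof.
move=> n1; apply/(roughP _ (ltnW n1))/idP => [H|H p pp pn].
  by apply: H; rewrite ?pdiv_prime ?pdiv_dvd.
by apply: (leq_trans H); rewrite pdiv_min_dvd ?prime_gt1.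
Qed.

Lemma divn_gt0_dvd d n : 0 < n -> d %| n -> 0 < n %/ d.
Proof.
move=> n0 dn; rewrite divn_gt0; last exact: dvdn_gt0 dn.
exact: dvdn_leq.
Qed.

Lemma divn_dvd d n : d %| n -> n %/ d %| n.
Proof. by move=> dn; rewrite -{2}(divnK dn) dvdn_mulr. Qed.

Lemma rough_step w n : 0 < n ->
  rough w n = (rough w.+1 n) || [&& prime w, w %| n & rough w (n %/ w)].
Proof.
move=> n0; apply/idP/idP => [/roughP -/(_ n0) H|/orP[/roughP -/(_ n0) H|]].
- have [|/allPn [p]] := boolP (rough w.+1 n) => //.
  rewrite mem_primes => /and3P[pp _ pn]; rewrite -ltnNge ltnS => pw /=.
  have wp : w = p by apply/eqP; rewrite eqn_leq H.
  have nw0 : 0 < n %/ w by apply: divn_gt0_dvd => //; rewrite wp.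
  rewrite wp pp pn -wp /=; apply/roughP => // r rp rn.
  by apply: H => //; rewrite wp in rn; apply: dvdn_trans rn (divn_dvd pn).
- by apply/roughP => // p pp pn; rewrite ltnW// H.
- move=> /and3P[wp wn].
  have nw0 : 0 < n %/ w by exact: divn_gt0_dvd.
  move=> /roughP -/(_ nw0) H; apply/roughP => // p pp pn.
  have [pw|pw] := eqVneq p w; first by rewrite pw.
  apply: H => //; move: pn; rewrite -{1}(divnK wn) Euclid_dvdM// => /orP[//|].
  by rewrite dvdn_prime2// (negbTE pw).
Qed.

Lemma rough_step_disj w n : 0 < n -> rough w.+1 n -> prime w -> (w %| n) = false.
Proof.
move=> n0 /roughP -/(_ n0) H wp; apply/negP => /(H _ wp).
by rewrite ltnn.
Qed.

Lemma max_pdiv_mul d p : 0 < d -> prime p -> (forall q, prime q -> q %| d -> q <= p) ->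
  max_pdiv (d * p) = p.
Proof.
move=> d0 pp H; have p0 := prime_gt0 pp.
have dp1 : 1 < d * p by rewrite (leq_trans (prime_gt1 pp))// leq_pmull.
apply/eqP; rewrite eqn_leq; apply/andP; split; last first.
  by apply: max_pdiv_max; rewrite /pi_of /= inE/= mem_primes pp muln_gt0 d0 p0 dvdn_mull.
have := max_pdiv_dvd (d * p); rewrite Euclid_dvdM ?max_pdiv_prime// => /orP[|].
  by apply: H; exact: max_pdiv_prime.
by rewrite dvdn_prime2 ?max_pdiv_prime// => /eqP ->.
Qed.

Lemma pdiv_mul l p : 0 < l -> prime p -> rough p l -> pdiv (l * p) = p.
Proof.
move=> l0 pp /roughP -/(_ l0) H; have p0 := prime_gt0 pp.
have lp1 : 1 < l * p by rewrite (leq_trans (prime_gt1 pp))// leq_pmull.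
apply/eqP; rewrite eqn_leq; apply/andP; split.
  by rewrite pdiv_min_dvd ?prime_gt1// dvdn_mull.
have := pdiv_dvd (l * p); rewrite Euclid_dvdM ?pdiv_prime// => /orP[|].
  by apply: H; rewrite pdiv_prime.
by rewrite dvdn_prime2 ?pdiv_prime// => /eqP ->.
Qed.

Lemma le_max_pdiv n p : 0 < n -> prime p -> p %| n -> p <= max_pdiv n.
Proof. by move=> n0 pp pn; apply: max_pdiv_max; rewrite /pi_of inE/= mem_primes pp n0. Qed.

(** The products of the first few prime factors of n, taken in increasing
    order: no prime factor of m exceeds one of n/m. For m = 1 the convention
    max_pdiv 1 = 1 makes the condition hold. *)
Definition prime_prefix n m := (m %| n) && rough (max_pdiv m) (n %/ m).

(** For an initial segment m, this says that m is the first one above Z: the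
    preceding one is obtained by dropping the largest prime. *)
Definition crosses Z m := (Z < m) && (m %/ max_pdiv m <= Z).

(** Apart from n itself, the initial segments of n are those of n without its
    largest prime factor. *)
Lemma prime_prefix_step n m : 1 < n -> m != n -> prime_prefix n m = prime_prefix (n %/ max_pdiv n) m.
Proof.
move=> n1 mn; have n0 := ltnW n1; set q := max_pdiv n.
have qp : prime q by exact: max_pdiv_prime.
have qn : q %| n by exact: max_pdiv_dvd.
have nE : n %/ q * q = n by rewrite divnK.
have nq0 : 0 < n %/ q by exact: divn_gt0_dvd.
apply/andP/andP => -[mdn].
  have m0 : 0 < m by exact: dvdn_gt0 mdn.
  have nm0 : 0 < n %/ m by exact: divn_gt0_dvd.
  move=> /roughP -/(_ nm0) H.
  have qnm : q %| n %/ m.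
    have nm1 : 1 < n %/ m.
      rewrite ltn_neqAle nm0 andbT eq_sym; apply: contraNneq mn => h.
      by rewrite -(divnK mdn) h mul1n.
    have h1 : max_pdiv m <= pdiv (n %/ m).
      by apply: H; rewrite ?pdiv_prime ?pdiv_dvd.
    have : q %| n %/ m * m by rewrite divnK.
    rewrite Euclid_dvdM// => /orP[//|qm].
    have e1 : q <= max_pdiv m by apply: le_max_pdiv.
    have e2 : pdiv (n %/ m) <= q.
      apply: le_max_pdiv; rewrite ?pdiv_prime//.
      by apply: dvdn_trans (pdiv_dvd _) (divn_dvd mdn).
    have -> : q = pdiv (n %/ m) by apply/eqP; rewrite eqn_leq e2 (leq_trans e1 h1).
    exact: pdiv_dvd.
  have mq : m %| n %/ q.
    by rewrite dvdn_divRL// mulnC -(divnK mdn) dvdn_mul.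
  split=> //; have nqm0 : 0 < n %/ q %/ m by exact: divn_gt0_dvd.
  apply/roughP => // p pp pn; apply: H => //.
  apply: dvdn_trans pn _; rewrite -divnMA mulnC divnMA.
  exact: divn_dvd.
have mdn' : m %| n by apply: dvdn_trans mdn (divn_dvd qn).
have m0 : 0 < m by exact: dvdn_gt0 mdn'.
have nqm0 : 0 < n %/ q %/ m by exact: divn_gt0_dvd.
move=> /roughP -/(_ nqm0) H; split => //; apply/roughP; first exact: divn_gt0_dvd.
move=> p pp.
have -> : n %/ m = (n %/ q %/ m) * q.
  by rewrite -[in LHS]nE -{1}(divnK mdn) mulnAC mulnK.
rewrite Euclid_dvdM// => /orP[/(H _ pp)//|].
rewrite dvdn_prime2// => /eqP ->.
have [m1|m1] := leqP m 1; last first.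
  by apply: le_max_pdiv; [|exact: max_pdiv_prime|exact: dvdn_trans (max_pdiv_dvd _) mdn'].
have -> : m = 1 by apply/eqP; rewrite eqn_leq m1.
by rewrite (prime_gt0 qp).
Qed.

End Rough.

(** * Sums over divisors *)

Section Divisors.
Implicit Types (n m d p Z : nat).

Lemma big_divisors_sub (V : nmodType) n n' (P : pred nat) (F : nat -> V) :
  (0 < n)%N -> (0 < n')%N -> (forall m, (m %| n)%N && P m = (m %| n')%N) ->
  \sum_(m <- divisors n | P m) F m = \sum_(m <- divisors n') F m.
Proof.
move=> n0 n'0 H; rewrite -big_filter; apply: perm_big; apply: uniq_perm.
- by rewrite filter_uniq// divisors_uniq.
- exact: divisors_uniq.
- by move=> m; rewrite mem_filter -!dvdn_divisors// andbC H.
Qed.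

Lemma big_divisors_mul (V : nmodType) n p (F : nat -> V) :
  (0 < n)%N -> (0 < p)%N -> (p %| n)%N ->
  \sum_(m <- divisors n | (p %| m)%N) F m = \sum_(d <- divisors (n %/ p)) F (d * p)%N.
Proof.
move=> n0 p0 pn; have np0 : (0 < n %/ p)%N by exact: divn_gt0_dvd.
transitivity (\sum_(m <- [seq (d * p)%N | d <- divisors (n %/ p)]) F m); last by rewrite big_map.
rewrite -big_filter; apply: perm_big.
apply: uniq_perm.
- by rewrite filter_uniq// divisors_uniq.
- rewrite map_inj_in_uniq ?divisors_uniq// => x y _ _ /eqP.
  by rewrite eqn_pmul2r// => /eqP.
- move=> m; rewrite mem_filter -dvdn_divisors//; apply/andP/mapP.
    move=> [pm mn]; exists (m %/ p)%N; last by rewrite divnK.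
    by rewrite -dvdn_divisors// dvdn_divRL// divnK.
  move=> [d dn ->]; rewrite dvdn_mull//; split => //.
  by move: dn; rewrite -dvdn_divisors// dvdn_divRL.
Qed.

Lemma big_divisors_quot (V : nmodType) n p (F : nat -> V) :
  (0 < n)%N -> (0 < p)%N -> (p %| n)%N ->
  \sum_(d <- divisors n | (p %| n %/ d)%N) F d = \sum_(d <- divisors (n %/ p)) F d.
Proof.
move=> n0 p0 pn; apply: big_divisors_sub => // [|d]; first exact: divn_gt0_dvd.
apply/andP/idP => [[dn]|dn].
  have d0 := dvdn_gt0 n0 dn.
  by rewrite !dvdn_divRL// mulnC.
have dn' : (d %| n)%N by apply: dvdn_trans dn (divn_dvd pn).
have d0 := dvdn_gt0 n0 dn'.
by split => //; move: dn; rewrite !dvdn_divRL// mulnC.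
Qed.

(** The initial segments increase from 1 to n by one prime at a time, so
    exactly one of them is the first above Z when Z < n. *)
Lemma sum_prime_prefix_crosses Z n : (0 < Z)%N -> (0 < n)%N ->
  (\sum_(m <- divisors n) (prime_prefix n m && crosses Z m) = (Z < n))%N.
Proof.
move=> Z0; have [k] := ubnP n; elim: k n => // k IH n nk n0.
have [n1|n1] := leqP n 1.
  have -> : n = 1%N by apply/eqP; rewrite eqn_leq n1.
  by rewrite (_ : divisors 1 = [:: 1%N])// big_seq1 /crosses ltnNge Z0 andbF.
set q := max_pdiv n; have qp : prime q by exact: max_pdiv_prime.
have qn : (q %| n)%N by exact: max_pdiv_dvd.
have nq0 : (0 < n %/ q)%N by exact: divn_gt0_dvd.
have nqn : (n %/ q < n)%N by rewrite ltn_Pdiv// prime_gt1.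
rewrite (bigD1_seq n)/= ?divisors_uniq -?dvdn_divisors//.
rewrite {1}/prime_prefix dvdnn divnn n0 rough1/=.
have -> : (\sum_(m <- divisors n | m != n) (prime_prefix n m && crosses Z m) =
   \sum_(m <- divisors (n %/ q)) (prime_prefix (n %/ q) m && crosses Z m))%N.
  rewrite -(@big_divisors_sub nat n (n %/ q) (fun m => (m != n) && (m %| n %/ q)%N))//.
    rewrite [RHS]big_mkcondr/=; apply: eq_bigr => m mn.
    rewrite (prime_prefix_step n1 mn) -/q; case: ifP => // h.
    by rewrite /prime_prefix h.
  move=> m; case: (boolP (m %| n %/ q)%N) => h; last by rewrite !andbF.
  rewrite (dvdn_trans h (divn_dvd qn)) andbT/=.
  by rewrite neq_ltn (leq_ltn_trans (dvdn_leq nq0 h) nqn).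
rewrite IH//; last exact: leq_trans nqn _.
rewrite /crosses -/q; case: (leqP (n %/ q) Z) => h; rewrite ?andbT ?andbF ?addn0//=.
by rewrite (ltn_trans h).
Qed.

(** The correspondence d -> d p, with p the least prime factor of n/d.
    Roughness of n/d says p > Z >= d, so d p is an initial segment of n which
    crosses Z, with largest prime p. *)
Lemma big_smooth_rough (V : nmodType) Z n (F : nat -> V) : (0 < Z)%N -> (0 < n)%N ->
  \sum_(d <- divisors n | [&& (d <= Z)%N, rough Z.+1 (n %/ d) & d != n]) F d =
  \sum_(m <- divisors n | [&& prime_prefix n m, crosses Z m & (Z < max_pdiv m)%N])
    F (m %/ max_pdiv m)%N.
Proof.
move=> Z0 n0.
have fwd m : [&& prime_prefix n m, crosses Z m & (Z < max_pdiv m)%N] ->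
  [/\ (m %| n)%N, prime (max_pdiv m), (m %/ max_pdiv m %| n)%N,
     (n %/ (m %/ max_pdiv m) = n %/ m * max_pdiv m)%N &
     (pdiv (n %/ (m %/ max_pdiv m)) = max_pdiv m)%N].
  move=> /and3P[/andP[mn mr] /andP[Zm mZ] Zp].
  have m0 := dvdn_gt0 n0 mn; have m1 : (1 < m)%N by apply: leq_trans Zm.
  have pp : prime (max_pdiv m) by exact: max_pdiv_prime.
  have pm : (max_pdiv m %| m)%N by exact: max_pdiv_dvd.
  have dn : (m %/ max_pdiv m %| n)%N by apply: dvdn_trans (divn_dvd pm) mn.
  have d0 : (0 < m %/ max_pdiv m)%N by exact: divn_gt0_dvd.
  have E : (n %/ (m %/ max_pdiv m) = n %/ m * max_pdiv m)%N.
    have nE : n = (n %/ m * max_pdiv m * (m %/ max_pdiv m))%N.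
      by rewrite -mulnA [(max_pdiv m * _)%N]mulnC (divnK pm) (divnK mn).
    by rewrite {1}nE mulnK.
  by split => //; rewrite E pdiv_mul// divn_gt0_dvd.
rewrite -big_filter -[RHS]big_filter.
set s := [seq m <- divisors n | [&& prime_prefix n m, crosses Z m & (Z < max_pdiv m)%N]].
transitivity (\sum_(d <- [seq (m %/ max_pdiv m)%N | m <- s]) F d); last by rewrite big_map.
rewrite /s {s}.
apply: perm_big; apply: uniq_perm.
- by rewrite filter_uniq// divisors_uniq.
- rewrite map_inj_in_uniq ?filter_uniq ?divisors_uniq// => x y.
  rewrite !mem_filter => /andP[/fwd[x1 x2 x3 x4 x5] _] /andP[/fwd[y1 y2 y3 y4 y5] _] xy.
  rewrite xy y5 in x5.
  by rewrite -(divnK (max_pdiv_dvd x)) -(divnK (max_pdiv_dvd y)) xy x5.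
- move=> d; rewrite mem_filter -dvdn_divisors//; apply/andP/mapP.
  + move=> [/and3P[dZ rd dneq] dn]; have d0 := dvdn_gt0 n0 dn.
    have nd0 : (0 < n %/ d)%N by exact: divn_gt0_dvd.
    have nd1 : (1 < n %/ d)%N.
      rewrite ltn_neqAle nd0 andbT eq_sym; apply: contraNneq dneq => h.
      by rewrite -(divnK dn) h mul1n.
    pose p := pdiv (n %/ d)%N.
    have pp : prime p by exact: pdiv_prime.
    have Zp : (Z < p)%N by rewrite rough_pdiv in rd.
    have mp : max_pdiv (d * p) = p.
      apply: max_pdiv_mul => // r rp rd'.
      by rewrite (leq_trans (dvdn_leq d0 rd'))// (leq_trans dZ)// ltnW.
    have dpn : (d * p %| n)%N by rewrite -(divnK dn) mulnC dvdn_mul// pdiv_dvd.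
    exists (d * p)%N; last by rewrite mp mulnK// prime_gt0.
    rewrite mem_filter -dvdn_divisors// dpn andbT /prime_prefix dpn mp Zp andbT /crosses mp.
    rewrite mulnK ?prime_gt0// dZ andbT (leq_trans Zp) ?leq_pmull// andbT.
    have ndp0 : (0 < n %/ (d * p))%N by exact: divn_gt0_dvd.
    apply/roughP => // r rp rn; apply: pdiv_min_dvd; first exact: prime_gt1.
    apply: dvdn_trans rn _; rewrite divnMA; apply: divn_dvd; exact: pdiv_dvd.
  + move=> [m]; rewrite mem_filter => /andP[H _] ->.
    have [mn pp dn E1 E2] := fwd m H.
    move: H => /and3P[/andP[_ mr] /andP[Zm mZ] Zp].
    have m0 := dvdn_gt0 n0 mn.
    have nm0 : (0 < n %/ m)%N by exact: divn_gt0_dvd.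
    have lp1 : (1 < n %/ m * max_pdiv m)%N by rewrite (leq_trans (prime_gt1 pp))// leq_pmull.
    rewrite mZ dn; split => //; rewrite E1 rough_pdiv// pdiv_mul// Zp/=.
    apply/eqP => h; move: E1; rewrite h divnn n0 => h2.
    by rewrite -h2 in lp1.
Qed.

End Divisors.

(** * Sieve identity and decomposition of the indicator of Omega *)

Section Buchstab.
Context {R : realType}.
Implicit Types (g : nat -> R[i]) (n m d p Z : nat).

(** Coefficients after j steps of the sieve, at the levels p = Z, Z - 1, ...,
    Z - j + 1. The subtracted term is the contribution to d of the pair (d/p,
    p) in the Buchstab identity. *)
Fixpoint sieve_coef Z g (j : nat) (d : nat) {struct j} : R[i] :=
  if j is i.+1 then
    let p := (Z - i)%N in
    sieve_coef Z g i d -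
      (if [&& prime p, p %| d & d <= Z]%N then sieve_coef Z g i (d %/ p)%N else 0)
  else if (0 < d <= Z)%N then g d else 0.

(** What the step at p throws above Z: minus the coefficient of m/p reached
    just before that step, for m = p (m/p) > Z. *)
Definition cross_coef Z g (m p : nat) : R[i] :=
  if [&& prime p, p <= Z, p %| m & Z < m]%N then - sieve_coef Z g (Z - p) (m %/ p)%N
  else 0.

(** Buchstab identity, one level at a time; the two alternatives of
    [rough_step] exclude each other, so indicators subtract. *)
Lemma buchstab_step p l : (0 < l)%N ->
  (rough p.+1 l)%:R = (rough p l)%:R -
     ([&& prime p, p %| l & rough p (l %/ p)]%N)%:R :> R[i].
Proof.
move=> l0; rewrite (rough_step p l0); case: (boolP (rough p.+1 l)) => r/=; last first.
  by rewrite subrr.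
case: (boolP (prime p)) => pp/=; last by rewrite subr0.
by rewrite (rough_step_disj l0 r pp) /= subr0.
Qed.

(** At level p = Z - j each [rough p.+1] is replaced by Buchstab; the
    subtracted terms, indexed by m = d p, are kept in the main sum if m <= Z
    and moved to the last sum otherwise. *)
Lemma sieve_identity_step Z g n j : (0 < n)%N -> (j <= Z)%N ->
  \sum_(d <- divisors n | (d <= Z)%N) g d * (rough Z.+1 (n %/ d))%:R =
  \sum_(d <- divisors n) sieve_coef Z g j d * (rough (Z - j).+1 (n %/ d))%:R +
  \sum_(i < j) \sum_(m <- divisors n) cross_coef Z g m (Z - i) * (rough (Z - i) (n %/ m))%:R.
Proof.
move=> n0; elim: j => [|j IH] jZ.
  rewrite big_ord0 addr0 subn0 big_mkcond big_seq [RHS]big_seq.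
  apply: eq_bigr => d; rewrite -dvdn_divisors// => dn /=.
  by rewrite (dvdn_gt0 n0 dn)/=; case: ifP; rewrite ?mul0r.
rewrite IH; last exact: ltnW.
rewrite big_ord_recr/= [RHS]addrA [RHS]addrAC; congr (_ + _).
set p := (Z - j)%N; have pE : (Z - j.+1).+1 = p by rewrite subnSK.
have p0 : (0 < p)%N by rewrite subn_gt0.
rewrite pE.
have E d : d \in divisors n -> (rough p.+1 (n %/ d))%:R =
    (rough p (n %/ d))%:R - ([&& prime p, p %| n %/ d & rough p (n %/ d %/ p)]%N)%:R :> R[i].
  by rewrite -dvdn_divisors// => dn; apply: buchstab_step; exact: divn_gt0_dvd.
transitivity (\sum_(d <- divisors n) sieve_coef Z g j d * (rough p (n %/ d))%:R -
  \sum_(d <- divisors n) sieve_coef Z g j d *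
     ([&& prime p, p %| n %/ d & rough p (n %/ d %/ p)]%N)%:R).
  rewrite -sumrB big_seq [RHS]big_seq; apply: eq_bigr => d dn.
  by rewrite E// mulrBr.
under [X in _ = X + _]eq_bigr do rewrite /= -/p mulrBl.
rewrite sumrB -addrA; congr (_ + _).
have [pp|pp] := boolP (prime p); last first.
  rewrite big1; last by move=> d _; rewrite mulr0.
  have X0 d : cross_coef Z g d p = 0 by rewrite /cross_coef (negbTE pp).
  by rewrite !big1 ?oppr0 ?addr0// => d _; rewrite ?X0 mul0r.
have [pn|pn] := boolP (p %| n)%N; last first.
  rewrite big_seq big1; last first.
    move=> d; rewrite -dvdn_divisors// => dn.
    have -> : (p %| n %/ d)%N = false.
      by apply/negP => h; move: pn; rewrite (dvdn_trans h (divn_dvd dn)).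
    by rewrite mulr0.
  have F d : d \in divisors n -> (p %| d)%N = false.
    rewrite -dvdn_divisors// => dn; apply/negP => h; move: pn.
    by rewrite (dvdn_trans h dn).
  rewrite [X in _ = - X + _]big_seq [X in _ = - X + _]big1; last first.
    by move=> d /F ->; rewrite andbF mul0r.
  rewrite [X in _ = _ + X]big_seq [X in _ = _ + X]big1 ?addr0//; move=> d /F pd.
  by rewrite /cross_coef pd !andbF mul0r.
have -> : \sum_(d <- divisors n) sieve_coef Z g j d *
     ([&& true, p %| n %/ d & rough p (n %/ d %/ p)]%N)%:R =
   \sum_(m <- divisors n | (p %| m)%N) sieve_coef Z g j (m %/ p)%N * (rough p (n %/ m))%:R.
  rewrite big_divisors_mul// -(@big_divisors_quot _ n p)// [RHS]big_mkcond/=.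
  apply: eq_bigr => d _; case: ifP => //= h; last by rewrite mulr0.
  by rewrite mulnK// divnMA.
rewrite -sumrN -sumrN -big_split/= big_mkcond/=; apply: eq_bigr => m _.
rewrite /cross_coef pp leq_subr/= subKn; last exact: ltnW.
case: ifP => pm; last by rewrite /= !mul0r oppr0 addr0.
by case: (leqP m Z) => mZ /=; rewrite ?mul0r ?addr0 ?mulNr ?oppr0 ?add0r.
Qed.

Lemma sieve_identity Z g n : (0 < n)%N ->
  \sum_(d <- divisors n | (d <= Z)%N) g d * (rough Z.+1 (n %/ d))%:R =
  \sum_(d <- divisors n) sieve_coef Z g Z d +
  \sum_(m <- divisors n) \sum_(p < Z.+1) cross_coef Z g m p * (rough p (n %/ m))%:R.
Proof.
move=> n0; rewrite (sieve_identity_step g n0 (leqnn Z)) subnn; congr (_ + _).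
  by apply: eq_bigr => d _; rewrite rough_le1 mulr1.
rewrite [RHS]exchange_big/= big_ord_recl/= [X in _ = X + _]big1 ?add0r; last first.
  by move=> m _; rewrite /cross_coef/= mul0r.
rewrite [RHS](reindex_inj rev_ord_inj)/=; apply: eq_bigr => i _.
have -> : bump 0 (Z - i.+1) = (Z - i)%N by rewrite /bump add1n subnSK.
by [].
Qed.

Definition tau (n : nat) : nat := size (divisors n).

(** The number of w-rough divisors obeys the same recursion as the sieve
    coefficients, with a plus sign; hence it dominates them. *)
Definition rough_tau w n : nat := (\sum_(e <- divisors n) rough w e)%N.

Lemma rough_tau_le w n : (rough_tau w n <= tau n)%N.
Proof.
rewrite /rough_tau /tau -sum1_size; apply: leq_sum => e _; exact: leq_b1.
Qed.

Lemma rough_tau_step p n : (0 < n)%N -> rough_tau p n =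
  (rough_tau p.+1 n + (if prime p && (p %| n) then rough_tau p (n %/ p) else 0))%N.
Proof.
move=> n0.
have E : (rough_tau p n = rough_tau p.+1 n +
   \sum_(e <- divisors n) [&& prime p, p %| e & rough p (e %/ p)])%N.
  rewrite /rough_tau -big_split/= big_seq [RHS]big_seq; apply: eq_bigr => e.
  rewrite -dvdn_divisors// => en; have e0 := dvdn_gt0 n0 en.
  rewrite (rough_step p e0); case: (boolP (rough p.+1 e)) => r //=.
  case: (boolP (prime p)) => pp //=.
  by rewrite (rough_step_disj e0 r pp).
rewrite E; congr (_ + _)%N; case: (boolP (prime p)) => pp/=; last by rewrite big1.
have p0 := prime_gt0 pp.
case: ifP => pn; last first.
  rewrite big_seq big1// => e; rewrite -dvdn_divisors// => en.
  by case: (boolP (p %| e)%N) => // pe; rewrite (dvdn_trans pe en) in pn.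
rewrite /rough_tau.
transitivity (\sum_(e <- divisors n | (p %| e)%N) rough p (e %/ p))%N.
  by rewrite [RHS]big_mkcond/=; apply: eq_bigr => e _; case: ifP.
rewrite (@big_divisors_mul nat)//; apply: eq_bigr => d _.
by rewrite mulnK.
Qed.

Lemma rough_tau_gt0 w n : (0 < n)%N -> (0 < rough_tau w n)%N.
Proof.
move=> n0; rewrite /rough_tau (bigD1_seq 1%N)/= ?divisors_uniq//.
by rewrite -dvdn_divisors.
Qed.

Lemma sieve_coef_out Z g j d : ~~ (0 < d <= Z)%N -> sieve_coef Z g j d = 0.
Proof.
move=> h; elim: j => [|j IH] /=; first by rewrite (negbTE h).
rewrite IH; move: h; rewrite negb_and -leqNgt leqn0 => /orP[/eqP d0|dZ].
  by move: IH; rewrite d0 div0n => ->; case: ifP => _; rewrite subrr.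
by rewrite (negbTE dZ) !andbF subr0.
Qed.

Lemma sieve_coef_le Z g j d : (forall n, nrm (g n) <= 1) -> (j <= Z)%N ->
  nrm (sieve_coef Z g j d) <= (rough_tau (Z - j).+1 d)%:R.
Proof.
move=> g1; elim: j d => [|j IH] d jZ.
  rewrite /=; case: ifP => [/andP[d0 _]|_]; last by rewrite nrm0.
  by apply: (le_trans (g1 _)); rewrite ler1n rough_tau_gt0.
have [/andP[d0 dZ]|h] := boolP (0 < d <= Z)%N; last first.
  by rewrite sieve_coef_out// nrm0.
rewrite /=; set p := (Z - j)%N; have pE : (Z - j.+1).+1 = p by rewrite subnSK.
rewrite pE (rough_tau_step p d0) natrD dZ andbT; apply: (le_trans (nrmB _ _)); apply: lerD.
  exact/IH/ltnW.
case: ifP => [/andP[pp pd]|_]; last by rewrite nrm0.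
apply: (le_trans (IH _ (ltnW jZ))); rewrite ler_nat.
have := rough_tau_step p (divn_gt0_dvd d0 pd); rewrite -/p => ->.
exact: leq_addr.
Qed.

Lemma sieve_coef_le_tau Z g j d : (forall n, nrm (g n) <= 1) -> (j <= Z)%N ->
  nrm (sieve_coef Z g j d) <= (tau d)%:R.
Proof.
move=> g1 jZ; apply: (le_trans (sieve_coef_le d g1 jZ)); rewrite ler_nat.
exact: rough_tau_le.
Qed.

Lemma tau_quot d n : (0 < n)%N -> (d %| n)%N -> (tau (n %/ d) <= tau n)%N.
Proof.
move=> n0 dn; apply: uniq_leq_size; first exact: divisors_uniq.
move=> e; rewrite -!dvdn_divisors//; last exact: divn_gt0_dvd.
by move=> h; apply: dvdn_trans h (divn_dvd dn).
Qed.

Lemma sum_cross_coef_le Z g m U : (forall n, nrm (g n) <= 1) -> (0 < m)%N ->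
  \sum_(p < U) nrm (cross_coef Z g m p) <= (size (primes m) * tau m)%:R.
Proof.
move=> g1 m0.
apply: (@le_trans _ _ (\sum_(p < U) (nat_of_ord p \in primes m)%:R * (tau m)%:R)).
  apply: ler_sum => p _; rewrite /cross_coef mem_primes m0/=.
  case: ifP => [/and4P[pp pZ pm _]|_]; last by rewrite nrm0 mulr_ge0.
  rewrite pp pm mul1r nrmN; apply: (le_trans (sieve_coef_le_tau _ g1 (leq_subr _ _))).
  by rewrite ler_nat tau_quot.
rewrite -mulr_suml natrM ler_wpM2r//.
apply: (@le_trans _ _ (\sum_(p < U) \sum_(r <- primes m) (nat_of_ord p == r)%:R)).
  apply: ler_sum => p _; case: (boolP (nat_of_ord p \in primes m)) => [pm|_]; last exact: sumr_ge0.
  by rewrite (bigD1_seq _ pm (primes_uniq m))/= eqxx lerDl sumr_ge0.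
rewrite exchange_big/= -sum1_size natr_sum; apply: ler_sum => r _.
have [rU|rU] := ltnP r U.
  rewrite (bigD1 (Ordinal rU))//= eqxx big1 ?addr0// => p.
  by rewrite -val_eqE/= => /negbTE ->.
by rewrite big1// => p _; case: eqP => // h; move: (ltn_ord p); rewrite h ltnNge rU.
Qed.

Lemma size_primes_le m B : (0 < m < 2 ^ B)%N -> (size (primes m) <= B)%N.
Proof.
move=> /andP[m0 mB]; apply: ltnW; rewrite -(ltn_exp2l _ _ (isT : 1 < 2)%N).
suff : (2 ^ size (primes m) <= m)%N by move=> h; exact: leq_ltn_trans h mB.
rewrite [leqRHS]prod_prime_decomp// /primes size_map.
have <- : (\prod_(f <- prime_decomp m) 2 = 2 ^ size (prime_decomp m))%N.
  by rewrite big_const_seq count_predT iter_muln_1.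
rewrite big_seq [leqRHS]big_seq; apply: leq_prod => -[p e] /mem_prime_decomp[pp e0 _].
by apply: (leq_trans (prime_gt1 pp)) => /=; rewrite -{1}[p]expn1 leq_exp2l ?prime_gt1.
Qed.

(** A common range of summation makes additivity of Omega immediate. *)
Lemma bigomegaE n N : (n < N)%N -> bigomega n = (\sum_(0 <= p < N) logn p n)%N.
Proof.
move=> nN; have [->|n0] := posnP n.
  by rewrite /bigomega big_nil big1// => p _; rewrite logn0.
rewrite /bigomega [RHS](bigID (fun p => p \in primes n))/= [X in (_ + X)%N]big1 ?addn0; last first.
  by move=> p; rewrite -logn_gt0 -leqNgt leqn0 => /eqP.
rewrite -[RHS]big_filter; apply: perm_big; apply: uniq_perm.
- exact: primes_uniq.
- by rewrite filter_uniq// iota_uniq.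
- move=> p; rewrite mem_filter mem_index_iota; case: (boolP (p \in primes n)) => //= pn.
  by move: pn; rewrite mem_primes => /and3P[_ _ pn]; rewrite (leq_ltn_trans (dvdn_leq n0 pn)).
Qed.

Lemma bigomegaM m n : (0 < m)%N -> (0 < n)%N ->
  bigomega (m * n) = (bigomega m + bigomega n)%N.
Proof.
move=> m0 n0; rewrite !(@bigomegaE _ (m * n).+1) ?ltnS ?leq_pmull ?leq_pmulr//.
by rewrite -big_split/=; apply: eq_bigr => p _; rewrite lognM.
Qed.

Lemma bigomega1 : bigomega 1 = 0%N.
Proof. by rewrite /bigomega big_nil. Qed.

Lemma bigomega_prime p : prime p -> bigomega p = 1%N.
Proof. by move=> pp; rewrite /bigomega primes_prime// big_seq1 lognE pp dvdnn prime_gt0//= divnn prime_gt0//= logn1. Qed.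

Lemma bigomega_eq0 n : (0 < n)%N -> (bigomega n == 0%N) = (n == 1%N).
Proof.
move=> n0; apply/eqP/eqP => [|->]; last exact: bigomega1.
move=> h; apply/eqP; rewrite eqn_leq n0 andbT leqNgt; apply/negP => n1.
have := pdiv_dvd n => /dvdnP[k nE].
have k0 : (0 < k)%N by move: n0; rewrite nE muln_gt0 => /andP[].
by move: h; rewrite nE bigomegaM ?pdiv_gt0// [X in (_ + X)%N]bigomega_prime ?pdiv_prime// addn1.
Qed.

Definition seg_smooth Z j m : R[i] :=
  [&& crosses Z m, (max_pdiv m <= Z)%N & bigomega m == j]%:R.

(** Initial segments that cross Z by a prime above Z and have a prime
    cofactor. The two terms: the left-hand side of the decomposition, and the
    correction for such m counted by the sieve sum, where they appear whatever
    their cofactor is. *)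
Definition seg_prime Z k m : R[i] :=
  [&& crosses Z m, (Z < max_pdiv m)%N & (m < Z.+1 ^ 2)%N]%:R *
  ((bigomega m == k)%:R - (bigomega m == k.+1)%:R).

(** For n <= Z nothing crosses. Otherwise one initial segment m crosses Z, and
    the identity is checked for each m. If its last prime exceeds Z then the
    cofactor is 1 or a prime because n < (Z+1)^3; the sieve sum over d <= Z
    with Omega(d) = k counts the n with either cofactor by [big_smooth_rough],
    and its term d = n is compensated by the first summand. *)
Lemma omega_decomposition Z X k n : (0 < Z)%N -> (X < Z.+1 ^ 3)%N -> (0 < n <= X)%N ->
  (bigomega n == k.+1)%:R = (n <= Z)%N%:R * ((bigomega n == k.+1)%:R - (bigomega n == k)%:R) +
  \sum_(m <- divisors n) \sum_(j < k.+2) seg_smooth Z j m *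
     ((rough (max_pdiv m) (n %/ m))%:R * (bigomega (n %/ m) == k.+1 - j)%N%:R) +
  \sum_(m <- divisors n) seg_prime Z k m *
     ((rough (max_pdiv m) (n %/ m))%:R * (prime (n %/ m))%:R) +
  \sum_(d <- divisors n) sieve_coef Z (@omega_ind R k) Z d +
  \sum_(m <- divisors n) \sum_(p < Z.+1) cross_coef Z (@omega_ind R k) m p * (rough p (n %/ m))%:R :> R[i].
Proof.
move=> Z0 XZ /andP[n0 nX]; rewrite -!addrA -(sieve_identity Z (@omega_ind R k) n0).
(* The sum to be sieved, in terms of initial segments. *)
have G : \sum_(d <- divisors n | (d <= Z)%N) @omega_ind R k d * (rough Z.+1 (n %/ d))%:R =
   (n <= Z)%N%:R * (bigomega n == k)%:R +
   \sum_(m <- divisors n) ([&& prime_prefix n m, crosses Z m & (Z < max_pdiv m)%N]%:R *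
      (bigomega m == k.+1)%:R) :> R[i].
  rewrite (bigID (fun d => d == n))/=; congr (_ + _).
    rewrite -big_filter (_ : [seq _ <- _ | _] = if (n <= Z)%N then [:: n] else [::]).
      case: ifP => _; last by rewrite big_nil mul0r.
      by rewrite big_seq1 divnn n0 rough1 mulr1 mul1r.
    case: ifP => nZ.
      rewrite -(@filter_pred1_uniq _ (divisors n) n) ?divisors_uniq -?dvdn_divisors//.
      by apply: eq_filter => d /=; case: eqP => [->|_]; rewrite ?andbF ?nZ.
    rewrite (@eq_filter _ _ pred0) ?filter_pred0// => d.
    by case: eqP => [->|_]; rewrite ?andbF ?nZ.
  transitivity (\sum_(d <- divisors n | [&& (d <= Z)%N, rough Z.+1 (n %/ d) & d != n]) @omega_ind R k d).
    rewrite big_mkcond [RHS]big_mkcond/=; apply: eq_bigr => d _.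
    by case: (d <= Z)%N; case: (d != n); case: (rough _ _) => //=; rewrite ?mulr1 ?mulr0.
  rewrite big_smooth_rough// big_mkcond/= big_seq [RHS]big_seq; apply: eq_bigr => m.
  rewrite -dvdn_divisors// => mn; case: ifP => [|_]; last by rewrite mul0r.
  move=> /and3P[_ /andP[Zm _] _]; rewrite mul1r /omega_ind.
  have m0 := dvdn_gt0 n0 mn; have m1 : (1 < m)%N by apply: leq_trans Zm.
  have pm := max_pdiv_dvd m; have pp := max_pdiv_prime m1.
  have -> : bigomega m = (bigomega (m %/ max_pdiv m)).+1.
    have := bigomegaM (divn_gt0_dvd m0 pm) (prime_gt0 pp).
    by rewrite (divnK pm) (bigomega_prime pp) addn1.
  by rewrite eqSS.
rewrite {}G.
have C : (Z < n)%N%:R = \sum_(m <- divisors n) (prime_prefix n m && crosses Z m)%:R :> R[i].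
  by rewrite -(sum_prime_prefix_crosses Z0 n0) natr_sum.
transitivity ((n <= Z)%N%:R * (bigomega n == k.+1)%:R +
   \sum_(m <- divisors n) (prime_prefix n m && crosses Z m)%:R * (bigomega n == k.+1)%:R : R[i]).
  rewrite -mulr_suml -C -mulrDl; case: (leqP n Z) => _; by rewrite ?addr0 ?add0r mul1r.
suff H : \sum_(m <- divisors n) (prime_prefix n m && crosses Z m)%:R * (bigomega n == k.+1)%:R =
   \sum_(m <- divisors n) \sum_(j < k.+2) seg_smooth Z j m *
     ((rough (max_pdiv m) (n %/ m))%:R * (bigomega (n %/ m) == k.+1 - j)%N%:R) +
  \sum_(m <- divisors n) seg_prime Z k m *
     ((rough (max_pdiv m) (n %/ m))%:R * (prime (n %/ m))%:R) +
   \sum_(m <- divisors n) ([&& prime_prefix n m, crosses Z m & (Z < max_pdiv m)%N]%:R *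
      (bigomega m == k.+1)%:R) :> R[i].
  by rewrite H; ring.
rewrite -!big_split/= big_seq [RHS]big_seq; apply: eq_bigr => m.
rewrite -dvdn_divisors// => mn; have m0 := dvdn_gt0 n0 mn.
have l0 : (0 < n %/ m)%N by exact: divn_gt0_dvd.
have On : bigomega n = (bigomega m + bigomega (n %/ m))%N.
  by rewrite -bigomegaM// mulnC divnK.
rewrite /prime_prefix mn/= /seg_smooth /seg_prime.
case: (boolP (rough (max_pdiv m) (n %/ m))) => rm /=; last first.
  by rewrite !(mul0r, mulr0) big1 ?add0r// => j _; rewrite mul0r mulr0.
case: (boolP (crosses Z m)) => cm /=; last first.
  by rewrite !(mul0r, mulr0) big1 ?add0r// => j _; rewrite mul0r.
rewrite !mul1r; case: (leqP (max_pdiv m) Z) => mZ /=.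
  rewrite !mul0r !addr0.
  have [mk|mk] := leqP (bigomega m) k.+1; last first.
    rewrite big1 => [|j _].
      by rewrite On; case: eqP => // h; move: mk; rewrite -h ltnNge leq_addr.
    case: eqP => [h|_]; last by rewrite mul0r.
    by move: (ltn_ord j); rewrite -h ltnS leqNgt mk.
  have mk' : (bigomega m < k.+2)%N by [].
  rewrite (bigD1 (Ordinal mk'))//= eqxx !mul1r big1 ?addr0; last first.
    by move=> j; rewrite -val_eqE/= eq_sym => /negbTE ->; rewrite mul0r.
  by rewrite On -(eqn_add2l (bigomega m) (bigomega (n %/ m))) subnKC.
rewrite big1 ?add0r; last by move=> j _; rewrite mul0r.
have m1 : (1 < m)%N by case/andP: cm => Zm _; apply: leq_trans Zm.
have pm := max_pdiv_dvd m; have pp := max_pdiv_prime m1.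
have mp : (max_pdiv m <= m)%N by exact: dvdn_leq.
have Zm : (Z.+1 <= m)%N by exact: leq_trans mp.
have nE : (n %/ m * m = n)%N by rewrite divnK.
rewrite On; have [l1|l1] := leqP (n %/ m) 1.
  have -> : (n %/ m)%N = 1%N by apply/eqP; rewrite eqn_leq l1.
  by rewrite bigomega1 addn0 /= mulr0 add0r mul1r.
have lZ : (Z < pdiv (n %/ m))%N.
  by rewrite (leq_trans mZ)// -rough_pdiv.
(* The cofactor is below (Z+1)^2 and has no prime factor <= Z. *)
have lp : prime (n %/ m).
  apply: ltn_pdiv2_prime => //.
  have : (n %/ m < Z.+1 ^ 2)%N.
    rewrite ltnNge; apply/negP => h; move: XZ; rewrite ltnNge => /negP; apply.
    by rewrite (leq_trans _ nX)// -nE expnSr leq_mul.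
  by move=> h; apply: (leq_trans h); rewrite leq_sqr.
have mZ2 : (m < Z.+1 ^ 2)%N.
  rewrite ltnNge; apply/negP => h; move: XZ; rewrite ltnNge => /negP; apply.
  rewrite (leq_trans _ nX)// -nE expnS leq_mul// (leq_trans lZ)// dvdn_leq//.
  exact: pdiv_dvd.
rewrite lp mZ2 (bigomega_prime lp) addn1 eqSS !mul1r mulr1; ring.
Qed.

End Buchstab.

(** * Second moment of the divisor function *)

Section TauMoment.
Context {R : realType}.

Lemma count_multiples D M : (0 < D)%N ->
  (\sum_(m < M.+1) ((0 < m) && (D %| m)) = M %/ D)%N.
Proof.
move=> D0; elim: M => [|M IH]; first by rewrite big_ord1 div0n.
by rewrite big_ord_recr/= IH divnS// addnC.
Qed.

Lemma tauE M m : (0 < m < M)%N -> tau m = (\sum_(d < M) (d %| m))%N.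
Proof.
move=> /andP[m0 mM]; rewrite -(big_mkord xpredT (fun d => nat_of_bool (d %| m)%N)) /tau.
rewrite -sum1_size [RHS](_ : _ = \sum_(0 <= d < M | d %| m) 1)%N; last first.
  by rewrite [RHS]big_mkcond; apply: eq_bigr => d _; case: ifP.
rewrite -[RHS]big_filter; apply: perm_big; apply: uniq_perm.
- exact: divisors_uniq.
- by rewrite filter_uniq// iota_uniq.
- move=> d; rewrite mem_filter mem_index_iota -dvdn_divisors//=.
  case: (boolP (d %| m)%N) => //= dm.
  by rewrite (leq_ltn_trans (dvdn_leq m0 dm)).
Qed.

Lemma sum_inv_multiples g M :
  \sum_(d < M) (g %| d)%N%:R * (d%:R)^-1 <= (g%:R)^-1 * harm M :> R.
Proof.
have [->|g0] := posnP g.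
  rewrite invr0 mul0r big1// => d _; rewrite dvd0n.
  by case: eqP => [->|_]; rewrite ?invr0 ?mulr0 ?mul0r.
case: M => [|M]; first by rewrite big_ord0 mulr_ge0 ?invr_ge0 ?harm_ge0.
pose h (d : 'I_M.+1) : 'I_M.+1 := inord (d %/ g).
have hE d : val (h d) = (d %/ g)%N by rewrite /h /= inordK// (leq_ltn_trans (leq_div _ _)).
rewrite (bigID (fun d : 'I_M.+1 => g %| d)%N)/= [X in _ + X]big1 ?addr0; last first.
  by move=> d /negbTE ->; rewrite mul0r.
rewrite /harm mulr_sumr.
apply: le_trans (@ler_sum_inj R _ _ (fun d : 'I_M.+1 => g %| d)%N h (fun t : 'I_M.+1 => (g%:R)^-1 * (t%:R)^-1) _ _).
- apply: ler_sum => d gd; rewrite gd mul1r hE -invfM -natrM.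
  by rewrite mulnC divnK.
- move=> x y; rewrite !unfold_in => gx gy /(congr1 val); rewrite !hE => xy.
  by apply: val_inj; rewrite /= -(divnK gx) -(divnK gy) xy.
- by move=> u; rewrite mulr_ge0 ?invr_ge0.
Qed.

(** Expand tau(m)^2 over pairs d, e of divisors of m: there are at most M /
    lcm(d, e) values of m, and lcm(d, e) = d e / gcd(d, e). Majorising gcd(d,
    e) by the sum of all common divisors g makes the sums over d and e
    independent, each of size (harm M) / g. *)
Lemma sum_tau_sqr M : \sum_(m < M | (0 < m)%N) ((tau m)%:R : R) ^+ 2 <= M%:R * harm M ^+ 3.
Proof.
have cnt (d e : nat) : \sum_(m < M | (0 < m)%N) ((d %| m) && (e %| m))%N%:R <=
    M%:R * ((gcdn d e)%:R / (d%:R * e%:R)) :> R.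
  have [->|d0] := posnP d.
    rewrite mul0r invr0 !mulr0 big1// => m m0; rewrite dvd0n.
    by rewrite gtn_eqF.
  have [->|e0] := posnP e.
    rewrite mulr0 invr0 !mulr0 big1// => m m0; rewrite dvd0n.
    by rewrite andbC gtn_eqF.
  have L0 : (0 < lcmn d e)%N by rewrite lcmn_gt0 d0.
  have -> : (gcdn d e)%:R / (d%:R * e%:R) = ((lcmn d e)%:R)^-1 :> R.
    rewrite -natrM -muln_lcm_gcd natrM invfM mulrCA divff ?mulr1//.
    by rewrite pnatr_eq0 -lt0n gcdn_gt0 d0.
  case: M => [|M]; first by rewrite big_ord0 mul0r.
  apply: (@le_trans _ _ (M %/ lcmn d e)%N%:R).
    rewrite -(count_multiples M L0) natr_sum big_mkcond/=; apply: ler_sum => m _.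
    by rewrite dvdn_lcm; case: (0 < m)%N.
  rewrite ler_pdivlMr ?ltr0n// -natrM ler_nat.
  by rewrite (leq_trans (leq_divM _ _)).
have E : \sum_(m < M | (0 < m)%N) ((tau m)%:R : R) ^+ 2 =
   \sum_(d < M) \sum_(e < M) \sum_(m < M | (0 < m)%N) ((d %| m) && (e %| m))%N%:R.
  transitivity (\sum_(m < M | (0 < m)%N) \sum_(d < M) \sum_(e < M)
     ((d %| m) && (e %| m))%N%:R : R).
    apply: eq_bigr => m m0; rewrite (@tauE M) ?m0 ?ltn_ord// natr_sum expr2 big_distrlr/=.
    by apply: eq_bigr => d _; apply: eq_bigr => e _; rewrite -natrM mulnb.
  rewrite exchange_big/=; apply: eq_bigr => d _; exact: exchange_big.
rewrite E; apply: (@le_trans _ _ (\sum_(d < M) \sum_(e < M)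
   M%:R * \sum_(g < M) g%:R * (((g %| d)%N%:R * (d%:R)^-1) * ((g %| e)%N%:R * (e%:R)^-1)))).
  apply: ler_sum => d _; apply: ler_sum => e _; apply: (le_trans (cnt d e)).
  rewrite ler_wpM2l//.
  have pos (g : 'I_M) : 0 <= g%:R * (((g %| d)%N%:R * (d%:R)^-1) * ((g %| e)%N%:R * (e%:R)^-1)) :> R.
    by rewrite !mulr_ge0 ?invr_ge0.
  have [d0|d0] := posnP d; first by rewrite d0 mul0r invr0 mulr0 sumr_ge0.
  have gM : (gcdn d e < M)%N by rewrite (leq_ltn_trans (dvdn_leq d0 (dvdn_gcdl _ _))).
  rewrite (bigD1 (Ordinal gM))//= dvdn_gcdl dvdn_gcdr !mul1r invfM lerDl sumr_ge0//.
under eq_bigr do rewrite -mulr_sumr.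
rewrite -mulr_sumr ler_wpM2l//.
have -> : \sum_(d < M) \sum_(e < M) \sum_(g < M)
     g%:R * (((g %| d)%N%:R * (d%:R)^-1) * ((g %| e)%N%:R * (e%:R)^-1)) =
   \sum_(g < M) g%:R * (\sum_(d < M) (g %| d)%N%:R * (d%:R)^-1) ^+ 2 :> R.
  under eq_bigr do rewrite exchange_big/=.
  rewrite exchange_big/=; apply: eq_bigr => g _.
  rewrite expr2 big_distrlr/= mulr_sumr; apply: eq_bigr => d _.
  by rewrite mulr_sumr.
have h0 := @harm_ge0 R M.
rewrite exprS {1}/harm mulr_suml; apply: ler_sum => g _.
have [->|g0] := posnP g; first by rewrite invr0 !mul0r.
have gn0 : (g%:R : R) != 0 by rewrite pnatr_eq0 -lt0n.
apply: (@le_trans _ _ (g%:R * ((g%:R)^-1 * harm M) ^+ 2)).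
  rewrite ler_wpM2l// lerXn2r ?nnegrE ?mulr_ge0 ?invr_ge0 ?sum_inv_multiples//.
  by apply: sumr_ge0 => *; rewrite mulr_ge0 ?invr_ge0.
apply: ler_of_eq; by field.
Qed.

End TauMoment.

(** * Dyadic decomposition of convolutions *)

Section Pieces.
Context {R : realType}.
Local Notation e := (@expi2pi R).
Implicit Types (b : nat -> R[i]) (chi : nat -> R[i]) (a : nat -> nat -> R[i]).

Definition dyadic_kernel X s (v : nat -> nat) (m u l : nat) : bool :=
  [&& (2 ^ s <= m)%N, (m * l <= X)%N & (u <= v l)%N].

Definition dyadic_sum X U s v a b chi (lam : R) : R[i] :=
  kernel_sum (2 ^ s.+1) U (X %/ 2 ^ s).+1 (dyadic_kernel X s v) a b chi lam.

(** Sums with coefficients that are Dirichlet convolutions a * b subject to u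
    <= v(l), where u is a label attached to m and l = n/m. *)
Definition conv_sum X U v a b chi (lam : R) : R[i] :=
  \sum_(1 <= n < X.+1) (\sum_(m <- divisors n) \sum_(u < U)
     a m u * (b (n %/ m)%N * (u <= v (n %/ m))%N%:R)) * chi n * e (lam * n%:R).

Lemma sum_divisors_pairs (V : nmodType) P n (H : nat -> nat -> V) : (0 < n < P)%N ->
  \sum_(m <- divisors n) H m (n %/ m)%N =
  \sum_(m < P) \sum_(l < P) (if (m * l == n)%N then H m l else 0).
Proof.
move=> /andP[n0 nP].
transitivity (\sum_(m < P) if (m %| n)%N then H m (n %/ m)%N else 0).
  rewrite -(big_mkord xpredT (fun m => if (m %| n)%N then H m (n %/ m)%N else 0)).
  rewrite -big_mkcond -[RHS]big_filter; apply: perm_big; apply: uniq_perm.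
  - exact: divisors_uniq.
  - by rewrite filter_uniq// iota_uniq.
  - move=> d; rewrite mem_filter mem_index_iota -dvdn_divisors//=.
    case: (boolP (d %| n)%N) => //= dn.
    by rewrite (leq_ltn_trans (dvdn_leq n0 dn)).
apply: eq_bigr => m _; case: ifP => mn.
  have m0 := dvdn_gt0 n0 mn.
  have lP : (n %/ m < P)%N by rewrite (leq_ltn_trans (leq_div _ _)).
  rewrite (bigD1 (Ordinal lP))//= mulnC divnK// eqxx big1 ?addr0// => l.
  rewrite -val_eqE/= => ln; case: eqP => // h; move: ln.
  by rewrite -h mulKn// eqxx.
rewrite big1// => l _; case: eqP => // h; move: mn; rewrite -h dvdn_mulr//.
Qed.

(** Each pair m, l with m l <= X has exactly one s with 2^s <= m < 2^(s+1),
    and then l <= X / 2^s. *)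
Lemma conv_dyadic X B U v a b chi (lam : R) : (X < 2 ^ B)%N -> b 0%N = 0 ->
  conv_sum X U v a b chi lam =
  \sum_(s < B | (2 ^ s <= X)%N) dyadic_sum X U s v a b chi lam.
Proof.
move=> XB b0; set P := (2 ^ B)%N.
pose H m l : R[i] := \sum_(u < U) a m u * (b l * (u <= v l)%N%:R).
pose G n := chi n * e (lam * n%:R).
pose F m l : R[i] := if (0 < m * l <= X)%N then H m l * G (m * l)%N else 0.
transitivity (\sum_(m < P) \sum_(l < P) F m l).
  transitivity (\sum_(n < P | (0 < n <= X)%N) \sum_(m < P) \sum_(l < P)
      (if (m * l == n)%N then H m l * G n else 0)).
    rewrite /conv_sum big_geq_mkord/= (big_ord_widen_cond P (fun n => (0 < n)%N)
      (fun n => (\sum_(m <- divisors n) \sum_(u < U)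
        a m u * (b (n %/ m)%N * (u <= v (n %/ m))%N%:R)) * chi n * e (lam * n%:R)))//.
    apply: eq_big => [n|n /andP[n0 nX]]; first by rewrite ltnS.
    rewrite (sum_divisors_pairs (P := P) H); last by rewrite n0/= ltn_ord.
    rewrite -mulrA mulr_suml; apply: eq_bigr => m _.
    by rewrite mulr_suml; apply: eq_bigr => l _; case: ifP => _; rewrite ?mul0r.
  rewrite exchange_big/=; apply: eq_bigr => m _.
  rewrite exchange_big/=; apply: eq_bigr => l _; rewrite /F.
  case: ifP => [/andP[ml0 mlX]|nml].
    have mlP : (m * l < P)%N by exact: leq_ltn_trans XB.
    rewrite (bigD1 (Ordinal mlP))/= ?ml0// eqxx big1 ?addr0// => n /andP[_].
    by rewrite -val_eqE/= eq_sym => /negbTE ->.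
  rewrite big1// => n nX; case: eqP => // h.
  by move: nX; rewrite -h nml.
(* Partition of unity: m belongs to one dyadic interval. *)
have dy m : (0 < m <= X)%N ->
   \sum_(s < B | (2 ^ s <= X)%N) ((2 ^ s <= m) && (m < 2 ^ s.+1))%N%:R = 1 :> R[i].
  move=> /andP[m0 mX]; have /andP[t1 t2] := @trunc_log_bounds 2 m isT m0.
  have tB : (trunc_log 2 m < B)%N.
    by rewrite -(ltn_exp2l _ _ (isT : 1 < 2)%N) (leq_ltn_trans t1)// (leq_ltn_trans mX).
  have tX : (2 ^ trunc_log 2 m <= X)%N by exact: leq_trans mX.
  rewrite (bigD1 (Ordinal tB) tX)/= t1 t2 big1 ?addr0// => s /andP[_].
  rewrite -val_eqE/= => sn; apply/eqP; rewrite pnatr_eq0 eqb0; apply: contraNN sn.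
  by move=> h; rewrite (@trunc_log_eq 2 s m).
transitivity (\sum_(s < B | (2 ^ s <= X)%N) \sum_(m < P) \sum_(l < P)
   ((2 ^ s <= m) && (m < 2 ^ s.+1))%N%:R * F m l).
  rewrite [RHS]exchange_big/=; apply: eq_bigr => m _.
  rewrite [RHS]exchange_big/=; apply: eq_bigr => l _.
  rewrite -mulr_suml /F; case: ifP => [/andP[ml0 mlX]|_]; last by rewrite mulr0.
  rewrite dy ?mul1r//; move: ml0; rewrite muln_gt0 => /andP[m0 l0].
  by rewrite m0 (leq_trans _ mlX)// leq_pmulr.
apply: eq_bigr => s sX.
have sB : (s < B)%N by [].
have MP : (2 ^ s.+1 <= P)%N by rewrite leq_exp2l.
have NP : ((X %/ 2 ^ s).+1 <= P)%N by rewrite (leq_ltn_trans (leq_div _ _)).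
rewrite /dyadic_sum /kernel_sum (big_ord_widen _ (fun m => \sum_(l < (X %/ 2 ^ s).+1) \sum_(u < U)
    (dyadic_kernel X s v m u l)%:R * (a m u * b l) * (chi (m * l)%N * e (lam * (m * l)%:R))) MP).
rewrite [RHS]big_mkcond/=; apply: eq_bigr => m _.
case: (ltnP m (2 ^ s.+1)) => mM; last by rewrite big1// => l _; rewrite andbF mul0r.
rewrite andbT (big_ord_widen _ (fun l => \sum_(u < U)
    (dyadic_kernel X s v m u l)%:R * (a m u * b l) * (chi (m * l)%N * e (lam * (m * l)%:R))) NP).
rewrite [RHS]big_mkcond/=; apply: eq_bigr => l _; rewrite ltnS /F /dyadic_kernel.
case: (leqP (2 ^ s) m) => sm /=; last first.
  by rewrite mul0r; case: ifP => // _; rewrite big1// => u _; rewrite !mul0r.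
rewrite mul1r; have s0 : (0 < 2 ^ s)%N by rewrite expn_gt0.
have m0 : (0 < m)%N by apply: leq_trans sm.
have [l0|l0] := posnP l.
  by rewrite l0 muln0/= big1// => u _; rewrite b0 !mulr0 mul0r.
rewrite muln_gt0 m0 l0/=; case: (leqP (m * l) X) => mlX /=; last first.
  by case: ifP => // _; rewrite big1// => u _; rewrite !mul0r.
have -> : (l <= X %/ 2 ^ s)%N.
  by rewrite leq_divRL//; apply: leq_trans mlX; rewrite mulnC leq_mul2r sm orbT.
rewrite /H mulr_suml; apply: eq_bigr => u _; rewrite /G; ring.
Qed.

Lemma dyadic_sum_eq0 X U s v a b chi (lam : R) :
  (forall m u, (2 ^ s <= m < 2 ^ s.+1)%N -> a m u = 0) ->
  dyadic_sum X U s v a b chi lam = 0.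
Proof.
move=> a0; rewrite /dyadic_sum /kernel_sum big1// => m _; rewrite big1// => l _.
rewrite big1// => u _; rewrite /dyadic_kernel; case: (leqP (2 ^ s) m) => sm /=; last by rewrite !mul0r.
by rewrite a0 ?sm ?ltn_ord// mul0r mulr0 mul0r.
Qed.

Lemma sqrt4_le (x y z w : R) : 0 <= x -> 0 <= y -> 0 <= z -> 0 <= w ->
  Num.sqrt (x + y + z + w) <= Num.sqrt x + Num.sqrt y + Num.sqrt z + Num.sqrt w.
Proof.
have H (s t : R) : 0 <= s -> 0 <= t -> Num.sqrt (s + t) <= Num.sqrt s + Num.sqrt t.
  move=> s0 t0; rewrite -[leRHS]ger0_norm ?addr_ge0 ?sqrtr_ge0// -sqrtr_sqr ler_wsqrtr//.
  by rewrite sqrrD !sqr_sqrtr// -addrA [_ *+ 2 + _]addrC addrA lerDl mulrn_wge0// mulr_ge0 ?sqrtr_ge0.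
move=> x0 y0 z0 w0; apply: (le_trans (H _ _ _ w0)); first by rewrite !addr_ge0.
rewrite lerD2r; apply: (le_trans (H _ _ _ z0)); first by rewrite addr_ge0.
by rewrite lerD2r; exact: H.
Qed.

Lemma dyadic_sizes X s : (2 ^ s <= X)%N -> (2 ^ s.+1 * (X %/ 2 ^ s).+1 <= 4 * X)%N.
Proof.
move=> sX; have := leq_divM X (2 ^ s); rewrite expnS mulnS => h.
have -> : (2 * 2 ^ s * (X %/ 2 ^ s) = 2 * (X %/ 2 ^ s * 2 ^ s))%N by ring.
lia.
Qed.

Lemma sum_tau_sqr_le M B : (M <= 2 ^ B)%N ->
  \sum_(m < M | (0 < m)%N) ((tau m)%:R : R) ^+ 2 <= M%:R * B%:R ^+ 3.
Proof.
move=> MB; apply: (le_trans (sum_tau_sqr M)); rewrite ler_wpM2l//.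
by rewrite lerXn2r ?nnegrE ?harm_ge0// harm_le_log.
Qed.

Lemma l12_le M U a B (D : R) : 0 <= D -> (M <= 2 ^ B)%N ->
  (forall m, (0 < m < M)%N -> \sum_(u < U) nrm (a m u) <= D * (tau m)%:R) ->
  (forall u, a 0%N u = 0) -> l12 M U a <= D * B%:R ^+ 2 * Num.sqrt M%:R.
Proof.
move=> D0 MB aD a0.
have S0 m : 0 <= \sum_(u < U) nrm (a m u) by apply: sumr_ge0 => *; exact: nrm_ge0.
have -> : D * B%:R ^+ 2 * Num.sqrt M%:R = Num.sqrt ((D * B%:R ^+ 2) ^+ 2 * M%:R) :> R.
  by rewrite sqrtrM ?sqr_ge0// sqrtr_sqr ger0_norm// mulr_ge0// exprn_ge0.
apply: ler_wsqrtr.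
apply: (@le_trans _ _ (D ^+ 2 * \sum_(m < M | (0 < m)%N) ((tau m)%:R : R) ^+ 2)).
  rewrite mulr_sumr [leRHS]big_mkcond/=; apply: ler_sum => m _.
  case: ifPn => [m0|]; last first.
    rewrite -leqNgt leqn0 => /eqP ->; rewrite big1 ?expr0n// => u _.
    by rewrite a0 nrm0.
  rewrite -exprMn lerXn2r ?nnegrE ?mulr_ge0// aD// m0/=; exact: ltn_ord.
rewrite exprMn -[leRHS]mulrA ler_wpM2l ?sqr_ge0//.
apply: (le_trans (sum_tau_sqr_le MB)); rewrite mulrC ler_wpM2r// -exprM.
case: B MB {aD} => [|B] _; first by rewrite !expr0n.
by rewrite ler_weXn2l// ler1n.
Qed.

Lemma l2_le1 N b : (forall l, nrm (b l) <= 1) -> l2 N b <= Num.sqrt N%:R.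
Proof.
move=> b1; rewrite ler_wsqrtr// -[X in _ <= X%:R]card_ord -sumr_const.
by apply: ler_sum => l _; rewrite expr_le1 ?nrm_ge0.
Qed.

(** With M and N the lengths of the ranges, MN <= 4 X, and the coefficient
    norms are at most polylog * sqrt(M) and sqrt(N). The hypothesis on E
    isolates the only term, Q sqrt(X (M + N)), in which the position of the
    dyadic interval matters. *)
Lemma type2_piece Q X B s U (theta D E : R) (lam : (nat -> R[i]) -> R) a b v :
  (0 < Q)%N -> b 0%N = 0 -> (X < 2 ^ B)%N -> (2 ^ s <= X)%N -> (U <= 2 ^ B)%N ->
  (forall l, (v l < 2 ^ B)%N) -> theta <= 2^-1 -> (forall chi, `|lam chi| <= theta) ->
  0 <= D -> (forall m, (0 < m < 2 ^ s.+1)%N -> \sum_(u < U) nrm (a m u) <= D * (tau m)%:R) ->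
  (forall u, a 0%N u = 0) -> (forall l, nrm (b l) <= 1) ->
  Q%:R * Num.sqrt (X%:R * (2 ^ s.+1 + (X %/ 2 ^ s).+1)%:R) <= E ->
  prim_sum Q (fun chi => nrm (dyadic_sum X U s v a b chi (lam chi))) <=
  type2_const * B.+1%:R ^+ 6 * D *
   (4 * X%:R + 3 * E + 4 * (Q ^ 2)%:R * Num.sqrt X%:R +
    46 * ((Q ^ 2)%:R * X%:R * Num.sqrt theta)).
Proof.
move=> Q0 b0 XB sX UB vB th2 lamth D0 aD a0 b1 hE.
have th0 : 0 <= theta by apply: le_trans (lamth (fun=> 0)).
apply: (le_trans (type2_dyadic a Q0 b0 XB sX UB vB th2 lamth)).
set M := (2 ^ s.+1)%N; set N := (X %/ 2 ^ s).+1.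
have sB : (s < B)%N by rewrite -(ltn_exp2l _ _ (isT : 1 < 2)%N) (leq_ltn_trans sX).
have MB : (M <= 2 ^ B.+1)%N by rewrite leq_exp2l// ltnS ltnW.
have h1 := l12_le D0 MB aD a0.
have h2 := l2_le1 N b1.
have MN : (M * N)%:R <= 4 * X%:R :> R by rewrite -natrM ler_nat dyadic_sizes.
set Y := type2_factor Q M N theta.
have Y0 : 0 <= Y by rewrite /Y /type2_factor !addr_ge0 ?mulr_ge0 ?addr_ge0 ?mulr_ge0.
have main : Num.sqrt Y * (Num.sqrt M%:R * Num.sqrt N%:R) <=
   4 * X%:R + 3 * E + 4 * (Q ^ 2)%:R * Num.sqrt X%:R +
    46 * ((Q ^ 2)%:R * X%:R * Num.sqrt theta).
  rewrite -[Num.sqrt M%:R * _]sqrtrM// -natrM -sqrtrM//.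
  apply: (@le_trans _ _ (Num.sqrt ((4 * X%:R) ^+ 2 + (3 * Q%:R) ^+ 2 * (X%:R * (M + N)%:R) +
     (4 * (Q ^ 2)%:R) ^+ 2 * X%:R + (46 * ((Q ^ 2)%:R * X%:R)) ^+ 2 * theta))).
    apply: ler_wsqrtr; apply: (@le_trans _ _ (Y * (4 * X%:R))); first exact: ler_wpM2l.
    rewrite /Y /type2_factor.
    have -> : (Q ^ 4)%:R = (Q ^ 2)%:R * (Q ^ 2)%:R :> R by rewrite -natrM -expnD.
    have -> : (Q ^ 2)%:R = Q%:R * Q%:R :> R by rewrite -natrM expnS expn1.
    have t0 : (0 : R) <= (M + N)%:R by []. have q0 : (0 : R) <= Q%:R by [].
    have x0 : (0 : R) <= X%:R by [].
    move: ((M + N)%:R : R) t0 => t t0; move: ((M * N)%:R : R) MN => mn MN.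
    move: (Q%:R : R) (X%:R : R) q0 x0 MN => q x q0 x0 MN.
    have e1 : mn * (4 * x) <= (4 * x) ^+ 2 by rewrite expr2 ler_wpM2r// mulr_ge0.
    have e2 : 0 <= q * q * (x * t) by rewrite !mulr_ge0.
    have e3 : q * q * (q * q) * theta * x * mn <= q * q * (q * q) * theta * x * (4 * x).
      by rewrite ler_wpM2l// !mulr_ge0.
    have e4 : 0 <= q * q * (q * q) * theta * x * x by rewrite !mulr_ge0.
    have -> : (mn + 2 * (q * q) * t + 4 * (q * q * (q * q)) * (1 + 32 * theta * mn)) * (4 * x)
      = mn * (4 * x) + 8 * (q * q * (x * t)) + 16 * (q * q * (q * q) * x) +
        512 * (q * q * (q * q) * theta * x * mn) by ring.
    have -> : (3 * q) ^+ 2 * (x * t) = 9 * (q * q * (x * t)) by ring.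
    have -> : (4 * (q * q)) ^+ 2 * x = 16 * (q * q * (q * q) * x) by ring.
    have -> : (46 * (q * q * x)) ^+ 2 * theta = 2116 * (q * q * (q * q) * theta * x * x) by ring.
    have : 512 * (q * q * (q * q) * theta * x * (4 * x)) = 2048 * (q * q * (q * q) * theta * x * x) by ring.
    lra.
  apply: (le_trans (sqrt4_le _ _ _ _)); rewrite ?mulr_ge0 ?sqr_ge0//.
  rewrite !(sqrtrM _ (sqr_ge0 _)) !sqrtr_sqr !ger0_norm ?mulr_ge0//.
  apply: lerD; last by rewrite -[leLHS]mulrA.
  by rewrite lerD2r lerD2l -mulrA ler_wpM2l.
set W := 4 * X%:R + _ + _ + _ in main *.
have sMN0 : 0 <= Num.sqrt M%:R * Num.sqrt N%:R :> R by rewrite mulr_ge0 ?sqrtr_ge0.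
apply: (@le_trans _ _ (type2_const * (B.+1 ^ 4)%:R * Num.sqrt Y *
   (D * B.+1%:R ^+ 2 * Num.sqrt M%:R * Num.sqrt N%:R))).
  rewrite ler_wpM2l ?mulr_ge0 ?sqrtr_ge0 ?type2_const_ge0//.
  by apply: ler_pM; rewrite ?l12_ge0 ?l2_ge0.
have -> : type2_const * (B.+1 ^ 4)%:R * Num.sqrt Y *
   (D * B.+1%:R ^+ 2 * Num.sqrt M%:R * Num.sqrt N%:R) =
   type2_const * B.+1%:R ^+ 6 * D * (Num.sqrt Y * (Num.sqrt M%:R * Num.sqrt N%:R)).
  by rewrite natrX; ring.
by rewrite ler_wpM2l// !mulr_ge0 ?type2_const_ge0// exprn_ge0.
Qed.

End Pieces.

(** * Type II and type I convolutions *)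

Section Assembly.
Context {R : realType}.
Local Notation e := (@expi2pi R).
Implicit Types (b c : nat -> R[i]) (chi : nat -> R[i]) (a : nat -> nat -> R[i]).

(** The bound aimed at, with Z sqrt(X) in place of X^(5/6). *)
Definition target (Q X Z : nat) (theta : R) : R :=
  X%:R + Q%:R * Z%:R * Num.sqrt X%:R + (Q ^ 2)%:R * Num.sqrt X%:R +
  (Q ^ 2)%:R * X%:R * Num.sqrt theta.

Lemma target_ge0 Q X Z theta : 0 <= target Q X Z theta.
Proof. by rewrite /target !addr_ge0 ?mulr_ge0 ?sqrtr_ge0. Qed.

Lemma prim_sum_dyadic_le Q X B U v a b (lam : (nat -> R[i]) -> R) (T : R) :
  (X < 2 ^ B)%N -> b 0%N = 0 -> 0 <= T ->
  (forall s, (2 ^ s <= X)%N -> prim_sum Q (fun chi => nrm (dyadic_sum X U s v a b chi (lam chi))) <= T) ->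
  prim_sum Q (fun chi => nrm (conv_sum X U v a b chi (lam chi))) <=
  B.+1%:R * T.
Proof.
move=> XB b0 T0 H.
apply: (@le_trans _ _ (prim_sum Q (fun chi => \sum_(s < B | (2 ^ s <= X)%N)
   nrm (dyadic_sum X U s v a b chi (lam chi))))).
  apply: prim_sum_le => q chi _ _; rewrite (conv_dyadic U v a chi (lam chi) XB b0).
  exact: nrm_sum.
rewrite prim_sum_sum; apply: (@le_trans _ _ (\sum_(s < B) T)).
  rewrite big_mkcond/=; apply: ler_sum => s _; case: ifP => // sX; exact: H.
by rewrite sumr_const card_ord -[leLHS]mulr_natl ler_wpM2r// ler_nat.
Qed.

Lemma prim_sum_dyadic0 Q X U s v a b (lam : (nat -> R[i]) -> R) :
  (forall m u, (2 ^ s <= m < 2 ^ s.+1)%N -> a m u = 0) ->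
  prim_sum Q (fun chi => nrm (dyadic_sum X U s v a b chi (lam chi))) = 0.
Proof.
move=> a0; rewrite (_ : prim_sum _ _ = prim_sum Q (fun=> 0)).
  by rewrite /prim_sum; under eq_bigr do rewrite mulr0; rewrite big1_eq.
by apply: eq_prim_sum => chi; rewrite dyadic_sum_eq0// nrm0.
Qed.

(** Only dyadic intervals that meet (Z, (Z+1)^2) contribute. For those M and
    X/M are O(Z^2), so that Q sqrt(X (M + N)) = O(Q Z sqrt(X)). *)
Lemma type2_conv Q X Z B U (theta D : R) (lam : (nat -> R[i]) -> R) a b v :
  (0 < Q)%N -> b 0%N = 0 -> (X < 2 ^ B)%N -> (U <= 2 ^ B)%N ->
  (0 < Z)%N -> (X < Z.+1 ^ 3)%N ->
  (forall l, (v l < 2 ^ B)%N) -> theta <= 2^-1 -> (forall chi, `|lam chi| <= theta) ->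
  0 <= D -> (forall m, (0 < m <= X)%N -> \sum_(u < U) nrm (a m u) <= D * (tau m)%:R) ->
  (forall m u, ~~ (Z < m < Z.+1 ^ 2)%N -> a m u = 0) -> (forall l, nrm (b l) <= 1) ->
  prim_sum Q (fun chi => nrm (conv_sum X U v a b chi (lam chi))) <=
  60 * type2_const * B.+1%:R ^+ 7 * D * target Q X Z theta.
Proof.
move=> Q0 b0 XB UB Z0 XZ vB th2 lamth D0 aD aZ b1.
pose a' m u := if (m <= X)%N then a m u else 0.
have -> : prim_sum Q (fun chi => nrm (conv_sum X U v a b chi (lam chi))) =
  prim_sum Q (fun chi => nrm (conv_sum X U v a' b chi (lam chi))).
  apply: eq_prim_sum => chi; congr nrm; rewrite /conv_sum !big_nat; apply: eq_bigr => n /andP[n0 nX].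
  congr (_ * _ * _); rewrite big_seq [RHS]big_seq; apply: eq_bigr => m.
  rewrite -dvdn_divisors// => mn; apply: eq_bigr => u _.
  by rewrite /a' (leq_trans (dvdn_leq n0 mn)).
have T0 : 0 <= 60 * type2_const * B.+1%:R ^+ 6 * D * target Q X Z theta.
  by rewrite !mulr_ge0 ?target_ge0 ?type2_const_ge0// exprn_ge0.
have -> : 60 * type2_const * B.+1%:R ^+ 7 * D * target Q X Z theta =
   B.+1%:R * (60 * type2_const * B.+1%:R ^+ 6 * D * target Q X Z theta) by rewrite exprS; ring.
apply: prim_sum_dyadic_le => // s sX.
have a'Z m u : ~~ (Z < m < Z.+1 ^ 2)%N -> a' m u = 0.
  by move=> h; rewrite /a' aZ//; case: ifP.
have [s1|s1] := leqP (2 ^ s.+1) Z.+1.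
  rewrite prim_sum_dyadic0// => m u /andP[_ mM]; apply: a'Z.
  by rewrite negb_and -leqNgt -ltnS (leq_trans mM s1).
have [s2|s2] := leqP (Z.+1 ^ 2) (2 ^ s).
  rewrite prim_sum_dyadic0// => m u /andP[mM _]; apply: a'Z.
  by rewrite negb_and -!leqNgt (leq_trans s2 mM) orbT.
have th0 : 0 <= theta by apply: le_trans (lamth (fun=> 0)).
pose E : R := 5 * (Q%:R * Z%:R * Num.sqrt X%:R).
(* X < (Z+1)^3 and 2^(s+1) > Z + 1 give X/2^s < 2 (Z+1)^2 <= 8 Z^2. *)
have size : (2 ^ s.+1 + (X %/ 2 ^ s).+1 <= 25 * Z ^ 2)%N.
  have N8 : (X %/ 2 ^ s < 2 * Z.+1 ^ 2)%N.
    rewrite ltn_divLR ?expn_gt0//; apply: (leq_trans XZ).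
    have -> : (2 * Z.+1 ^ 2 * 2 ^ s = Z.+1 ^ 2 * 2 ^ s.+1)%N by rewrite [(2 ^ s.+1)%N]expnS; ring.
    by rewrite expnSr leq_mul2l (ltnW s1) orbT.
  have Z2 : (Z.+1 ^ 2 <= 4 * Z ^ 2)%N.
    by rewrite -[4%N]/(2 ^ 2)%N -expnMn leq_exp2r//; lia.
  have Z1 : (1 <= Z ^ 2)%N by rewrite expn_gt0 Z0.
  move: s2; rewrite [in (2 ^ s.+1)%N]expnS; move: N8 Z2 Z1.
  move: (Z.+1 ^ 2)%N (Z ^ 2)%N (2 ^ s)%N => y z t; lia.
have hE : Q%:R * Num.sqrt (X%:R * (2 ^ s.+1 + (X %/ 2 ^ s).+1)%:R) <= E.
  have -> : E = Q%:R * Num.sqrt (X%:R * (5 * Z%:R) ^+ 2).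
    by rewrite /E sqrtrM// sqrtr_sqr ger0_norm ?mulr_ge0//; ring.
  rewrite ler_wpM2l// ler_wsqrtr// ler_wpM2l//.
  by rewrite exprMn -!natrX -natrM ler_nat.
apply: le_trans (type2_piece (D := D) (E := E) Q0 b0 XB sX UB vB th2 lamth D0 _ _ b1 hE) _.
- move=> m /andP[m0 mM]; rewrite /a'; case: (leqP m X) => mX; first by apply: aD; rewrite m0.
  by rewrite big1 ?mulr_ge0// => u _; rewrite nrm0.
- by move=> u; apply: a'Z.
have -> : 60 * type2_const * B.+1%:R ^+ 6 * D * target Q X Z theta =
  type2_const * B.+1%:R ^+ 6 * D * (60 * target Q X Z theta) by ring.
apply: ler_wpM2l; first by rewrite !mulr_ge0 ?type2_const_ge0// exprn_ge0.
rewrite /E /target.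
have p1 : 0 <= X%:R :> R by [].
have p2 : 0 <= Q%:R * Z%:R * Num.sqrt X%:R :> R by rewrite !mulr_ge0 ?sqrtr_ge0.
have p3 : 0 <= (Q ^ 2)%:R * Num.sqrt X%:R :> R by rewrite !mulr_ge0 ?sqrtr_ge0.
have p4 : 0 <= (Q ^ 2)%:R * X%:R * Num.sqrt theta by rewrite !mulr_ge0 ?sqrtr_ge0.
lra.
Qed.

Lemma tau_gt0 m : (0 < m)%N -> (0 < tau m)%N.
Proof.
by move=> m0; rewrite /tau -has_predT; apply/hasP; exists 1%N; rewrite -?dvdn_divisors.
Qed.

(** Let m be of size 2^s <= Z. If X <= Q^2 2^s, or if theta 2^(s+1) 2 Q > 1,
    the term Q X 2^(-s/2) of the type II bound is at most Q^2 sqrt(X),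
    respectively O(Q^2 X sqrt(theta)). Otherwise Polya-Vinogradov applies, and
    2^s sqrt(Q) <= sqrt(X) follows from 2^s < X/Q^2 and 2^(3s) <= X. *)
Lemma type1_conv Q X Z B (theta : R) (lam : (nat -> R[i]) -> R) c :
  (0 < Q)%N -> (Q < 2 ^ B)%N -> (X < 2 ^ B)%N ->
  (0 < Z)%N -> (Z ^ 3 <= X)%N -> theta <= 2^-1 -> (forall chi, `|lam chi| <= theta) ->
  (forall m, nrm (c m) <= (tau m)%:R) ->
  (forall m, ~~ (0 < m <= Z)%N -> c m = 0) ->
  prim_sum Q (fun chi => nrm (\sum_(1 <= n < X.+1) (\sum_(m <- divisors n) c m) *
      chi n * e (lam chi * n%:R))) <=
  60 * type2_const * B.+1%:R ^+ 7 * target Q X Z theta.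
Proof.
move=> Q0 QB XB Z0 ZX th2 lamth ctau cZ.
have th0 : 0 <= theta by apply: le_trans (lamth (fun=> 0)).
pose b l : R[i] := (0 < l)%N%:R.
have b0 : b 0%N = 0 by [].
have -> : prim_sum Q (fun chi => nrm (\sum_(1 <= n < X.+1) (\sum_(m <- divisors n) c m) *
      chi n * e (lam chi * n%:R))) =
  prim_sum Q (fun chi => nrm (\sum_(1 <= n < X.+1) (\sum_(m <- divisors n) \sum_(u < 1)
      c m * (b (n %/ m)%N * (u <= 0)%N%:R)) * chi n * e (lam chi * n%:R))).
  apply: eq_prim_sum => chi; congr nrm; rewrite !big_nat; apply: eq_bigr => n /andP[n0 nX].
  congr (_ * _ * _); rewrite big_seq [RHS]big_seq; apply: eq_bigr => m.
  by rewrite -dvdn_divisors// => mn; rewrite big_ord1 /b divn_gt0_dvd// leqnn !mulr1.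
have c21 : 1 <= type2_const :> R by rewrite /type2_const; lra.
have T0 : 0 <= 60 * type2_const * B.+1%:R ^+ 6 * target Q X Z theta.
  by rewrite !mulr_ge0 ?target_ge0 ?type2_const_ge0// exprn_ge0.
have -> : 60 * type2_const * B.+1%:R ^+ 7 * target Q X Z theta =
   B.+1%:R * (60 * type2_const * B.+1%:R ^+ 6 * target Q X Z theta) by rewrite exprS; ring.
apply: (@prim_sum_dyadic_le Q X B 1 (fun=> 0%N) (fun m _ => c m) b) => // s sX.
have [s1|s1] := leqP (2 ^ s) Z; last first.
  rewrite prim_sum_dyadic0// => m u /andP[mM _]; apply: cZ.
  by rewrite negb_and -!leqNgt -ltnNge (leq_trans s1 mM) orbT.
have XR0 : 0 < X%:R :> R by rewrite ltr0n (leq_trans _ sX)// expn_gt0.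
have sp : (0 < 2 ^ s)%N by rewrite expn_gt0.
have spR : 0 < (2 ^ s)%:R :> R by rewrite ltr0n.
have p1 : 0 <= X%:R :> R by [].
have p2 : 0 <= Q%:R * Z%:R * Num.sqrt X%:R :> R by rewrite !mulr_ge0 ?sqrtr_ge0.
have p3 : 0 <= (Q ^ 2)%:R * Num.sqrt X%:R :> R by rewrite !mulr_ge0 ?sqrtr_ge0.
have p4 : 0 <= (Q ^ 2)%:R * X%:R * Num.sqrt theta by rewrite !mulr_ge0 ?sqrtr_ge0.
(* Type II estimate, for a given majorant E of the critical term. *)
have type2_case (E : R) : Q%:R * Num.sqrt (X%:R * (4 * (X%:R / (2 ^ s)%:R))) <= E ->
  E <= 4 * ((Q ^ 2)%:R * Num.sqrt X%:R + (Q ^ 2)%:R * X%:R * Num.sqrt theta) ->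
  prim_sum Q (fun chi => nrm (dyadic_sum X 1 s (fun=> 0%N) (fun m _ => c m) b chi (lam chi))) <=
    60 * type2_const * B.+1%:R ^+ 6 * target Q X Z theta.
  move=> h1 h2.
  have size : (2 ^ s.+1 + (X %/ 2 ^ s).+1)%:R <= 4 * (X%:R / (2 ^ s)%:R) :> R.
    rewrite mulrA ler_pdivlMr// -!natrM ler_nat mulnDl mulSn expnS.
    have Z2 : (2 ^ s * 2 ^ s <= X)%N.
      apply: (leq_trans (leq_mul s1 s1)); apply: leq_trans ZX.
      by rewrite expnSr -[(Z ^ 2)%N]/(Z * Z)%N leq_pmulr.
    have := leq_divM X (2 ^ s); move: (X %/ 2 ^ s)%N (2 ^ s)%N Z2 sX => y t; clear; lia.
  have hE : Q%:R * Num.sqrt (X%:R * (2 ^ s.+1 + (X %/ 2 ^ s).+1)%:R) <= E.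
    by apply: le_trans h1; rewrite ler_wpM2l// ler_wsqrtr// ler_wpM2l.
  have B1 : (1 <= 2 ^ B)%N by rewrite expn_gt0.
  have v0 (l : nat) : (0 < 2 ^ B)%N by [].
  apply: le_trans (type2_piece (D := 1) (E := E) (U := 1) (v := fun=> 0%N) (a := fun m _ => c m) Q0 b0 XB sX B1 v0 th2 lamth ler01 _ _ _ hE) _.
  - by move=> m _; rewrite big_ord1 mul1r.
  - by move=> u; apply: cZ.
  - by move=> l; rewrite /b nrm_nat lern1 leq_b1.
  have -> : 60 * type2_const * B.+1%:R ^+ 6 * target Q X Z theta =
    type2_const * B.+1%:R ^+ 6 * 1 * (60 * target Q X Z theta) by ring.
  apply: ler_wpM2l; first by rewrite !mulr_ge0 ?type2_const_ge0// exprn_ge0.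
  rewrite /target; clear -h2 p1 p2 p3 p4; lra.
have EE : Q%:R * Num.sqrt (X%:R * (4 * (X%:R / (2 ^ s)%:R))) =
   2 * (Q%:R * X%:R * Num.sqrt ((2 ^ s)%:R)^-1) :> R.
  have -> : X%:R * (4 * (X%:R / (2 ^ s)%:R)) = (2 * X%:R) ^+ 2 * ((2 ^ s)%:R)^-1 :> R.
    by rewrite exprMn; ring.
  by rewrite (sqrtrM _ (sqr_ge0 _)) sqrtr_sqr ger0_norm ?mulr_ge0//; ring.
have [c1|c1] := leqP X (Q ^ 2 * 2 ^ s).
  apply: (type2_case (2 * (Q%:R * X%:R * Num.sqrt ((2 ^ s)%:R)^-1))); first by rewrite EE.
  suff : Q%:R * X%:R * Num.sqrt ((2 ^ s)%:R)^-1 <= (Q ^ 2)%:R * Num.sqrt X%:R :> R by lra.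
  have -> : (Q ^ 2)%:R * Num.sqrt X%:R = Q%:R * X%:R * Num.sqrt ((Q%:R / X%:R) ^+ 2 * X%:R) :> R.
    rewrite (sqrtrM _ (sqr_ge0 _)) sqrtr_sqr ger0_norm ?divr_ge0// expnS expn1 natrM.
    by field; rewrite gt_eqF.
  rewrite ler_wpM2l ?mulr_ge0// ler_wsqrtr//.
  have -> : (Q%:R / X%:R) ^+ 2 * X%:R = (Q ^ 2)%:R / X%:R :> R.
    by rewrite expnS expn1 natrM; field; rewrite gt_eqF.
  rewrite ler_pdivlMr// mulrC ler_pdivrMr// -natrM ler_nat.
  exact: c1.
have [c2|c2] := leP (theta * (2 ^ s.+1 * (2 * Q))%:R) 1; last first.
  apply: (type2_case (2 * (Q%:R * X%:R * Num.sqrt ((2 ^ s)%:R)^-1))); first by rewrite EE.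
  suff : Q%:R * X%:R * Num.sqrt ((2 ^ s)%:R)^-1 <= 2 * ((Q ^ 2)%:R * X%:R * Num.sqrt theta) :> R by lra.
  have -> : 2 * ((Q ^ 2)%:R * X%:R * Num.sqrt theta) = Q%:R * X%:R * Num.sqrt ((2 * Q%:R) ^+ 2 * theta) :> R.
    rewrite (sqrtrM _ (sqr_ge0 _)) sqrtr_sqr ger0_norm ?mulr_ge0// expnS expn1 natrM; ring.
  rewrite ler_wpM2l ?mulr_ge0// ler_wsqrtr//.
  rewrite -[_^-1]mul1r ler_pdivrMr//; apply: (le_trans (ltW c2)).
  have -> : theta * (2 ^ s.+1 * (2 * Q))%:R = theta * (2 ^ s)%:R * 4 * Q%:R.
    by rewrite expnS !natrM; ring.
  have -> : (2 * Q%:R) ^+ 2 * theta * (2 ^ s)%:R = theta * (2 ^ s)%:R * 4 * Q%:R * Q%:R :> R by ring.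
  by rewrite ler_peMr ?mulr_ge0// ler1n.
apply: (le_trans (type1_dyadic c QB sX th0 c2 lamth)).
have sB : (s < B)%N by rewrite -(ltn_exp2l _ _ (isT : 1 < 2)%N) (leq_ltn_trans sX).
have MB : (2 ^ s.+1 <= 2 ^ B.+1)%N by rewrite leq_exp2l// ltnS ltnW.
have hc : \sum_(m < 2 ^ s.+1) nrm (c m) <= (2 ^ s.+1)%:R * B.+1%:R ^+ 3.
  apply: le_trans (sum_tau_sqr_le MB); rewrite [leRHS]big_mkcond/=.
  apply: ler_sum => m _; case: ifPn => [m0|m0]; last by rewrite cZ ?nrm0// (negbTE m0).
  apply: (le_trans (ctau _)); rewrite -natrX ler_nat.
  by move: (tau m) (tau_gt0 m0) => t t0; rewrite expnS expn1 leq_pmulr.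
have XsN : (2 ^ s.+1)%:R * (X %/ 2 ^ s).+1%:R <= 4 * X%:R :> R by rewrite -!natrM ler_nat dyadic_sizes.
(* Multiply 2^s Q^2 <= X and (2^s)^3 <= X. *)
have sQ : (2 ^ s)%:R * Num.sqrt Q%:R <= Num.sqrt X%:R :> R.
  have -> : (2 ^ s)%:R * Num.sqrt Q%:R = Num.sqrt ((2 ^ s)%:R ^+ 2 * Q%:R) :> R.
    by rewrite (sqrtrM _ (sqr_ge0 _)) sqrtr_sqr ger0_norm.
  apply: ler_wsqrtr; rewrite -natrX -natrM ler_nat.
  have t3 : ((2 ^ s) ^ 3 <= X)%N by apply: leq_trans ZX; rewrite leq_exp2r.
  rewrite -leq_sqr; move: c1 t3; move: (2 ^ s)%N => t c1 t3.
  have -> : ((t ^ 2 * Q) ^ 2 = Q ^ 2 * t * t ^ 3)%N by ring.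
  by rewrite [(X ^ 2)%N]expnS expn1 leq_mul// ltnW.
have B1 : 1 <= B.+1%:R :> R by rewrite ler1n.
have B0 : 0 <= B.+1%:R ^+ 3 :> R by rewrite exprn_ge0.
set y := B.+1%:R in B1 B0 hc *.
have By : B%:R <= y by rewrite ler_nat.
apply: (@le_trans _ _ ((2 ^ s.+1)%:R * y ^+ 3 * ((X %/ 2 ^ s).+1%:R + 8 * Num.sqrt Q%:R * y * (Q ^ 2)%:R))).
  apply: ler_pM.
  - by apply: sumr_ge0 => *; exact: nrm_ge0.
  - by rewrite addr_ge0// !mulr_ge0 ?sqrtr_ge0.
  - exact: hc.
  - rewrite lerD2l ler_wpM2r// ler_wpM2l// mulr_ge0 ?sqrtr_ge0//.
apply: (@le_trans _ _ (y ^+ 3 * (4 * X%:R + 16 * y * ((Q ^ 2)%:R * Num.sqrt X%:R)))).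
  have -> : (2 ^ s.+1)%:R * y ^+ 3 * ((X %/ 2 ^ s).+1%:R + 8 * Num.sqrt Q%:R * y * (Q ^ 2)%:R) =
    y ^+ 3 * ((2 ^ s.+1)%:R * (X %/ 2 ^ s).+1%:R + 16 * y * ((Q ^ 2)%:R * ((2 ^ s)%:R * Num.sqrt Q%:R))).
    by rewrite expnS [(2 * 2 ^ s)%:R]natrM; ring.
  rewrite ler_wpM2l// lerD// ler_wpM2l ?mulr_ge0 ?(le_trans ler01 B1)// ler_wpM2l//.
have y31 : 1 <= y ^+ 3 by rewrite exprn_ege1.
have y0 : 0 <= y by apply: le_trans B1.
have y21 : 1 <= y ^+ 2 by rewrite exprn_ege1.
apply: (@le_trans _ _ (y ^+ 3 * (16 * y ^+ 3 * target Q X Z theta))).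
  rewrite ler_wpM2l//.
  apply: (@le_trans _ _ (16 * y ^+ 3 * (X%:R + (Q ^ 2)%:R * Num.sqrt X%:R))).
    have a1 : X%:R <= y ^+ 3 * X%:R by rewrite ler_peMl.
    have a2 : y * ((Q ^ 2)%:R * Num.sqrt X%:R) <= y ^+ 3 * ((Q ^ 2)%:R * Num.sqrt X%:R).
      by rewrite ler_wpM2r// exprS ler_peMr.
    have a3 : 0 <= y ^+ 3 * X%:R by rewrite mulr_ge0.
    rewrite -!mulrA mulrDr; lra.
  apply: ler_wpM2l; first by rewrite mulr_ge0// exprn_ge0.
  rewrite /target; clear -p1 p2 p3 p4; lra.
have -> : y ^+ 3 * (16 * y ^+ 3 * target Q X Z theta) = 16 * (y ^+ 6 * target Q X Z theta) by ring.
have -> : 60 * type2_const * y ^+ 6 * target Q X Z theta = 60 * type2_const * (y ^+ 6 * target Q X Z theta) by ring.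
rewrite ler_wpM2r ?mulr_ge0 ?exprn_ge0 ?target_ge0//; lra.
Qed.

End Assembly.

(** * Characters twisted by the indicator of Omega *)

Section Main.
Context {R : realType}.
Local Notation e := (@expi2pi R).
Implicit Types (b c : nat -> R[i]) (chi : nat -> R[i]) (a : nat -> nat -> R[i]).

(** The cofactor l = 1 imposes no condition; it is given the largest value in
    range, so that being rough is one inequality for every l. *)
Definition least_prime B l : nat := if (1 < l < 2 ^ B)%N then pdiv l else (2 ^ B).-1.

Lemma least_prime_lt B l : (least_prime B l < 2 ^ B)%N.
Proof.
have B0 : (0 < 2 ^ B)%N by rewrite expn_gt0.
rewrite /least_prime; case: ifP => [/andP[l1 lB]|_]; last by rewrite prednK.
by rewrite (leq_ltn_trans _ lB)// dvdn_leq ?pdiv_dvd// ltnW.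
Qed.

Lemma rough_least_prime B l u : (0 < l < 2 ^ B)%N -> (u < 2 ^ B)%N ->
  rough u l = (u <= least_prime B l)%N.
Proof.
move=> /andP[l0 lB] uB; rewrite /least_prime lB andbT; case: ltnP => l1.
  exact: rough_pdiv.
have -> : l = 1%N by apply/eqP; rewrite eqn_leq l1.
by rewrite rough1 -ltnS prednK// expn_gt0.
Qed.

(** The coefficient f(m) carries its largest prime factor as label u, so that
    the roughness of the cofactor becomes u <= v(l). *)
Definition at_max_pdiv (f : nat -> R[i]) (m u : nat) : R[i] := (u == max_pdiv m)%:R * f m.

Definition pos_part (g : nat -> R[i]) (l : nat) : R[i] := (0 < l)%N%:R * g l.

Lemma sum_at_max_pdiv (f g : nat -> R[i]) B m l : (0 < m < 2 ^ B)%N -> (0 < l < 2 ^ B)%N ->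
  \sum_(u < 2 ^ B) at_max_pdiv f m u * (pos_part g l * (u <= least_prime B l)%N%:R) =
  f m * ((rough (max_pdiv m) l)%:R * g l).
Proof.
move=> /andP[m0 mB] /andP[l0 lB].
have pB : (max_pdiv m < 2 ^ B)%N.
  by rewrite (leq_ltn_trans _ mB)// dvdn_leq// max_pdiv_dvd.
rewrite (bigD1 (Ordinal pB))//= big1 ?addr0; last first.
  by move=> u; rewrite -val_eqE/= /at_max_pdiv => /negbTE ->; rewrite !mul0r.
by rewrite /at_max_pdiv eqxx /pos_part l0 !mul1r (rough_least_prime (B := B)) ?l0//; congr (_ * _); rewrite mulrC.
Qed.

Lemma nrm_at_max_pdiv_sum f U m : \sum_(u < U) nrm (at_max_pdiv f m u) <= nrm (f m).
Proof.
rewrite /at_max_pdiv; under eq_bigr do rewrite nrmM nrm_nat.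
rewrite -mulr_suml ler_piMl ?nrm_ge0//.
under eq_bigr do rewrite eq_sym.
by apply: (sum_indic_le1 U (max_pdiv m) (g := id)).
Qed.

Lemma nrm_pos_part g l : nrm (g l) <= 1 -> nrm (pos_part g l) <= 1.
Proof.
by move=> g1; rewrite /pos_part nrmM nrm_nat mulr_ile1 ?nrm_ge0// lern1 leq_b1.
Qed.

Lemma nrm_bool (x : bool) : nrm (x%:R : R[i]) <= 1.
Proof. by rewrite nrm_nat lern1 leq_b1. Qed.

Lemma crosses_le Z m : crosses Z m -> (max_pdiv m <= Z)%N -> (Z < m < Z.+1 ^ 2)%N.
Proof.
move=> /andP[-> mZ] pZ /=; rewrite -(divnK (max_pdiv_dvd m)).
by rewrite (@leq_ltn_trans (Z * Z))// ?leq_mul// expnS expn1 ltn_mul.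
Qed.

Lemma seg_smooth_out Z j m : ~~ (Z < m < Z.+1 ^ 2)%N -> seg_smooth Z j m = 0 :> R[i].
Proof.
move=> h; rewrite /seg_smooth; case: (boolP [&& _, _ & _]) => // /and3P[cm pm _].
by rewrite (crosses_le cm pm) in h.
Qed.

Lemma seg_prime_out Z k m : ~~ (Z < m < Z.+1 ^ 2)%N -> seg_prime Z k m = 0 :> R[i].
Proof.
move=> h; rewrite /seg_prime; case: (boolP [&& _, _ & _]); last by rewrite mul0r.
by move=> /and3P[/andP[Zm _] _ mZ]; rewrite Zm mZ in h.
Qed.

Lemma nrm_seg_prime Z k m : nrm (seg_prime Z k m : R[i]) <= 2.
Proof.
rewrite /seg_prime nrmM; apply: (@le_trans _ _ (1 * 2)); last by rewrite mul1r.
apply: ler_pM; rewrite ?nrm_ge0 ?nrm_bool//.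
by apply: (le_trans (nrmB _ _)); have := nrm_bool (bigomega m == k);
   have := nrm_bool (bigomega m == k.+1); lra.
Qed.

Lemma cross_coef_out Z (g : nat -> R[i]) m p : ~~ (Z < m < Z.+1 ^ 2)%N -> cross_coef Z g m p = 0.
Proof.
move=> h; rewrite /cross_coef; case: ifP => // /and4P[pp pZ pm Zm].
rewrite sieve_coef_out ?oppr0//; apply: contraNN h => /andP[m0 mZ].
rewrite Zm -(divnK pm).
by rewrite (@leq_ltn_trans (Z * Z))// ?leq_mul// expnS expn1 ltn_mul.
Qed.

(** The five parts of the decomposition: n <= Z is estimated trivially by Q^2
    Z, the segments with a smooth or prime last step and the terms leaving the
    sieve range by [type2_conv], the sieve sum by [type1_conv]. The smooth
    segments are split according to Omega(m) = j, which separates the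
    condition on Omega(n); this costs one more logarithm. *)
Lemma omega_prim_sum_le Q X B Z k (theta : R) (lam : (nat -> R[i]) -> R) :
  (0 < Q)%N -> (Q <= X)%N -> (X < 2 ^ B)%N -> (0 < Z)%N -> (Z ^ 3 <= X)%N -> (X < Z.+1 ^ 3)%N ->
  (k < B)%N -> theta <= 2^-1 -> (forall chi, `|lam chi| <= theta) ->
  prim_sum Q (fun chi => nrm (\sum_(1 <= n < X.+1)
     (bigomega n == k.+1)%:R * chi n * e (lam chi * n%:R))) <=
  400 * type2_const * B.+1%:R ^+ 8 * target Q X Z theta.
Proof.
move=> Q0 QX XB Z0 ZX XZ kB th2 lamth.
have QB : (Q < 2 ^ B)%N by exact: leq_ltn_trans XB.
pose g := @omega_ind R k.
have g1 n : nrm (g n) <= 1 by exact: nrm_bool.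
pose bj j l : R[i] := (bigomega l == k.+1 - j)%N%:R.
pose bp l : R[i] := (prime l)%:R.
pose one (l : nat) : R[i] := 1.
pose conv U a b v chi := conv_sum X U v a b chi (lam chi).
pose S1 chi := \sum_(1 <= n < X.+1)
   ((n <= Z)%N%:R * ((bigomega n == k.+1)%:R - (bigomega n == k)%:R)) * chi n * e (lam chi * n%:R).
pose SA j chi := conv (2 ^ B)%N (at_max_pdiv (seg_smooth Z j)) (pos_part (bj j)) (least_prime B) chi.
pose SP chi := conv (2 ^ B)%N (at_max_pdiv (seg_prime Z k)) (pos_part bp) (least_prime B) chi.
pose SS chi := \sum_(1 <= n < X.+1) (\sum_(m <- divisors n) sieve_coef Z g Z m) *
      chi n * e (lam chi * n%:R).
pose SC chi := conv (2 ^ B)%N (cross_coef Z g) (pos_part one) (least_prime B) chi.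
have B1 : (Z.+1 <= 2 ^ B)%N.
  rewrite (leq_ltn_trans _ XB)// (leq_trans _ ZX)//.
  by rewrite -{1}[Z]expn1 leq_pexp2l.
(* The decomposition, summed over n <= X. *)
have E chi : \sum_(1 <= n < X.+1) (bigomega n == k.+1)%:R * chi n * e (lam chi * n%:R) =
   S1 chi + \sum_(j < k.+2) SA j chi + SP chi + SS chi + SC chi.
  rewrite /S1 /SA /SP /SS /SC /conv /conv_sum [X in _ + X + _ + _ + _]exchange_big/= -!big_split/=.
  rewrite !big_nat; apply: eq_bigr => n /andP[n0 nX].
  rewrite -!mulr_suml -!mulrDl; congr (_ * _ * _).
  rewrite [LHS](@omega_decomposition R Z X k n)//; last by rewrite n0.
  have nB : (n < 2 ^ B)%N by rewrite (leq_ltn_trans _ XB).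
  have rng m : m \in divisors n -> (0 < m < 2 ^ B)%N /\ (0 < n %/ m < 2 ^ B)%N.
    rewrite -dvdn_divisors// => mn; rewrite (dvdn_gt0 n0 mn) (divn_gt0_dvd n0 mn)/=.
    by rewrite (leq_ltn_trans (dvdn_leq n0 mn) nB) (leq_ltn_trans (leq_div _ _) nB).
  congr (_ + _ + _ + _ + _).
  - rewrite [RHS]exchange_big/= big_seq [RHS]big_seq; apply: eq_bigr => m /rng[r1 r2].
    by apply: eq_bigr => j _; rewrite sum_at_max_pdiv.
  - by rewrite big_seq [RHS]big_seq; apply: eq_bigr => m /rng[r1 r2]; rewrite sum_at_max_pdiv.
  - rewrite big_seq [RHS]big_seq; apply: eq_bigr => m /rng[r1 r2].
    rewrite (big_ord_widen _ (fun p => cross_coef Z g m p * (rough p (n %/ m))%:R) B1).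
    rewrite big_mkcond/=; apply: eq_bigr => u _.
    have /andP[l0 lB] := r2.
    rewrite /pos_part l0 !mul1r (rough_least_prime (B := B))//.
    case: ifP => // uZ; rewrite /cross_coef ltnS in uZ *.
    by rewrite uZ andbF mul0r.
pose W := target Q X Z theta; have W0 : 0 <= W by exact: target_ge0.
pose y : R := B.+1%:R; have y1 : 1 <= y by rewrite ler1n.
have y0 : 0 <= y by apply: le_trans y1.
have c1 : 1 <= type2_const :> R by rewrite /type2_const; lra.
pose V : R := type2_const * y ^+ 8 * W.
have V0 : 0 <= V by rewrite /V !mulr_ge0 ?exprn_ge0 ?type2_const_ge0.
have V7 : type2_const * y ^+ 7 * W <= V.
  by rewrite /V ler_wpM2r// ler_wpM2l ?type2_const_ge0// ler_weXn2l.
have tau1 m : (0 < m)%N -> 1 <= (tau m)%:R :> R by move=> m0; rewrite ler1n tau_gt0.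
have h1 : prim_sum Q (fun chi => nrm (S1 chi)) <= V.
  apply: (@le_trans _ _ W); last first.
    rewrite /V ler_peMl//; apply: (@le_trans _ _ (1 * 1)); first by rewrite mulr1.
    by apply: ler_pM => //; rewrite exprn_ege1.
  apply: (@le_trans _ _ (prim_sum Q (fun=> Z%:R))).
    apply: prim_sum_le => q chi /andP[q0 _] [dchi _]; rewrite /S1.
    apply: (le_trans (nrm_sum _ _ _)).
    apply: (@le_trans _ _ (\sum_(1 <= n < X.+1) (n <= Z)%N%:R)).
      apply: ler_sum => n _; rewrite !nrmM nrm_expi mulr1 nrm_nat -mulrA ler_piMr//.
      rewrite mulr_ile1 ?nrm_ge0 ?(nrm_dchar_le1 _ dchi)//.
      case: eqP => [->|_]; first by rewrite gtn_eqF// subr0 nrm1.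
      by rewrite sub0r nrmN nrm_bool.
    have ZX1 : (Z <= X)%N by rewrite (leq_trans _ ZX)// -{1}[Z]expn1 leq_pexp2l.
    rewrite (big_cat_nat (n := Z.+1))//=.
    rewrite [X in _ + X]big_nat [X in _ + X]big1 ?addr0; last first.
      by move=> n /andP[nZ _]; rewrite leqNgt nZ.
    apply: (@le_trans _ _ (\sum_(1 <= n < Z.+1) 1)).
      by apply: ler_sum => n _; rewrite lern1 leq_b1.
    by rewrite sumr_const_nat subSS subn0.
  apply: (le_trans (prim_sum_const Q (ler0n _ Z))); rewrite mulrC.
  apply: (@le_trans _ _ ((Q ^ 2)%:R * Num.sqrt X%:R)).
    rewrite ler_wpM2l//; have -> : Z%:R = Num.sqrt (Z%:R ^+ 2) :> R by rewrite sqrtr_sqr ger0_norm.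
    by rewrite ler_wsqrtr// -natrX ler_nat (leq_trans _ ZX)// leq_pexp2l.
  rewrite /W /target.
  have p2 : 0 <= Q%:R * Z%:R * Num.sqrt X%:R :> R by rewrite !mulr_ge0 ?sqrtr_ge0.
  have p4 : 0 <= (Q ^ 2)%:R * X%:R * Num.sqrt theta by rewrite !mulr_ge0 ?sqrtr_ge0.
  have p1 : 0 <= X%:R :> R by [].
  clear -p1 p2 p4; lra.
have vlt l : (least_prime B l < 2 ^ B)%N by exact: least_prime_lt.
have hA j : prim_sum Q (fun chi => nrm (SA j chi)) <= 60 * (type2_const * y ^+ 7 * W).
  apply: le_trans (type2_conv (D := 1) Q0 _ XB (leqnn _) Z0 XZ vlt th2 lamth ler01 _ _ _) _.
  - by rewrite /pos_part mul0r.
  - move=> m /andP[m0 _]; apply: (le_trans (nrm_at_max_pdiv_sum _ _ _)); rewrite mul1r.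
    by apply: le_trans (tau1 m m0); exact: nrm_bool.
  - by move=> m u h; rewrite /at_max_pdiv seg_smooth_out ?mulr0.
  - by move=> l; apply: nrm_pos_part; exact: nrm_bool.
  by rewrite -/y -/W; apply: ler_of_eq; ring.
have hP : prim_sum Q (fun chi => nrm (SP chi)) <= 120 * (type2_const * y ^+ 7 * W).
  apply: le_trans (type2_conv (D := 2) Q0 _ XB (leqnn _) Z0 XZ vlt th2 lamth _ _ _ _) _.
  - by rewrite /pos_part mul0r.
  - by [].
  - move=> m /andP[m0 _]; apply: (le_trans (nrm_at_max_pdiv_sum _ _ _)).
    by apply: (le_trans (nrm_seg_prime _ _ _)); rewrite ler_peMr// tau1.
  - by move=> m u h; rewrite /at_max_pdiv seg_prime_out ?mulr0.
  - by move=> l; apply: nrm_pos_part; exact: nrm_bool.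
  by rewrite -/y -/W; apply: ler_of_eq; ring.
have hC : prim_sum Q (fun chi => nrm (SC chi)) <= 60 * V.
  apply: le_trans (type2_conv (D := y) Q0 _ XB (leqnn _) Z0 XZ vlt th2 lamth y0 _ _ _) _.
  - by rewrite /pos_part mul0r.
  - move=> m /andP[m0 mX]; apply: (le_trans (sum_cross_coef_le _ _ g1 m0)).
    rewrite natrM ler_wpM2r// ler_nat (leq_trans (size_primes_le (B := B) _))//.
    by rewrite m0 (leq_ltn_trans mX).
  - by move=> m u h; rewrite cross_coef_out.
  - by move=> l; apply: nrm_pos_part; rewrite nrm1.
  by rewrite -/y -/W /V; apply: ler_of_eq; ring.
have hS : prim_sum Q (fun chi => nrm (SS chi)) <= 60 * (type2_const * y ^+ 7 * W).
  apply: le_trans (type1_conv Q0 QB XB Z0 ZX th2 lamth _ _) _.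
  - by move=> m; exact: sieve_coef_le_tau.
  - by move=> m h; exact: sieve_coef_out.
  by rewrite -/y -/W; apply: ler_of_eq; ring.
apply: (@le_trans _ _ (prim_sum Q (fun chi => nrm (S1 chi) + \sum_(j < k.+2) nrm (SA j chi) +
   nrm (SP chi) + nrm (SS chi) + nrm (SC chi)))).
  apply: prim_sum_le => q chi _ _; rewrite E.
  apply: (le_trans (nrmD _ _)); rewrite lerD2r.
  apply: (le_trans (nrmD _ _)); rewrite lerD2r.
  apply: (le_trans (nrmD _ _)); rewrite lerD2r.
  by apply: (le_trans (nrmD _ _)); rewrite lerD2l nrm_sum.
rewrite !prim_sumD prim_sum_sum.
have hAA : \sum_(j < k.+2) prim_sum Q (fun chi => nrm (SA j chi)) <= 60 * V.
  apply: (@le_trans _ _ (\sum_(j < k.+2) 60 * (type2_const * y ^+ 7 * W))).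
    by apply: ler_sum => j _; exact: hA.
  rewrite sumr_const card_ord -[leLHS]mulr_natl.
  have -> : 60 * V = y * (60 * (type2_const * y ^+ 7 * W)) by rewrite /V exprS; ring.
  by rewrite ler_wpM2r ?mulr_ge0 ?exprn_ge0 ?type2_const_ge0// ler_nat ltnS.
have -> : 400 * type2_const * B.+1%:R ^+ 8 * target Q X Z theta = 400 * V by rewrite /V -/y -/W; ring.
clear -V0 V7 h1 hAA hP hS hC; lra.
Qed.

End Main.

(** * The bound for Xi *)

Section Final.
Context {R : realType}.
Local Notation e := (@expi2pi R).

Lemma Xi_prim_sum (f : nat -> R[i]) (x Q theta : R) :
  Xi f x Q theta = prim_sum (Num.truncn Q) (fun chi => max_twisted_sum f chi x theta).
Proof.
rewrite prim_sumE /Xi !big_nat; apply: eq_bigr => q /andP[q0 _].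
by congr (_ * _); rewrite fsbig_finite//; exact: finite_primitive_char.
Qed.

Lemma nrm_omega_ind_twist k q chi (x lam : R) : (0 < q)%N -> dirichlet_char q chi ->
  nrm (twisted_sum (@omega_ind R k) chi x lam) <=
  \sum_(1 <= n < (Num.truncn x).+1) (bigomega n == k)%:R.
Proof.
move=> q0 dchi; apply: (le_trans (nrm_sum _ _ _)); apply: ler_sum => n _.
rewrite !nrmM nrm_expi mulr1 /omega_ind nrm_nat ler_piMr//.
exact: nrm_dchar_le1 dchi q0.
Qed.

Lemma ln2_bounds : 2^-1 <= ln (2 : R) <= 1.
Proof.
apply/andP; split.
  have h : ln (2^-1) <= - 2^-1 :> R.
    have := @le_ln1Dx R (- 2^-1); rewrite (_ : 1 + - 2^-1 = 2^-1); last lra.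
    by apply; lra.
  by move: h; rewrite lnV ?posrE//; lra.
by have := @le_ln1Dx R 1; apply; lra.
Qed.

Lemma ln_ge_two_thirds (x : R) : 3 <= x -> 2 / 3 <= ln x.
Proof.
move=> x3; have x0 : 0 < x by lra.
apply: (@le_trans _ _ (ln 3)); last by rewrite ler_ln ?posrE.
have h : ln (3^-1) <= - (2 / 3) :> R.
  have := @le_ln1Dx R (- (2 / 3)); rewrite (_ : 1 + - (2 / 3) = 3^-1); last lra.
  by apply; lra.
by move: h; rewrite lnV ?posrE//; lra.
Qed.

Lemma nat_cube_root X : exists Z, (Z ^ 3 <= X < Z.+1 ^ 3)%N.
Proof.
have ex : exists Z, (X < Z.+1 ^ 3)%N.
  exists X; have : (X.+1 ^ 1 <= X.+1 ^ 3)%N by rewrite leq_pexp2l.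
  by rewrite expn1.
have := ex_minnP ex; case=> Z h1 h2; exists Z; rewrite h1 andbT.
case: Z h1 h2 => [|Z] _ h2; first by rewrite exp0n.
by rewrite leqNgt; apply/negP => /h2; rewrite ltnn.
Qed.

End Final.

Theorem proposition4 (R : realType) :
  exists C A : R, forall (x Q theta : R) (k : nat),
    3 <= x -> 2 <= Q -> Q <= x -> 0 <= theta -> k%:R <= ln x ->
    Xi (@omega_ind R k) x Q theta <=
      C * (x `^ (1 / 2) * Q ^+ 2 + x `^ (5 / 6) * Q + x
           + x * Q ^+ 2 * theta `^ (1 / 2)) * (ln x) `^ A.
Proof.
(* 5 ln x bounds B + 1, where B is the number of binary digits of floor x. *)
exists (400 * type2_const * 5 ^+ 8), 8%:R => x Q theta k x3 Q2 Qx th0 kx.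
have lnx := ln_ge_two_thirds x3; have ln0 : 0 <= ln x by lra.
have x0 : 0 <= x by lra. have Q0 : 0 <= Q by lra.
set W := x `^ (1 / 2) * Q ^+ 2 + _ + _ + _.
pose y := 5 * ln x; have y1 : 1 <= y by rewrite /y; lra.
have -> : 400 * type2_const * 5 ^+ 8 * W * ln x `^ 8%:R = 400 * type2_const * y ^+ 8 * W.
  by rewrite powR_mulrn// /y exprMn; ring.
have c1 : 1 <= type2_const :> R by rewrite /type2_const; lra.
have y8 : 1 <= y ^+ 8 by rewrite exprn_ege1.
have cy : 400 <= 400 * type2_const * y ^+ 8 :> R.
  have : 1 * 1 <= type2_const * y ^+ 8 by apply: ler_pM.
  by rewrite -mulrA; lra.
pose X := Num.truncn x; pose q := Num.truncn Q.
have /andP[Xx xX] : X%:R <= x < X.+1%:R by exact: truncn_itv.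
have /andP[qQ Qq] : q%:R <= Q < q.+1%:R by exact: truncn_itv.
have X1 : (0 < X)%N by rewrite -ltnS -(ltr_nat R); apply: le_lt_trans xX; lra.
have q0 : (0 < q)%N by rewrite -ltnS -(ltr_nat R); apply: le_lt_trans Qq; lra.
have qX : (q <= X)%N by rewrite -ltnS -(ltr_nat R); lra.
have sX : Num.sqrt X%:R <= x `^ (1 / 2).
  by rewrite mul1r powR12_sqrt// ler_wsqrtr.
have sth : Num.sqrt theta = theta `^ (1 / 2) by rewrite mul1r powR12_sqrt.
have q2 : (q ^ 2)%:R <= Q ^+ 2 by rewrite natrX lerXn2r ?nnegrE.
have t1 : (q ^ 2)%:R * Num.sqrt X%:R <= x `^ (1 / 2) * Q ^+ 2.
  by rewrite mulrC; apply: ler_pM; rewrite ?sqrtr_ge0.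
have t4 : (q ^ 2)%:R * X%:R * Num.sqrt theta <= x * Q ^+ 2 * theta `^ (1 / 2).
  by rewrite sth ler_wpM2r ?powR_ge0// mulrC; apply: ler_pM.
have p1 : 0 <= x `^ (1 / 2) * Q ^+ 2 by rewrite mulr_ge0 ?powR_ge0 ?sqr_ge0.
have p2 : 0 <= x `^ (5 / 6) * Q by rewrite mulr_ge0 ?powR_ge0.
have p4 : 0 <= x * Q ^+ 2 * theta `^ (1 / 2) by rewrite !mulr_ge0 ?powR_ge0 ?sqr_ge0.
have W0 : 0 <= W by rewrite /W !addr_ge0.
rewrite Xi_prim_sum -/q.
pose lam chi := sval (cid (max_twisted_sum_attained (@omega_ind R k) chi x th0)).
have lamth chi : `|lam chi| <= theta by rewrite /lam; case: cid => l [].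
have lamE chi : max_twisted_sum (@omega_ind R k) chi x theta =
   nrm (twisted_sum (@omega_ind R k) chi x (lam chi)).
  by rewrite /lam; case: cid => l [].
rewrite (eq_prim_sum q lamE).
have trivial_bound (t : R) : 0 <= t ->
    \sum_(1 <= n < X.+1) (bigomega n == k)%:R <= t ->
    prim_sum q (fun chi => nrm (twisted_sum (@omega_ind R k) chi x (lam chi))) <= t * (q ^ 2)%:R.
  move=> t0 ht; apply: le_trans (prim_sum_const q t0).
  apply: prim_sum_le => r chi /andP[r0 _] [dchi _].
  exact: le_trans (nrm_omega_ind_twist k x (lam chi) r0 dchi) ht.
(* The trivial cases leave room, the constant and the powers of y being >= 1. *)
have enough (t : R) : t <= 400 * W -> t <= 400 * type2_const * y ^+ 8 * W.
  by move=> h; apply: (le_trans h); rewrite ler_wpM2r.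
(* Omega(n) = 0 only for n = 1. *)
case: k kx @lam lamth lamE trivial_bound => [|k] kx lam lamth lamE trivial_bound.
  apply: enough; apply: (le_trans (trivial_bound 1 ler01 _)).
    rewrite big_ltn// [X in _ + X]big_nat [X in _ + X]big1 ?addr0.
      by rewrite lern1 leq_b1.
    by move=> n /andP[n1 _]; rewrite bigomega_eq0 ?(ltnW n1)// gtn_eqF.
  rewrite mul1r.
  have : (q ^ 2)%:R * 1 <= (q ^ 2)%:R * Num.sqrt X%:R :> R.
    by rewrite ler_wpM2l// -[X in X <= _]sqrtr1 ler_wsqrtr// ler1n.
  rewrite mulr1 /W; clear -t1 p1 p2 p4 x0; lra.
(* For theta > 1/2 the term x Q^2 theta^(1/2) exceeds half of the trivial
   bound x Q^2. *)
have [th2|th2] := leP theta 2^-1; last first.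
  apply: enough; apply: (le_trans (trivial_bound X%:R (ler0n _ _) _)).
    apply: (@le_trans _ _ (\sum_(1 <= n < X.+1) 1)).
      by apply: ler_sum => n _; rewrite lern1 leq_b1.
    by rewrite sumr_const_nat subSS subn0.
  have s2 : 2^-1 <= Num.sqrt theta.
    have -> : 2^-1 = Num.sqrt (2^-1 ^+ 2) :> R by rewrite sqrtr_sqr ger0_norm.
    by rewrite ler_wsqrtr//; rewrite expr2; lra.
  have u0 : 0 <= (q ^ 2)%:R * X%:R :> R by rewrite mulr_ge0.
  have := ler_wpM2l u0 s2; rewrite [X%:R * _]mulrC /W.
  clear -t4 p1 p2 p4 x0; lra.
have [Z /andP[ZX XZ]] := nat_cube_root X.
have Z0 : (0 < Z)%N.
  by rewrite lt0n; apply: contraTneq XZ => ->; rewrite exp1n ltnS leqn0 -lt0n.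
pose B := (trunc_log 2 X).+1.
have /andP[B1 XB] : (2 ^ B.-1 <= X < 2 ^ B)%N by exact: trunc_log_bounds.
have /andP[l2 l21] := @ln2_bounds R.
have By : B.+1%:R <= y.
  have h : (2 ^ B.-1)%:R <= x by apply: le_trans Xx; rewrite ler_nat.
  have h2 : ln (2 : R) * (B.-1)%:R <= ln x.
    rewrite mulr_natr -lnXn// -natrX ler_ln ?posrE ?ltr0n ?expn_gt0//; lra.
  have h3 : (B.-1)%:R * 2^-1 <= ln 2 * (B.-1)%:R :> R by rewrite mulrC ler_wpM2r.
  have -> : B.+1%:R = (B.-1)%:R + 2 :> R by rewrite -natrD addn2 /B.
  rewrite /y; lra.
have kB : (k < B)%N.
  rewrite -(ler_nat R); apply: (le_trans kx).
  have h : x <= (2 ^ B)%:R by apply: (le_trans (ltW xX)); rewrite ler_nat.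
  apply: (@le_trans _ _ (ln (2 ^ B)%:R)).
    by rewrite ler_ln ?posrE ?ltr0n ?expn_gt0//; lra.
  by rewrite natrX lnXn// -[leLHS]mulr_natr ler_piMl.
have main := @omega_prim_sum_le R q X B Z k theta lam q0 qX XB Z0 ZX XZ kB th2 lamth.
apply: (@le_trans _ _ (400 * type2_const * B.+1%:R ^+ 8 * target q X Z theta)); first exact: main.
have c0 : 0 <= 400 * type2_const :> R by lra.
apply: ler_pM.
- by apply: mulr_ge0 => //; exact: exprn_ge0.
- exact: target_ge0.
- by apply: ler_wpM2l => //; rewrite lerXn2r ?nnegrE ?(le_trans ler01 y1).
rewrite /target.
(* Z <= x^(1/3). *)
have Zx : Z%:R * Num.sqrt X%:R <= x `^ (5 / 6).
  have -> : (5 / 6 : R) = 3^-1 + 1 / 2 by lra.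
  rewrite powRD; last by apply/implyP => _; rewrite gt_eqF//; lra.
  apply: ler_pM; rewrite ?sqrtr_ge0//.
  have -> : Z%:R = (Z%:R ^+ 3) `^ 3^-1 :> R.
    rewrite -powR_mulrn// -powRrM divff ?powRr1// pnatr_eq0//.
  apply: ge0_ler_powR; rewrite ?nnegrE ?exprn_ge0//.
  by apply: le_trans Xx; rewrite -natrX ler_nat.
have t2 : q%:R * Z%:R * Num.sqrt X%:R <= x `^ (5 / 6) * Q.
  by rewrite -mulrA mulrC; apply: ler_pM; rewrite ?mulr_ge0 ?sqrtr_ge0.
rewrite /W; clear -t1 t2 t4 Xx; lra.
Qed.
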